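(* We have $$\lim_{\mu \to 1/2,\ \mu>\frac{1}{2}} \dim_H \underline{\mathrm{Sing}}^{\ast}_{2,1}(\mu)= \frac{4}{3}.$$
   Context: For $\theta\in\mathbb{R}^2$ let $|\theta|_\infty$ be the maximum of the absolute values of its coordinates and $\|\theta\|=\min_{p\in\mathbb{Z}^2}|\theta-p|_\infty$. The set $\underline{\mathrm{Sing}}^{\ast}_{2,1}(\mu)$ is the set of all $\theta=(\theta_1,\theta_2)\in\mathbb{R}^2$ such that the subgroup $\mathbb{Z}\theta+\mathbb{Z}^2$ of $\mathbb{R}^2$ has rank $3$ (equivalently, $1,\theta_1,\theta_2$ are linearly independent over $\mathbb{Q}$) and such that, for all sufficiently large real numbers $X$, there is an integer $q$ with $0<|q|\le X$ and $\|q\theta\|\le X^{-\mu}$. $\dim_H$ denotes Hausdorff dimension. *)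

(* Defs.v *)
From HB Require Import structures.
From mathcomp Require Import all_boot all_order all_algebra.
From mathcomp Require Import all_classical all_reals all_analysis.

Set Implicit Arguments.
Unset Strict Implicit.
Unset Printing Implicit Defensive.

Import Order.TTheory GRing.Theory Num.Theory.
Import numFieldNormedType.Exports.

Local Open Scope classical_set_scope.
Local Open Scope ring_scope.

Section hausdorff.
Context {R : realType} {V : normedModType R}.
Implicit Types (A : set V) (s delta : R).
Local Open Scope ereal_scope.

(* The extra element 0 only matters for the empty set, whose diameter would
   otherwise be -oo. *)
Definition diam A : \bar R :=
  ereal_sup (0 |` [set `|p.1 - p.2|%:E | p in A `*` A]).

(* diam(A)^s, with 0^0 = 1 for singletons, and the value 0 for the empty set
   even when s = 0, so that finite covers may be padded with empty sets. *)
Definition diam_pow s A : \bar R :=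
  if A == set0 then 0 else poweR (diam A) s.

Definition hausdorff_content s delta A : \bar R :=
  ereal_inf [set \sum_(0 <= n <oo) diam_pow s (U n) | U in
    [set U : nat -> set V |
      A `<=` \bigcup_n U n /\ forall n, diam (U n) <= delta%:E]].

Definition hausdorff_measure s A : \bar R :=
  ereal_sup [set hausdorff_content s delta A | delta in [set d | (0 < d)%R]].

Definition hausdorff_dim A : \bar R :=
  ereal_inf [set s%:E | s in [set s | (0 <= s)%R /\ hausdorff_measure s A = 0]].

End hausdorff.

Section rank.
Context {G : zmodType}.

Definition Zindependent n (v : 'I_n -> G) : Prop :=
  forall c : 'I_n -> int, \sum_i v i *~ c i = 0 -> forall i, c i = 0.

(* The rank of a subgroup is the maximal number of its elements that are
   linearly independent over the integers. *)
Definition has_rank (H : set G) (n : nat) : Prop :=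
  (exists v : 'I_n -> G, (forall i, H (v i)) /\ Zindependent v) /\
  (forall v : 'I_n.+1 -> G, (forall i, H (v i)) -> ~ Zindependent v).

End rank.

Section singular.
Context {R : realType}.
Implicit Types (theta : 'rV[R]_2) (mu : R).

Definition intvec (p : 'rV[int]_2) : 'rV[R]_2 := map_mx intr p.

(* The library norm on matrices is the maximum of the absolute values of the
   entries. The infimum is a minimum, as there are only finitely many integer
   points in any ball. *)
Definition dist_to_int theta : R :=
  inf [set `|theta - intvec p| | p in [set: 'rV[int]_2]].

Definition theta_group theta : set 'rV[R]_2 :=
  [set x | exists (q : int) (p : 'rV[int]_2), x = q%:~R *: theta + intvec p].

Definition Sing_star mu : set 'rV[R]_2 :=
  [set theta | has_rank (theta_group theta) 3 /\
    \forall X \near +oo_R, exists q : int,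
      [/\ 0 < `|q|, `|q|%:~R <= X
        & dist_to_int (q%:~R *: theta) <= X `^ (- mu)]].

End singular.

(* Main.v *)
(* Lower bound. A Cantor set is grown from unimodular triples (V, W, Q) of
   integer vectors. Write Q = (p1, p2, q), with q of order T, and suppose that the
   projection of W along Q has length of order h / T, where h = T ^ (1/2 - kappa).
   Such a node has about h'^2 T' / T^2 children at the next scale T' = T ^ gamma,
   with centers (p1/q, p2/q) separated by h' / T'^2. The mass distribution
   principle gives dimension close to 4/3 as kappa and gamma - 1 tend to 0, and
   the denominators q show that every limit point is singular with an exponent
   mu > 1/2.

   Upper bound. Rational lines have dimension 1. A singular theta outside them is
   followed along pairs (Q, H): Q is a best approximation of denominator q, and
   the primitive vector H is normal to a plane containing Q but not the next best
   approximation. Singularity gives |H| <= C q ^ (1 - mu), which is far smaller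
   than q ^ (1/2), and puts theta within C |H| / q^2 of (p1/q, p2/q). The next
   pair (U, H') is determined by (Q, H) and four integers m, j, m', j', where
   H x H' = m Q and Q x U = m' H'. For s > 4/3 the weight
   |H| ^ (3s - 4) q ^ (2 - 3s), an upper estimate of (|H| / q^2) ^ s, shrinks by a
   factor summable over these four labels, so the s-dimensional measure is 0. *)
Require Import Defs.
From mathcomp Require Import all_boot all_order all_algebra.
From mathcomp Require Import all_classical all_reals all_analysis.
From mathcomp Require Import ring lra zify.
Import Order.TTheory GRing.Theory Num.Theory.
Import numFieldNormedType.Exports.
Set Implicit Arguments.
Unset Strict Implicit.
Unset Printing Implicit Defensive.
Local Open Scope classical_set_scope.
Local Open Scope ring_scope.

(** Where 4/3 comes from. With [h] near [T ^ (1/2)], a node has about [T ^ (2 (gamma - 1))]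
    children; at mutual distance [h' / T'^2] they would fill a square of side about
    [T ^ (-(1 + gamma/2))]. This side shrinks by [T ^ ((1 + gamma/2) (gamma - 1))] per generation,
    so the dimension is near [2 / (1 + gamma/2)], which tends to 2 / (3/2). From above, four
    inequalities, one for each label, are raised to powers and multiplied. The power of [q] comes
    from those for [m] and [j'], that of [u] from those for [m'] and [j'], and both must be
    [3s - 2]. The label sums converge only if every exponent exceeds 1, which forces [3s - 2 > 2].
    The assumption [mu > 1/2] enters as a surplus power [|H'| ^ (-eta/2)], which absorbs all
    constants once the denominators are large. No measure is built for the lower bound: a cover of
    small total weight is tested against the tree, and averaging over children finds a branch whose
    limit point the cover misses. *)

Section powR_facts.
Context {R : realType}.
Implicit Types a b x y : R.

Lemma powR_le a b x : 0 <= a -> a <= b -> 0 <= x -> a `^ x <= b `^ x.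
Proof. by move=> a0 ab x0; rewrite ge0_ler_powR ?nnegrE // (le_trans a0). Qed.

Lemma powR_ge1 a x : 1 <= a -> 0 <= x -> 1 <= a `^ x.
Proof. by move=> a1 x0; have := powR_le ler01 a1 x0; rewrite powR1. Qed.

Lemma powR_le1 a x : 0 <= a -> a <= 1 -> 0 <= x -> a `^ x <= 1.
Proof. by move=> a0 a1 x0; have := powR_le a0 a1 x0; rewrite powR1. Qed.

Lemma powR_leN a b x : 0 < a -> a <= b -> x <= 0 -> b `^ x <= a `^ x.
Proof.
move=> a0 ab x0; rewrite -[x]opprK [leLHS]powRN [leRHS]powRN.
have b0 := lt_le_trans a0 ab.
by rewrite lef_pV2 ?posrE ?powR_gt0 // powR_le ?oppr_ge0 // ltW.
Qed.

Lemma powR_add a x y : 0 < a -> a `^ (x + y) = a `^ x * a `^ y.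
Proof. by move=> a0; rewrite powRD // (gt_eqF a0) implybT. Qed.

Lemma powR_unbounded (B x : R) : 0 < x -> exists T0 : R, 1 <= T0 /\ forall a, T0 <= a -> B <= a `^ x.
Proof.
move=> x0; exists (Num.max 1 (Num.max 1 B `^ x^-1)); split; first by rewrite le_max lexx.
move=> a; rewrite ge_max => /andP[a1 aB].
have : (Num.max 1 B `^ x^-1) `^ x <= a `^ x by apply: powR_le => //; [exact: powR_ge0|exact: ltW].
rewrite -powRrM mulVf ?gt_eqF // powRr1; last by rewrite le_max ler01.
by rewrite ge_max => /andP[].
Qed.

End powR_facts.

(** * Hausdorff content and measure *)

Section content.
Context {R : realType} {V : normedModType R}.
Implicit Types (A : set V) (s delta : R).
Local Open Scope ereal_scope.

Lemma diam_ge0 A : 0 <= diam A.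
Proof. by apply: ereal_sup_ubound; left. Qed.

Lemma diam_pow_ge0 s A : 0 <= diam_pow s A.
Proof. by rewrite /diam_pow; case: ifP => // _; exact: poweR_ge0. Qed.

Lemma diam_set0 : diam (set0 : set V) = 0.
Proof.
apply/eqP; rewrite eq_le diam_ge0 andbT.
by apply: ge_ereal_sup => x [->//|[p [[]]]].
Qed.

Lemma diam_pow_set0 s : diam_pow s (set0 : set V) = 0.
Proof. by rewrite /diam_pow eqxx. Qed.

Lemma diam_leP A (r : R) : (0 <= r)%R ->
  (forall x y, A x -> A y -> (`|x - y| <= r)%R) -> diam A <= r%:E.
Proof.
move=> r0 h; apply: ge_ereal_sup => x [->|]; first by rewrite lee_fin.
by move=> [[a b] /= [Aa Ab] <-]; rewrite lee_fin; exact: h.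
Qed.

Lemma dist_le_diam A x y : A x -> A y -> (`|x - y|%:E <= diam A).
Proof. by move=> Ax Ay; apply: ereal_sup_ubound; right; exists (x, y). Qed.

Lemma diam_pow_le s A (r : R) : (0 <= r)%R -> (0 <= s)%R ->
  (forall x y, A x -> A y -> (`|x - y| <= r)%R) ->
  diam_pow s A <= (r `^ s)%:E.
Proof.
move=> r0 s0 h; rewrite /diam_pow; case: ifP => _.
  by rewrite lee_fin powR_ge0.
rewrite -poweR_EFin gt0_ler_poweR//.
- by rewrite in_itv /= diam_ge0 leey.
- by rewrite in_itv /= leey lee_fin r0.
- exact: diam_leP.
Qed.

Lemma content_ge0 s delta A : 0 <= hausdorff_content s delta A.
Proof.
apply: le_ereal_inf_tmp => x [U _ <-].
by apply: nneseries_ge0 => n _ _; exact: diam_pow_ge0.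
Qed.

Lemma content_mono s delta A B : A `<=` B ->
  hausdorff_content s delta A <= hausdorff_content s delta B.
Proof.
move=> AB; apply: ereal_inf_le_tmp => x [U [BU dU] <-].
by exists U => //; split => //; exact: subset_trans BU.
Qed.

Lemma content_set0 s delta : (0 <= delta)%R ->
  hausdorff_content s delta (set0 : set V) = 0.
Proof.
move=> d0; apply/eqP; rewrite eq_le content_ge0 andbT.
apply: ereal_inf_lbound; exists (fun=> set0).
  by split => // n; rewrite diam_set0 lee_fin.
by apply: eseries0 => n _ _; exact: diam_pow_set0.
Qed.

Lemma content_le1 s delta A (r : R) : (0 <= r)%R -> (0 < s)%R ->
  (r <= delta)%R -> (forall x y, A x -> A y -> (`|x - y| <= r)%R) ->
  hausdorff_content s delta A <= (r `^ s)%:E.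
Proof.
move=> r0 s0 rd h.
apply: (@le_trans _ _ (\sum_(0 <= n <oo) diam_pow s (if n == 0%N then A else set0))).
  apply: ereal_inf_lbound; exists (fun n => if n == 0%N then A else set0) => //.
  split; first by move=> x Ax; exists 0%N.
  move=> n; case: ifP => _.
    by apply: (@le_trans _ _ r%:E); [exact: diam_leP | rewrite lee_fin].
  by rewrite diam_set0 lee_fin (le_trans r0).
rewrite (nneseries_recl (fun n _ => diam_pow_ge0 _ _)) //=.
rewrite [X in _ + X]eseries0 ?adde0; first by apply: diam_pow_le => //; exact: ltW.
by move=> i i1 _; case: i i1 => // i _; rewrite diam_pow_set0.
Qed.

Lemma content_sigma_subadditive s delta (A : nat -> set V) :
  hausdorff_content s delta (\bigcup_n A n)
  <= \sum_(0 <= n <oo) hausdorff_content s delta (A n).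
Proof.
(* An infinite term makes the bound trivial. Otherwise each [A n] has a cover within [e / 2 ^ n.+1]
   of its content, and a bijection of [nat] with pairs merges these covers into one sequence. *)
have [[i ioo]|] := pselect (exists i, hausdorff_content s delta (A i) = +oo).
  rewrite (eseries_pinfty _ _ ioo) ?leey// => n _.
  by rewrite -ltNye (lt_le_trans _ (content_ge0 _ _ _)).
rewrite -forallNE => fin.
apply/lee_addgt0Pr => e e0.
apply: le_trans (epsilon_trick xpredT _ (ltW e0)); last first.
  by move=> n; exact: content_ge0.
have [U UP] : {U : nat -> nat -> set V & forall n,
    (A n `<=` \bigcup_k U n k /\ forall k, diam (U n k) <= delta%:E) /\
    \sum_(0 <= k <oo) diam_pow s (U n k)
      <= hausdorff_content s delta (A n) + (e / (2 ^ n.+1)%:R)%:E}.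
  pose P n (U : nat -> set V) :=
    (A n `<=` \bigcup_k U k /\ forall k, diam (U k) <= delta%:E) /\
    \sum_(0 <= k <oo) diam_pow s (U k)
      <= hausdorff_content s delta (A n) + (e / (2 ^ n.+1)%:R)%:E.
  apply: (@choice _ _ P) => n.
  have en : (0 < e / (2 ^ n.+1)%:R)%R by rewrite divr_gt0// ltr0n expn_gt0.
  have ffin : hausdorff_content s delta (A n) \is a fin_num.
    by rewrite ge0_fin_numE ?content_ge0// ltey; apply/eqP; exact: fin.
  have [x [U UP <-] /ltW xle] := lb_ereal_inf_adherent en ffin.
  by exists U.
have /card_esym/ppcard_eqP[f] := card_nat2.
have fbij : set_bij [set: nat] [set: nat * nat] f by exact: bij.
pose g k := U (f k).1 (f k).2.
apply: (@le_trans _ _ (\sum_(0 <= k <oo) diam_pow s (g k))).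
  apply: ereal_inf_lbound; exists g => //; split; last first.
    by move=> k; exact: (UP _).1.2.
  move=> x [n _ Anx]; have [k _ Ux] := (UP n).1.1 _ Anx.
  by exists (f^-1%FUN (n, k)) => //; rewrite /g invK ?inE.
rewrite (nneseries_esum (fun n _ => diam_pow_ge0 _ _)).
rewrite [X in esum X](_ : _ = [set: nat]); last by apply/seteqP; split.
rewrite -(reindex_esum [set: nat] [set: nat * nat] f (fun p => diam_pow s (U p.1 p.2))) //.
rewrite [X in esum X](_ : _ = [set: nat] `*`` (fun=> [set: nat])); last first.
  by apply/seteqP; split.
rewrite -(esum_esum (a := fun i j => diam_pow s (U i j))); last first.
  by move=> *; exact: diam_pow_ge0.
rewrite nneseries_esum; last first.
  by move=> n _; rewrite adde_ge0 ?content_ge0// lee_fin divr_ge0// ltW.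
rewrite [X in _ <= esum X _](_ : _ = [set: nat]); last by apply/seteqP; split.
apply: le_esum => n _.
apply: le_trans (UP n).2.
rewrite nneseries_esum; last by move=> *; exact: diam_pow_ge0.
by rewrite [X in _ <= esum X _](_ : _ = [set: nat]) //; apply/seteqP; split.
Qed.

Lemma content_bigcup_le s delta (A : nat -> set V) (B Z : R) (a : nat -> R) :
  (0 <= B)%R -> (forall n, 0 <= a n)%R ->
  \sum_(0 <= n <oo) (a n)%:E <= Z%:E ->
  (forall n, hausdorff_content s delta (A n) <= (B * a n)%:E) ->
  hausdorff_content s delta (\bigcup_n A n) <= (B * Z)%:E.
Proof.
move=> B0 a0 aZ h; apply: le_trans (content_sigma_subadditive _ _ _) _.
apply: (@le_trans _ _ (\sum_(0 <= n <oo) (B%:E * (a n)%:E))).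
  apply: lee_nneseries => [n _ _|n _]; first exact: content_ge0.
  by rewrite -EFinM.
rewrite nneseriesZl; last by move=> n _; rewrite lee_fin.
by rewrite EFinM lee_wpmul2l// lee_fin.
Qed.

Lemma measure0P s A :
  hausdorff_measure s A = 0 <-> (forall delta, (0 < delta)%R -> hausdorff_content s delta A = 0).
Proof.
split=> h.
  move=> d d0; apply/eqP; rewrite eq_le content_ge0 andbT -h.
  by apply: ereal_sup_ubound; exists d.
apply/eqP; rewrite eq_le; apply/andP; split.
  by apply: ge_ereal_sup => x [d /= d0 <-]; rewrite h.
by rewrite -(h 1%R ltr01); apply: ereal_sup_ubound; exists 1%R => //=.
Qed.

Lemma measure0_bigcup s (A : nat -> set V) :
  (forall n, hausdorff_measure s (A n) = 0) -> hausdorff_measure s (\bigcup_n A n) = 0.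
Proof.
move=> h; apply/measure0P => d d0; apply/eqP; rewrite eq_le content_ge0 andbT.
apply: le_trans (content_sigma_subadditive _ _ _) _.
by rewrite eseries0 // => n _ _; exact: (measure0P _ _).1.
Qed.

Lemma measure0_sub s A B : A `<=` B -> hausdorff_measure s B = 0 -> hausdorff_measure s A = 0.
Proof.
move=> AB /measure0P h; apply/measure0P => d d0; apply/eqP; rewrite eq_le content_ge0 andbT.
by rewrite -(h d d0) content_mono.
Qed.

Lemma measure0_mono s t A : (0 <= s <= t)%R -> hausdorff_measure s A = 0 -> hausdorff_measure t A = 0.
Proof.
move=> /andP[s0 st] /measure0P h; apply/measure0P => d d0.
apply/eqP; rewrite eq_le content_ge0 andbT.
(* Diameters at most 1 make powers decrease as the exponent grows; shrinking [d] is harmless because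
   the content vanishes at every scale. *)
pose d1 := Num.min d 1%R.
have d10 : (0 < d1)%R by rewrite lt_min d0 ltr01.
rewrite -(h _ d10); apply: le_ereal_inf_tmp => x [U [AU dU] <-].
apply: (@le_trans _ _ (\sum_(0 <= n <oo) diam_pow t (U n))).
  apply: ereal_inf_lbound; exists U => //; split => // n.
  by apply: le_trans (dU n) _; rewrite lee_fin ge_min lexx.
apply: lee_nneseries => [n _ _|n _]; first exact: diam_pow_ge0.
rewrite /diam_pow; case: ifP => // _.
have := dU n; have := diam_ge0 (U n).
case: (diam (U n)) => [r| |]//; rewrite !lee_fin => r0 rd1.
have r1 : (r <= 1)%R by rewrite (le_trans rd1)// ge_min lexx orbT.
have [->|rn0] := eqVneq r 0%R; last first.
  by apply: ger_powR => //; rewrite r1 andbT lt_def rn0.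
have [->|sn0] := eqVneq s 0%R; last by rewrite !powR0 // gt_eqF// (lt_le_trans _ st)// lt_def sn0.
rewrite powRr0; have [->|tn0] := eqVneq t 0%R; first by rewrite powRr0.
by rewrite powR0.
Qed.

Lemma dim_ge s A : (0 <= s)%R -> hausdorff_measure s A != 0 -> s%:E <= hausdorff_dim A.
Proof.
move=> s0 /eqP h; apply: le_ereal_inf_tmp => x [t [t0 mt] <-].
rewrite lee_fin leNgt; apply/negP => ts; apply: h.
by apply: (measure0_mono (s := t)) => //; rewrite t0 ltW.
Qed.

Lemma dim_le s A : (0 <= s)%R -> hausdorff_measure s A = 0 -> hausdorff_dim A <= s%:E.
Proof. by move=> s0 h; apply: ereal_inf_lbound; exists s. Qed.

End content.

(** * The maximum norm of the plane *)

Section plane_norm.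
Context {R : realType}.
Implicit Types (v : 'rV[R]_2).

Lemma ord2P (l : 'I_2) : l = 0 \/ l = 1.
Proof. by case: l => -[|[|//]] jlt; [left|right]; exact/val_inj. Qed.

Lemma norm2_le v (r : R) : (`|v| <= r) = (`|v 0 0| <= r) && (`|v 0 1| <= r).
Proof.
rewrite [`|v|]mx_normrE; apply/idP/andP => [h|[h0 h1]].
  by split; apply: le_trans h;
    [exact: (le_bigmax _ (fun ij => `|v ij.1 ij.2|) (0, 0))|
     exact: (le_bigmax _ (fun ij => `|v ij.1 ij.2|) (0, 1))].
apply/bigmax_leP; split => [|[i j] _ /=]; first exact: le_trans (normr_ge0 _) h0.
by rewrite (ord1 i); case: (ord2P j) => ->.
Qed.

Lemma norm2_ge v (g : R) : g <= `|v| -> (g <= `|v 0 0|) \/ (g <= `|v 0 1|).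
Proof.
move=> h; have [h0|h0] := leP g `|v 0 0|; first by left.
right; rewrite leNgt; apply/negP => h1.
have : Num.max `|v 0 0| `|v 0 1| < g by rewrite gt_max h0 h1.
apply/negP; rewrite -leNgt; apply: le_trans h _.
by rewrite norm2_le !le_max !lexx orbT.
Qed.

End plane_norm.

(** * Mass distribution on a Cantor set *)

Section packing.
Context {R : realType}.

Lemma truncn_dist (x y : R) : 0 <= x -> 0 <= y ->
  Num.truncn x = Num.truncn y -> `|x - y| < 1.
Proof.
move=> x0 y0 e; have /andP[] := truncn_itv x0; have /andP[] := truncn_itv y0.
by rewrite e -natr1 => *; rewrite ltr_norml; lra.
Qed.

(* Pigeonhole on the half-open cells of a square grid of mesh [g]. *)
Lemma packing (n : nat) (p : 'I_n -> 'rV[R]_2) (P : {set 'I_n}) (g D : R) :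
  0 < g -> 0 <= D ->
  (forall i j, i != j -> g <= `|p i - p j|) ->
  {in P &, forall i j, `|p i - p j| <= D} ->
  #|P|%:R <= (2 * D / g + 1) ^+ 2.
Proof.
move=> g0 D0 sep close.
have [i0 i0P|P0] := pickP (mem P); last by rewrite eq_card0 // sqr_ge0.
(* Coordinates in units of [g], measured from the corner of the square of half-side [D] around
   [p i0]. *)
pose t i (l : 'I_2) := (p i 0 l - p i0 0 l + D) / g.
pose M := (Num.truncn (2 * D / g)).+1.
have tb i l : i \in P -> 0 <= t i l <= 2 * D / g.
  move=> iP; have := close _ _ iP i0P; rewrite norm2_le.
  move=> /andP[h0 h1].
  have : `|p i 0 l - p i0 0 l| <= D by move: h0 h1; rewrite !mxE; case: (ord2P l) => ->.
  rewrite ler_norml /t => /andP[t1 t2].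
  by rewrite divr_ge0 ?ler_pM2r ?invr_gt0 ?(ltW g0) //=; lra.
pose f i : 'I_M * 'I_M := (inord (Num.truncn (t i 0)), inord (Num.truncn (t i 1))).
have tM i l : i \in P -> (Num.truncn (t i l) < M)%N.
  by move=> /(tb _ l)/andP[_ h]; rewrite ltnS; exact: le_truncn.
have finj : {in P &, injective f}.
  move=> i j iP jP [] /(congr1 val) /= + /(congr1 val) /=.
  rewrite !inordK ?tM // => e0 e1; apply/eqP/negPn/negP => /sep ij.
  have key l : Num.truncn (t i l) = Num.truncn (t j l) -> `|(p i - p j) 0 l| < g.
    move=> e; have /andP[ti _] := tb _ l iP; have /andP[tj _] := tb _ l jP.
    have := truncn_dist ti tj e; rewrite /t -mulrBl normrM normfV (gtr0_norm g0).
    rewrite ltr_pdivrMr // mul1r !mxE.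
    by rewrite opprD addrACA subrr addr0 opprB addrA subrK.
  by case: (norm2_ge ij) => h; [have := key _ e0 | have := key _ e1];
     rewrite ltNge h.
have : (#|P| <= M * M)%N.
  by rewrite -(card_in_imset finj) (leq_trans (max_card _)) // card_prod !card_ord.
rewrite -(ler_nat R) natrM => /le_trans; apply; rewrite -expr2.
have MM : M%:R <= 2 * D / g + 1.
  by rewrite /M -natr1 lerD2r ?truncn_le // divr_ge0 ?(ltW g0) // mulr_ge0.
by rewrite lerXn2r ?nnegrE ?(le_trans _ MM).
Qed.

End packing.

Section cantor.
Context {R : realType} {N : Type}.
Variables (good : nat -> N -> Prop) (c : N -> 'rV[R]_2).
(** [omega k] need not be the radius [rho k]: it is the scale at which a node is charged, a set of
    diameter [r] being credited with at most [(r / omega k) ^ s] of the node. [omega_m] keeps this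
    consistent for sets that meet at most one child, [omega_g] for sets that may meet many. *)
Variables (rho g omega m : nat -> R) (s : R).
Hypothesis s02 : 0 < s <= 2.
Hypothesis rho0 : forall k, 0 <= rho k.
Hypothesis g0 : forall k, 0 < g k.
Hypothesis omega0 : forall k, 0 < omega k.
Hypothesis omega_to0 : forall e, 0 < e -> exists k, omega k < e.
Hypothesis rho_g : forall k, 4 * rho k.+1 <= g k.
Hypothesis omega_m : forall k, (omega k / omega k.+1) `^ s <= m k.
Hypothesis omega_g : forall k, 100 * omega k ^+ 2 <= g k ^+ 2 * m k.
Hypothesis children : forall k x, good k x -> exists n (y : 'I_n -> N),
  [/\ m k <= n%:R,
      forall i, [/\ good k.+1 (y i), `|c (y i) - c x| + rho k.+1 <= rho k
                  & c (y i) != c x] &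
      forall i j, i != j -> g k <= `|c (y i) - c (y j)|].

Let meets k x (U : set 'rV[R]_2) : bool :=
  `[< exists2 t, U t & `|t - c x| <= rho k >].

(* An upper estimate for the proportion of the part of the limit set below the
   node [x] that lies in a set [U] of diameter at most [r]. *)
Let share k x U (r : R) : R := if meets k x U then Num.min 1 ((r / omega k) `^ s) else 0.

Let s0 : 0 < s. Proof. by case/andP: s02. Qed.

Let share_ge0 k x U r : 0 <= share k x U r.
Proof. by rewrite /share; case: ifP => // _; rewrite le_min ler01 powR_ge0. Qed.

Let m0 k : 0 < m k.
Proof. by apply: lt_le_trans (omega_m k); rewrite powR_gt0 // divr_gt0. Qed.

(** Three ranges of [r]. If [r >= omega k], the parent has share 1. If [4 r < g k], at most one
    child is met and [omega_m] suffices. In between, packing bounds the number of children met by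
    [(10 r / g k) ^ 2], hence by [m k (r / omega k) ^ 2], and the exponent 2 may be lowered to [s]
    because [r < omega k]. *)
Lemma share_children k x n (y : 'I_n -> N) (U : set 'rV[R]_2) (r : R) :
  m k <= n%:R ->
  (forall i, `|c (y i) - c x| + rho k.+1 <= rho k) ->
  (forall i j, i != j -> g k <= `|c (y i) - c (y j)|) ->
  0 < r -> (forall t u, U t -> U u -> `|t - u| <= r) ->
  \sum_(i < n) share k.+1 (y i) U r <= n%:R * share k x U r.
Proof.
move=> mn near sep r0 dU.
pose P := [set i | meets k.+1 (y i) U]%SET.
have sumE a : \sum_(i < n) (if meets k.+1 (y i) U then a else 0) = a * #|P|%:R.
  rewrite -big_mkcond /= (eq_bigl (mem P)); last by move=> i; rewrite /P !inE.
  by rewrite sumr_const mulr_natr.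
rewrite /share sumE.
case: ifPn => [xU|/negP xU]; last first.
  rewrite mulr0 (_ : P = finset.set0) ?cards0 ?mulr0 //.
  apply/setP => i; rewrite !inE; apply/negP => /asboolP[t Ut tr]; apply: xU.
  apply/asboolP; exists t => //; apply: le_trans (near i).
  rewrite -(subrK (c (y i)) t) -addrA; apply: le_trans (ler_normD _ _) _.
  by move: tr; lra.
have Pn : #|P|%:R <= n%:R :> R.
  by rewrite ler_nat -[leqRHS]card_ord; exact: max_card.
have minge0 : 0 <= Num.min 1 ((r / omega k.+1) `^ s) by rewrite le_min ler01 powR_ge0.
have [rom|rom] := leP 1 (r / omega k).
  rewrite [in leRHS](min_idPl _) ?mulr1.
    apply: le_trans Pn; rewrite -[leRHS]mul1r ler_wpM2r // ge_min lexx //.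
  by rewrite powR_ge1 // ltW.
have rom0 : 0 < r / omega k by rewrite divr_gt0.
have rs1 : (r / omega k) `^ s <= 1.
  by rewrite powR_le1 ?(ltW s0) // !ltW.
rewrite (min_idPr rs1).
have Pclose : {in P &, forall i j, `|c (y i) - c (y j)| <= r + g k / 2}.
  move=> i j iP jP.
  have /asboolP[t Ut tr] : meets k.+1 (y i) U by move: iP; rewrite inE.
  have /asboolP[u Uu ur] : meets k.+1 (y j) U by move: jP; rewrite inE.
  have -> : c (y i) - c (y j) = (c (y i) - t) + (t - u) + (u - c (y j)).
    by rewrite !addrA !subrK.
  apply: le_trans (ler_normD _ _) _; apply: le_trans (lerD (ler_normD _ _) (lexx _)) _.
  have := dU _ _ Ut Uu; have := rho_g k; rewrite distrC in tr; lra.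
have [gr|gr] := ltP (4 * r) (g k).
  have P1 : (#|P| <= 1)%N.
    apply/card_le1_eqP => i j iP jP; apply/eqP/negPn/negP => /sep.
    by have := Pclose _ _ jP iP; have := g0 k; lra.
  apply: (@le_trans _ _ ((r / omega k.+1) `^ s)).
    rewrite -[leRHS]mulr1 ler_pM // ?ge_min ?lexx ?orbT //.
    by rewrite -[leRHS]/(1%:R) ler_nat.
  have -> : r / omega k.+1 = (omega k / omega k.+1) * (r / omega k).
    by have := omega0 k; have := omega0 k.+1; move=> *; field; rewrite !gt_eqF.
  rewrite powRM ?ler_wpM2r ?powR_ge0 ?divr_ge0 ?(ltW (omega0 _)) ?(ltW r0) //.
  exact: le_trans (omega_m k) mn.
have gk := g0 k.
have D0 : 0 <= r + g k / 2 by lra.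
have cardP := packing gk D0 sep Pclose.
apply: (@le_trans _ _ (1 * #|P|%:R)); first by rewrite ler_wpM2r // ge_min lexx.
rewrite mul1r; apply: le_trans cardP _.
(* [r / g k >= 1/4] gives [2 (r / g k) + 2 <= 10 (r / g k)], the source of the constant 100 in
   [omega_g]. *)
apply: (@le_trans _ _ ((10 * (r / g k)) ^+ 2)).
  have -> : 2 * (r + g k / 2) / g k + 1 = 2 * (r / g k) + 2 by field; rewrite gt_eqF.
  have : 1 / 4 <= r / g k by rewrite ler_pdivlMr //; lra.
  by move=> ?; rewrite lerXn2r ?nnegrE //; lra.
apply: (@le_trans _ _ (m k * (r / omega k) ^+ 2)).
  have om := omega0 k.
  have -> : (10 * (r / g k)) ^+ 2 = (r / (g k * omega k)) ^+ 2 * (100 * omega k ^+ 2).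
    by field; rewrite !gt_eqF.
  have -> : m k * (r / omega k) ^+ 2 = (r / (g k * omega k)) ^+ 2 * (g k ^+ 2 * m k).
    by field; rewrite !gt_eqF.
  by rewrite ler_wpM2l ?sqr_ge0.
apply: ler_pM => //; [exact: ltW|exact: sqr_ge0|].
rewrite -powR_mulrn ?(ltW rom0) //; apply: ger_powR; first by rewrite rom0 ltW.
by case/andP: s02.
Qed.

Let potential k x (U : nat -> set 'rV[R]_2) (r : nat -> R) : \bar R :=
  (\sum_(0 <= j <oo) (share k x (U j) (r j))%:E)%E.

(** The potentials of the children average to at most that of the parent, so some child keeps the
    potential below 1. *)
Lemma potential_child k x (U : nat -> set 'rV[R]_2) (r : nat -> R) :
  (forall j, 0 < r j) -> (forall j t u, U j t -> U j u -> `|t - u| <= r j) ->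
  good k x -> (potential k x U r < 1)%E ->
  exists y, [/\ good k.+1 y, `|c y - c x| + rho k.+1 <= rho k, c y != c x &
    (potential k.+1 y U r < 1)%E].
Proof.
move=> r0 dU gx px; have [n [y [mn hy sep]]] := children gx.
have n0 : (0 < n%:R :> R) by exact: lt_le_trans (m0 k) mn.
have [[i pi]|nopi] := pselect (exists i, (potential k.+1 (y i) U r < 1)%E).
  by have [h1 h2 h3] := hy i; exists (y i).
exfalso.
have : (\sum_(i < n) potential k.+1 (y i) U r <= n%:R%:E * potential k x U r)%E.
  rewrite /potential -nneseries_sum; last by move=> i j _; rewrite lee_fin share_ge0.
  rewrite -nneseriesZl; last by move=> j _; rewrite lee_fin share_ge0.
  apply: lee_nneseries => j _.
    by move=> _; apply: sume_ge0 => i _; rewrite lee_fin share_ge0.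
  rewrite sumEFin -EFinM lee_fin; apply: share_children => // [i|t u].
    by have [] := hy i.
  exact: dU.
apply/negP; rewrite -ltNge.
apply: (@lt_le_trans _ _ (n%:R%:E)).
  by rewrite -[ltRHS]mule1 lte_pmul2l // ltry.
apply: (@le_trans _ _ (\sum_(i < n) 1%:E)%E).
  by rewrite sumEFin lee_fin sumr_const card_ord.
apply: lee_sum => i _; rewrite leNgt; apply/negP => h; apply: nopi.
by exists i.
Qed.

(** If the content vanished, some cover would have so little weight that the root has potential
    below 1. Descending through children of potential below 1 leads to a point of [E], hence of some
    [U n]. As soon as [omega k < r n], this one set already contributes 1 to the potential of [x k],
    a contradiction. *)
Theorem cantor_measure_neq0 (E : set 'rV[R]_2) x0 : good 0 x0 ->
  (forall x t, (forall k, [/\ good k (x k), c (x k.+1) != c (x k) & `|t - c (x k)| <= rho k]) ->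
     E t) ->
  hausdorff_measure s E != 0%E.
Proof.
move=> gx0 Elim; apply/eqP => /measure0P /(_ 1 ltr01) content0.
pose e := omega 0%N `^ s / 2.
have e0 : 0 < e by rewrite divr_gt0 // powR_gt0.
have [_ [U [EU dU] <-]] : exists2 z, [set (\sum_(0 <= n <oo) diam_pow s (U n))%E | U in
    [set U : nat -> set 'rV[R]_2 |
      E `<=` \bigcup_n U n /\ forall n, (diam (U n) <= 1%:E)%E]] z & (z < e%:E)%E.
  have ffin : hausdorff_content s 1 E \is a fin_num by rewrite content0.
  have [z hz] := lb_ereal_inf_adherent e0 ffin.
  by rewrite -/(hausdorff_content s 1 E) content0 add0e => ze; exists z.
move=> sumU.
have dpfin j : exists2 d, 0 <= d & diam_pow s (U j) = d%:E.
  have := diam_pow_ge0 s (U j); have := dU j; have := diam_ge0 (U j).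
  rewrite /diam_pow; case: ifP => [_ _ _ _|_]; first by exists 0.
  by case: (diam (U j)) => [d| |] // _ _; rewrite poweR_EFin; exists (d `^ s) => //; exact: powR_ge0.
have [d d0 dE] : exists2 d : nat -> R, (forall j, 0 <= d j) & forall j, diam_pow s (U j) = (d j)%:E.
  have [d hd] : {d : nat -> R & forall j, 0 <= d j /\ diam_pow s (U j) = (d j)%:E}.
    by apply: (@choice _ _ (fun j (d : R) => 0 <= d /\ diam_pow s (U j) = d%:E)) => j;
       have [z] := dpfin j; exists z.
  by exists d => j; have [] := hd j.
(* The surplus, of total [e], makes [r j] positive also for sets that are empty or a single
   point. *)
pose q j := d j + e / (2 ^ j.+1)%:R.
have q0 j : 0 < q j by rewrite ltr_wpDl // divr_gt0 // ltr0n expn_gt0.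
pose r j := q j `^ s^-1.
have r0 j : 0 < r j by rewrite powR_gt0.
have rs j : r j `^ s = q j.
  by rewrite -powRrM mulVf ?gt_eqF // powRr1 // ltW.
have dr j t u : U j t -> U j u -> `|t - u| <= r j.
  move=> Ut Uu; have := dist_le_diam Ut Uu; have := dE j; have := dU j.
  rewrite /diam_pow; case: ifPn => [/eqP Uj0|_]; first by rewrite Uj0 in Ut.
  have := diam_ge0 (U j); case: (diam (U j)) => [z| |] // z0 _ [zE].
  rewrite lee_fin => /le_trans; apply; rewrite lee_fin in z0.
  rewrite -[z]powRr1 // -(@mulfV _ s) ?gt_eqF // powRrM zE.
  apply: powR_le; rewrite ?invr_ge0 ?(ltW s0) //.
  by rewrite lerDl divr_ge0 // ltW.
have p0 : (potential 0 x0 U r < 1)%E.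
  have -> : 1%E = ((omega 0%N `^ s)^-1%:E * (omega 0%N `^ s)%:E)%E :> \bar R.
    by rewrite -EFinM mulVf // gt_eqF // powR_gt0.
  apply: (@le_lt_trans _ _ ((omega 0%N `^ s)^-1%:E * \sum_(0 <= j <oo) (q j)%:E)%E).
    rewrite -nneseriesZl; last by move=> j _; rewrite lee_fin ltW.
    apply: lee_nneseries => [j _ _|j _]; first by rewrite lee_fin share_ge0.
    rewrite -EFinM lee_fin /share; case: ifP => _; last first.
      by rewrite mulr_ge0 ?invr_ge0 ?powR_ge0 // ltW.
    rewrite ge_min; apply/orP; right.
    by rewrite powRM ?invr_ge0 ?(ltW (r0 _)) ?(ltW (omega0 _)) // rs mulrC
       -powR_inv1 ?(ltW (omega0 _)) // -powRrM mulN1r powRN.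
  rewrite lte_pmul2l // ?lte_fin ?invr_gt0 ?powR_gt0 //.
  apply: (@le_lt_trans _ _ (\sum_(0 <= j <oo) diam_pow s (U j) + e%:E)%E).
    rewrite (eq_eseriesr (g := fun j => (diam_pow s (U j) + (e / (2 ^ j.+1)%:R)%:E)%E)).
      by apply: epsilon_trick (ltW e0) => j; exact: diam_pow_ge0.
    by move=> j _; rewrite dE -EFinD.
  apply: (@lt_le_trans _ _ (e%:E + e%:E)%E); first by rewrite lte_leD.
  by rewrite -EFinD lee_fin /e; lra.
have [F FP] : {F : nat * N -> N & forall p, good p.1 p.2 -> (potential p.1 p.2 U r < 1)%E ->
    [/\ good p.1.+1 (F p), `|c (F p) - c p.2| + rho p.1.+1 <= rho p.1, c (F p) != c p.2 &
    (potential p.1.+1 (F p) U r < 1)%E]}.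
  apply: (@choice _ _ (fun p y => good p.1 p.2 -> (potential p.1 p.2 U r < 1)%E ->
    [/\ good p.1.+1 y, `|c y - c p.2| + rho p.1.+1 <= rho p.1, c y != c p.2 &
    (potential p.1.+1 y U r < 1)%E])) => -[k x] /=.
  have [[gx px]|no] := pselect (good k x /\ (potential k x U r < 1)%E).
    by have [y hy] := potential_child r0 dr gx px; exists y.
  by exists x0 => gx px; exfalso; apply: no.
pose x := fix x k := if k is k'.+1 then F (k', x k') else x0.
have xP k : good k (x k) /\ (potential k (x k) U r < 1)%E.
  elim: k => [|k [gk pk]]; first by split.
  by have [h1 _ _ h2] := FP (k, x k) gk pk; split; [exact: h1|exact: h2].
have xS k : `|c (x k.+1) - c (x k)| + rho k.+1 <= rho k /\ c (x k.+1) != c (x k).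
  by have [gk pk] := xP k; have [] := FP (k, x k) gk pk.
have nest k n : `|c (x (k + n)%N) - c (x k)| + rho (k + n)%N <= rho k.
  elim: n => [|n IH]; first by rewrite addn0 subrr normr0 add0r.
  have [hS _] := xS (k + n)%N; rewrite addnS; apply: le_trans IH.
  apply: le_trans (_ : _ <= `|c (x (k + n)%N) - c (x k)| +
    (`|c (x (k + n).+1) - c (x (k + n)%N)| + rho (k + n).+1)) _; last by rewrite lerD2l.
  rewrite addrA lerD2r addrC; apply: le_trans (ler_normD _ _).
  by rewrite addrA subrK.
have nest2 j k (l : 'I_2) : c (x j) 0 l - rho j <= c (x k) 0 l + rho k.
  have coord a b (v : 'rV[R]_2) : `|v| + a <= b -> `|v 0 l| + a <= b :> R.
    move=> h; have : `|v| <= b - a by lra.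
    by rewrite norm2_le; case: (ord2P l) => -> /andP[]; lra.
  have [jk|/ltnW kj] := leqP j k.
    have := coord _ _ _ (nest j (k - j)%N); rewrite subnKC // !mxE.
    by have := rho0 k; have := ler_norm (c (x j) 0 l - c (x k) 0 l); rewrite distrC; lra.
  have := coord _ _ _ (nest k (j - k)%N); rewrite subnKC // !mxE.
  by have := rho0 j; have := ler_norm (c (x j) 0 l - c (x k) 0 l); lra.
(* The squares around the centers are nested, so the coordinatewise supremum of their lower sides
   lies in all of them. *)
pose lo l := [set c (x k) 0 l - rho k | k in [set: nat]].
pose t : 'rV[R]_2 := \row_l sup (lo l).
have tP k : `|t - c (x k)| <= rho k.
  have h l : `|(t - c (x k)) 0 l| <= rho k.
    rewrite !mxE ler_distl; apply/andP; split.
      apply: ub_le_sup; last by exists k.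
      by exists (c (x k) 0 l + rho k) => _ [j _ <-]; exact: nest2.
    apply: ge_sup; first by exists (c (x k) 0 l - rho k), k.
    by move=> _ [j _ <-]; exact: nest2.
  by rewrite norm2_le !h.
have [n _ Unt] : (\bigcup_n U n) t.
  by apply: EU; apply: (Elim x) => k; split; [case: (xP k)|case: (xS k)|exact: tP].
have [k kr] := omega_to0 (r0 n).
have [_] := xP k; apply/negP; rewrite -leNgt.
have : (share k (x k) (U n) (r n) = 1).
  rewrite /share ifT; last by apply/asboolP; exists t.
  by apply/min_idPl; rewrite powR_ge1 ?(ltW s0) // ler_pdivlMr // mul1r ltW.
move=> sh1; have sh0 j : (0 <= (share k (x k) (U j) (r j))%:E)%E by rewrite lee_fin share_ge0.
apply: le_trans (nneseries_lim_ge n.+1 (fun j _ _ => sh0 j)).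
by rewrite big_nat_recr //= sh1 leeDr // sume_ge0.
Qed.

End cantor.

(** * The tree of unimodular triples *)

(* V = (v1, v2, v0), W = (w1, w2, w0) and Q = (p1, p2, q0), where (p1/q0, p2/q0)
   is the rational point in the plane. *)
Record node := Node {
  v1 : int; v2 : int; v0 : int;
  w1 : int; w2 : int; w0 : int;
  p1 : int; p2 : int; q0 : int }.

Definition ndet N : int :=
  v1 N * (w2 N * q0 N - w0 N * p2 N) - v2 N * (w1 N * q0 N - w0 N * p1 N)
  + v0 N * (w1 N * p2 N - w2 N * p1 N).

Section reduction.
Context {R : realType}.

(** Rounding brings the coordinate in which [y] is largest below the norm of [y]; the determinant
    then controls the other coordinate. *)
Lemma reduce_vector (x1 x2 y1 y2 : R) :
  let w := Num.max `|y1| `|y2| in 0 < w ->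
  exists n : int, Num.max `|x1 + n%:~R * y1| `|x2 + n%:~R * y2|
    <= `|x1 * y2 - x2 * y1| / w + w.
Proof.
have aux (a1 a2 b1 b2 : R) : 0 < `|b1| -> `|b2| <= `|b1| ->
    exists n : int, `|a1 + n%:~R * b1| <= `|b1| /\
      `|a2 + n%:~R * b2| <= `|a1 * b2 - a2 * b1| / `|b1| + `|b1|.
  move=> b10 b21; have b1n : b1 != 0 by rewrite -normr_gt0.
  exists (- Num.floor (a1 / b1)).
  set n := Num.floor _.
  have e1 : a1 + (- n)%:~R * b1 = (a1 / b1 - n%:~R) * b1.
    by rewrite mulrBl divfK // mulrNz mulNr.
  have f1 : `|a1 / b1 - n%:~R| <= 1.
    have := floor_le (a1 / b1); have := floorD1_gt (a1 / b1); rewrite -/n intrD.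
    by rewrite ler_norml; lra.
  have h1 : `|a1 + (- n)%:~R * b1| <= `|b1|.
    by rewrite e1 normrM -[leRHS]mul1r ler_wpM2r.
  split=> //.
  have -> : a2 + (- n)%:~R * b2 =
    - ((a1 * b2 - a2 * b1) / b1) + (a1 + (- n)%:~R * b1) * (b2 / b1) by field.
  apply: le_trans (ler_normD _ _) _; rewrite normrN !normrM normfV; apply: lerD => //.
  rewrite -[leRHS]mulr1; apply: ler_pM => //; rewrite -?normrM ?normrM ?mulr_ge0 ?invr_ge0 //.
  by rewrite ler_pdivrMr // mul1r.
move=> w w0; have [h|h] := leP `|y2| `|y1|.
  have wE : w = `|y1| by rewrite /w; apply/max_idPl.
  have [|n [h1 h2]] := aux x1 x2 y1 y2 _ h; first by rewrite -wE.
  exists n; rewrite wE ge_max h2 andbT; apply: le_trans h1 _.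
  by rewrite lerDr divr_ge0.
have wE : w = `|y2| by rewrite /w; apply/max_idPr/ltW.
have [|n [h1 h2]] := aux x2 x1 y2 y1 _ (ltW h); first by rewrite -wE.
exists n; rewrite wE ge_max distrC h2 /=; apply: le_trans h1 _.
by rewrite lerDr divr_ge0.
Qed.

End reduction.

Section nodes.
Context {R : realType}.
Implicit Types (N : node) (T h : R).

(* [pj y y0 p q] is a coordinate of the projection of an integer vector along
   the line spanned by [Q = (p1, p2, q)]; the projections of [V] and [W] span the
   planar lattice Z^3 / Z Q, of covolume 1/q, and have norms [nV] and [nW]. *)
Definition pj (y y0 p q : int) : R := y%:~R - y0%:~R * p%:~R / q%:~R.

Definition nV N : R :=
  Num.max `|pj (v1 N) (v0 N) (p1 N) (q0 N)| `|pj (v2 N) (v0 N) (p2 N) (q0 N)|.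
Definition nW N : R :=
  Num.max `|pj (w1 N) (w0 N) (p1 N) (q0 N)| `|pj (w2 N) (w0 N) (p2 N) (q0 N)|.

Definition center N : 'rV[R]_2 :=
  \row_i (if i == 0 then (p1 N)%:~R / (q0 N)%:~R else (p2 N)%:~R / (q0 N)%:~R).

(** The last clause says that [V] is reduced against [W] in a planar lattice of covolume [1 / q0].
    The constants 1/4 and 6 come from bounds 1/2 and 3 for the direction of a child, each weakened
    by a factor 2 for the range of the denominators. *)
Definition ok T h N : Prop :=
  [/\ ndet N = 1, T <= (q0 N)%:~R <= 2 * T,
      h / T / 4 <= nW N <= 6 * (h / T) &
      nV N <= ((q0 N)%:~R * nW N)^-1 + nW N].

Lemma pj_det N : q0 N != 0 -> ndet N = 1 ->
  pj (v1 N) (v0 N) (p1 N) (q0 N) * pj (w2 N) (w0 N) (p2 N) (q0 N) -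
  pj (v2 N) (v0 N) (p2 N) (q0 N) * pj (w1 N) (w0 N) (p1 N) (q0 N) = (q0 N)%:~R^-1.
Proof.
move=> q0N /(congr1 (fun z : int => z%:~R : R)).
rewrite /ndet /pj !(intrD, intrM, mulrNz, rmorph1) => e.
have qn : (q0 N)%:~R != 0 :> R by rewrite intr_eq0.
by rewrite -[RHS]mul1r -[X in _ = X * _]e; field.
Qed.

(* The triple (V', Q, a V + b W + j Q): the former best approximation becomes the
   short vector of the new lattice, and V' only completes a basis. *)
Definition child N (a b c d j n : int) := Node
  (c * v1 N + d * w1 N + n * p1 N) (c * v2 N + d * w2 N + n * p2 N)
  (c * v0 N + d * w0 N + n * q0 N)
  (p1 N) (p2 N) (q0 N)
  (a * v1 N + b * w1 N + j * p1 N) (a * v2 N + b * w2 N + j * p2 N)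
  (a * v0 N + b * w0 N + j * q0 N).

Lemma ndet_child N a b c d j n : a * d - b * c = 1 ->
  ndet (child N a b c d j n) = ndet N.
Proof.
by move=> e; rewrite -[RHS]mul1r -e /ndet /child /=; ring.
Qed.

(** As [Q] projects to 0, these are the coordinates of the projection of [a V + b W + j Q] for every
    [j]. *)
Definition xx N (a b : int) (i : bool) : R :=
  if i then a%:~R * pj (v1 N) (v0 N) (p1 N) (q0 N) + b%:~R * pj (w1 N) (w0 N) (p1 N) (q0 N)
  else a%:~R * pj (v2 N) (v0 N) (p2 N) (q0 N) + b%:~R * pj (w2 N) (w0 N) (p2 N) (q0 N).

Definition nx N a b : R := Num.max `|xx N a b true| `|xx N a b false|.

Lemma center_child N a b c d j n l : q0 N != 0 -> q0 (child N a b c d j n) != 0 ->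
  (center (child N a b c d j n) - center N) 0 l =
  xx N a b (l == 0) / (q0 (child N a b c d j n))%:~R.
Proof.
move=> qN uN; have q0N : (q0 N)%:~R != 0 :> R by rewrite intr_eq0.
have u0N : (q0 (child N a b c d j n))%:~R != 0 :> R by rewrite intr_eq0.
by rewrite !mxE /=; case: ifP => _; rewrite /xx /pj /= !(intrD, intrM) in u0N *; field;
  rewrite q0N u0N.
Qed.

(** The new [W] is the old [Q], and projecting [Q] along [U] gives [- q / u] times the projection of
    [U] along [Q]. *)
Lemma nW_child N a b c d j n : 0 < q0 N -> 0 < q0 (child N a b c d j n) ->
  nW (child N a b c d j n) = (q0 N)%:~R * nx N a b / (q0 (child N a b c d j n))%:~R.
Proof.
move=> qN uN; have q0N : 0 < (q0 N)%:~R :> R by rewrite ltr0z.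
have u0N : 0 < (q0 (child N a b c d j n))%:~R :> R by rewrite ltr0z.
have qn := lt0r_neq0 q0N; have un := lt0r_neq0 u0N.
have e1 : pj (w1 (child N a b c d j n)) (w0 (child N a b c d j n))
    (p1 (child N a b c d j n)) (q0 (child N a b c d j n)) =
    - ((q0 N)%:~R / (q0 (child N a b c d j n))%:~R * xx N a b true).
  by rewrite /xx /pj /= !(intrD, intrM) in u0N un *; field; rewrite qn un.
have e2 : pj (w2 (child N a b c d j n)) (w0 (child N a b c d j n))
    (p2 (child N a b c d j n)) (q0 (child N a b c d j n)) =
    - ((q0 N)%:~R / (q0 (child N a b c d j n))%:~R * xx N a b false).
  by rewrite /xx /pj /= !(intrD, intrM) in u0N un *; field; rewrite qn un.
have ge : 0 < (q0 N)%:~R / (q0 (child N a b c d j n))%:~R :> R by rewrite divr_gt0.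
rewrite /nW e1 e2 !normrN !normrM !normfV (gtr0_norm q0N) (gtr0_norm u0N).
by rewrite -maxr_pMr ?ltW // /nx; ring.
Qed.

Lemma nV_child N a b c d j n : q0 (child N a b c d j 0) != 0 ->
  nV (child N a b c d j n) = Num.max
   `|pj (v1 (child N a b c d j 0)) (v0 (child N a b c d j 0)) (p1 (child N a b c d j 0)) (q0 (child N a b c d j 0))
     + n%:~R * pj (w1 (child N a b c d j 0)) (w0 (child N a b c d j 0)) (p1 (child N a b c d j 0)) (q0 (child N a b c d j 0))|
   `|pj (v2 (child N a b c d j 0)) (v0 (child N a b c d j 0)) (p2 (child N a b c d j 0)) (q0 (child N a b c d j 0))
     + n%:~R * pj (w2 (child N a b c d j 0)) (w0 (child N a b c d j 0)) (p2 (child N a b c d j 0)) (q0 (child N a b c d j 0))|.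
Proof.
rewrite -(intr_eq0 R) => un.
by rewrite /nV /pj /= !(intrD, intrM) in un *; congr Order.max; congr Num.norm; field.
Qed.

(** Bezout completes [(a, b)] to a matrix of determinant 1, and [n] reduces the new [V] against the
    new [W]; neither choice moves the center. *)
Lemma child_ok T h T' h' N (a b j : int) : 0 < T -> 0 < T' -> 0 < h' -> ok T h N ->
  coprimez a b ->
  h' / T / 2 <= nx N a b <= 3 * (h' / T) ->
  T' <= (a * v0 N + b * w0 N + j * q0 N)%:~R <= 2 * T' ->
  exists2 N', ok T' h' N' &
    exists c d n, N' = child N a b c d j n.
Proof.
move=> T0 T'0 h'0 [dN /andP[qT q2T] _ _] ab /andP[x1 x2] uT.
have [c [d cd]] : exists c d : int, a * d - b * c = 1.
  have [u [v uv]] := Bezoutz a b; exists (- v), u.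
  by move: ab; rewrite /coprimez -uv => /eqP; lia.
have q_gt0 : 0 < q0 N by rewrite -(ltr0z R) (lt_le_trans T0).
have u_gt0 m : 0 < q0 (child N a b c d j m).
  by rewrite -(ltr0z R) (lt_le_trans T'0) //; case/andP: uT.
have qr : 0 < (q0 N)%:~R :> R by rewrite ltr0z.
have ur : 0 < (q0 (child N a b c d j 0))%:~R :> R by rewrite ltr0z.
have nx0 : 0 < nx N a b by apply: lt_le_trans x1; rewrite !divr_gt0.
have W0 : 0 < nW (child N a b c d j 0) by rewrite nW_child // divr_gt0 // mulr_gt0.
have [n nP] := reduce_vector (pj (v1 (child N a b c d j 0)) (v0 (child N a b c d j 0)) (p1 (child N a b c d j 0)) (q0 (child N a b c d j 0)))
  (pj (v2 (child N a b c d j 0)) (v0 (child N a b c d j 0)) (p2 (child N a b c d j 0)) (q0 (child N a b c d j 0))) W0.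
have det1 m : ndet (child N a b c d j m) = 1 by rewrite ndet_child.
exists (child N a b c d j n); last by exists c, d, n.
have WE : nW (child N a b c d j n) = nW (child N a b c d j 0) by [].
split => //.
  rewrite nW_child //; set u := (q0 (child _ _ _ _ _ _ _))%:~R.
  have /andP[u1 u2] : T' <= u <= 2 * T' by [].
  have u0 : 0 < u by exact: lt_le_trans u1.
  have e1 : h' / T' / 4 = T * (h' / T / 2) / (2 * T') by field; rewrite !gt_eqF.
  have e2 : 6 * (h' / T') = (2 * T) * (3 * (h' / T)) / T' by field; rewrite !gt_eqF.
  have hT : 0 <= h' / T / 2 by rewrite !divr_ge0 // ltW.
  have A1 := ler_pM (ltW T0) hT qT x1.
  have A2 := ler_pM (ltW qr) (ltW nx0) q2T x2.
  have T'2 : 0 < 2 * T' by rewrite mulr_gt0.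
  rewrite e1 e2; apply/andP; split; apply: ler_pM A1 _ || apply: ler_pM A2 _.
  - by rewrite mulr_ge0 // ltW.
  - by rewrite invr_ge0 ltW.
  - by rewrite lef_pV2 ?posrE.
  - by rewrite mulr_ge0 // ltW.
  - by rewrite invr_ge0 ltW.
  - by rewrite lef_pV2 ?posrE.
rewrite nV_child ?gt_eqF ?u_gt0 // WE; apply: le_trans nP _.
rewrite pj_det ?gt_eqF ?u_gt0 // gtr0_norm ?invr_gt0 //.
by rewrite invfM.
Qed.

Lemma nx_bounds N a b A B (r : R) : 0 <= a -> 0 <= b ->
  a%:~R * nV N <= A -> B <= b%:~R * nW N <= r ->
  B - A <= nx N a b <= r + A.
Proof.
rewrite -!(ler0z R) => a0 b0 aA /andP[Bb br].
have b1 i : `|xx N a b i| <= a%:~R * nV N + b%:~R * nW N.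
  rewrite /xx /nV /nW; case: i; apply: le_trans (ler_normD _ _) _;
  by rewrite !normrM (ger0_norm a0) (ger0_norm b0) lerD // ler_wpM2l // le_max lexx ?orbT.
have b2 : b%:~R * nW N - a%:~R * nV N <= nx N a b.
  rewrite /nx /nW /nV lerBlDr [b%:~R * _]maxr_pMr // ge_max; apply/andP; split.
    have -> : b%:~R * `|pj (w1 N) (w0 N) (p1 N) (q0 N)| =
      `|xx N a b true - a%:~R * pj (v1 N) (v0 N) (p1 N) (q0 N)|.
      by rewrite /xx addrC addKr normrM (ger0_norm b0).
    apply: le_trans (ler_normB _ _) _; apply: lerD; first by rewrite le_max lexx.
    by rewrite normrM (ger0_norm a0) ler_wpM2l // le_max lexx.
  have -> : b%:~R * `|pj (w2 N) (w0 N) (p2 N) (q0 N)| =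
    `|xx N a b false - a%:~R * pj (v2 N) (v0 N) (p2 N) (q0 N)|.
    by rewrite /xx addrC addKr normrM (ger0_norm b0).
  apply: le_trans (ler_normB _ _) _; apply: lerD; first by rewrite le_max lexx orbT.
  by rewrite normrM (ger0_norm a0) ler_wpM2l // le_max lexx orbT.
apply/andP; split; first by lra.
by rewrite /nx ge_max; apply/andP; split; apply: le_trans (b1 _) _; lra.
Qed.

End nodes.

(** * Counting coprime pairs *)

Section coprime_count.
Local Open Scope nat_scope.

(** After the first term 1/4 the sum is dominated by the telescoping [1 / (d (d - 1))]. That 3/4 is
    less than 1 allows a union bound over all [d >= 2], prime or not. *)
Lemma sum_inv_sqr (F : realFieldType) n :
  (\sum_(2 <= d < n.+3) (d%:R ^+ 2)^-1 <= 3 / 4 - (n.+2)%:R^-1 :> F)%R.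
Proof.
elim: n => [|n IH]; first by rewrite big_nat1 expr2; lra.
rewrite big_nat_recr //=; apply: le_trans (lerD IH (lexx _)) _.
have n0 : (0 < n.+2%:R :> F)%R by rewrite ltr0n.
rewrite -[n.+3%:R]natr1; set x : F := n.+2%:R%R in n0 *.
have x1 : (0 < x + 1)%R by lra.
have -> : (3 / 4 - x^-1 + ((x + 1) ^+ 2)^-1 =
  3 / 4 - (x + 1)^-1 - (x * (x + 1) ^+ 2)^-1)%R.
  by field; rewrite !gt_eqF.
by rewrite lerBlDr lerDl invr_ge0 mulr_ge0 ?sqr_ge0 // ltW.
Qed.

(** 7/8 = 3/4 + 1/8: the main terms give 3/4 of [A B]. The successor costs at most [A / 2] for each
    of fewer than [A] divisors, in all at most [A B / 8] since [4 A <= B]. *)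
Lemma sum_div_le (F : realFieldType) A B : 0 < A -> 4 * A <= B ->
  ((8 * \sum_(2 <= d < A.+1) (A %/ d) * (B %/ d).+1)%:R <= (7 * (A * B))%:R :> F)%R.
Proof.
case: A => [//|[_ _|n _ nB]]; first by rewrite big_geq // muln0 ler0n.
set A := n.+2 in nB *.
rewrite natrM natr_sum.
apply: (@le_trans _ _ (8 * \sum_(2 <= d < A.+1)
    ((A * B)%:R * (d%:R ^+ 2)^-1 + A%:R / 2)))%R.
  rewrite ler_pM2l //; apply: ler_sum_nat => d /andP[d2 _].
  have d2r : (2 <= d%:R :> F)%R by rewrite (ler_nat _ 2).
  have d0r : (0 < d%:R :> F)%R by lra.
  have fl (m : nat) : ((m %/ d)%:R <= m%:R / d%:R :> F)%R.
    by rewrite ler_pdivlMr // -natrM ler_nat leq_trunc_div.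
  rewrite natrM -natr1 mulrDr mulr1 lerD //.
    apply: le_trans (ler_pM _ _ (fl A) (fl B)) _ => //; rewrite natrM.
    by rewrite le_eqVlt; apply/orP; left; apply/eqP; field; rewrite gt_eqF.
  apply: le_trans (fl A) _; rewrite ler_wpM2l //.
  by rewrite lef_pV2 ?posrE.
rewrite big_split /= -big_distrr /= sumr_const_nat.
have := sum_inv_sqr F n; rewrite -/A; set S := (\sum_(2 <= d < A.+1) _)%R => hS.
have A0 : (0 < A%:R :> F)%R by rewrite ltr0n.
have Sq : (S <= 3 / 4)%R by apply: le_trans hS _; rewrite lerBlDr lerDl invr_ge0 ltW.
have nB' : (4 * A%:R <= B%:R :> F)%R by rewrite -natrM ler_nat.
have An : ((A.+1 - 2)%:R <= A%:R :> F)%R by rewrite ler_nat /A; lia.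
rewrite -[((A%:R / 2) *+ _)%R]mulr_natr !natrM.
have h1 : (A%:R * B%:R * S <= A%:R * B%:R * (3 / 4))%R by rewrite ler_wpM2l // mulr_ge0.
have h2 : (A%:R / 2 * (A.+1 - 2)%:R <= A%:R / 2 * (B%:R / 4) :> F)%R.
  by rewrite ler_wpM2l ?divr_ge0 //; lra.
rewrite -/A; lra.
Qed.

Lemma not_coprime_le A a b : 0 < a <= A ->
  1 <= coprime a b + \sum_(2 <= d < A.+1) (d %| a) * (d %| b).
Proof.
case/andP=> a0 aA; case: (boolP (coprime a b)) => // /negbTE cop.
have g1 : 1 < gcdn a b.
  by rewrite ltn_neqAle eq_sym gcdn_gt0 a0 andbT; apply/negP => /eqP e; move: cop; rewrite /coprime e.
rewrite add0n (bigD1_seq (gcdn a b)) ?iota_uniq //=; last first.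
  by rewrite mem_index_iota g1 ltnS (leq_trans _ aA) // dvdn_leq // dvdn_gcdl.
by rewrite dvdn_gcdl dvdn_gcdr.
Qed.

(** At most 7/8 of the pairs have a common divisor. The second entry runs over [B + 1, ..., 2 B],
    where all values have the same order of magnitude. *)
Lemma coprime_count A B : 0 < A -> 4 * A <= B ->
  A * B <= 8 * \sum_(i < A) \sum_(k < B) coprime i.+1 (B + k).+1.
Proof.
move=> A0 AB.
have cA d n : \sum_(i < n) (d %| i.+1) = n %/ d.
  by rewrite divn_count_dvd big_add1 /= big_mkord.
have cB d : \sum_(k < B) (d %| (B + k).+1) <= (B %/ d).+1.
  have := cA d (B + B); rewrite big_split_ord /= cA => e.
  by have := leq_divDl d B B; rewrite -e; lia.
have le1 : A * B <= \sum_(i < A) \sum_(k < B) coprime i.+1 (B + k).+1 +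
    \sum_(2 <= d < A.+1) (A %/ d) * (B %/ d).+1.
  apply: (@leq_trans (\sum_(i < A) \sum_(k < B) (coprime i.+1 (B + k).+1 +
     \sum_(2 <= d < A.+1) (d %| i.+1) * (d %| (B + k).+1)))).
    rewrite -[leqLHS]muln1 -[in leqLHS](card_ord A) -[in leqLHS](card_ord B) -mulnA.
    rewrite -sum_nat_const; apply: leq_sum => i _; rewrite muln1 -sum1_card.
    by apply: leq_sum => k _; apply: not_coprime_le; rewrite /= ltn_ord.
  rewrite (eq_bigr (fun i : 'I_A => \sum_(k < B) coprime i.+1 (B + k).+1 +
     \sum_(k < B) \sum_(2 <= d < A.+1) (d %| i.+1) * (d %| (B + k).+1))); last first.
    by move=> i _; rewrite -big_split.
  rewrite big_split leq_add2l.
  under eq_bigr do rewrite exchange_big /=.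
  rewrite exchange_big; apply: leq_sum => d _.
  under eq_bigr do rewrite -big_distrr /=.
  by rewrite -big_distrl /= cA leq_mul2l cB orbT.
have := sum_div_le rat A0 AB; rewrite ler_nat.
lia.
Qed.

End coprime_count.

(** * Number and separation of the children of a node *)

Section separation.
Context {R : realType}.

(** The determinant of the two directions is [u'] times a combination of the two coordinate
    differences with coefficients at most [3 r]. In the application it is a nonzero integer divided
    by the denominator of the parent, whence the lower bound [1 / (2 T)]. *)
Lemma sep_directions (T T' r : R) (x1 x2 x1' x2' u u' e : R) :
  0 < T -> 0 < T' -> 0 < r ->
  T' <= u <= 2 * T' -> T' <= u' <= 2 * T' ->
  Num.max `|x1| `|x2| <= 3 * r ->
  (2 * T)^-1 <= `|x1 * x2' - x2 * x1'| ->
  `|x1 / u - x1' / u'| <= e -> `|x2 / u - x2' / u'| <= e ->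
  (48 * T * T' * r)^-1 <= e.
Proof.
move=> T0 T'0 r0 /andP[u1 u2] /andP[u1' u2']; rewrite ge_max => /andP[x1r x2r] D e1 e2.
have u0 : 0 < u by lra.
have u'0 : 0 < u' by lra.
have e0 : 0 <= e by apply: le_trans e1.
have DE : x1 * x2' - x2 * x1' =
  u' * (x2 * (x1 / u - x1' / u') - x1 * (x2 / u - x2' / u')).
  by field; rewrite !gt_eqF.
have : `|x1 * x2' - x2 * x1'| <= (2 * T') * (3 * r * e + 3 * r * e).
  rewrite DE normrM (gtr0_norm u'0); apply: ler_pM => //; first exact: ltW.
  by apply: le_trans (ler_normB _ _) _; rewrite !normrM; apply: lerD; apply: ler_pM.
move=> /(le_trans D).
have -> : 2 * T' * (3 * r * e + 3 * r * e) = 12 * T' * r * e by ring.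
have z0 : 0 < 12 * T' * r by rewrite !mulr_gt0.
rewrite -ler_pdivrMl // => /(le_trans _); apply.
rewrite -invfM lef_pV2 ?posrE ?mulr_gt0 //.
have : 0 < T * T' * r by rewrite !mulr_gt0.
by nra.
Qed.

End separation.

Section children.
Context {R : realType}.

(** Both points lie on one ray from the center of the parent, at distances inversely proportional to
    the denominators. *)
Lemma sep_same_direction (T T' r : R) (x1 x2 u u' e : R) :
  0 < T -> 0 < T' -> 0 < r ->
  T' <= u <= 2 * T' -> T' <= u' <= 2 * T' ->
  r / 2 <= Num.max `|x1| `|x2| -> T <= `|u - u'| ->
  `|x1 / u - x1 / u'| <= e -> `|x2 / u - x2 / u'| <= e ->
  r * T / (8 * T' ^+ 2) <= e.
Proof.
move=> T0 T'0 r0 /andP[u1 u2] /andP[u1' u2'] x12 uu e1 e2.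
have u0 : 0 < u by lra.
have u'0 : 0 < u' by lra.
have key (x : R) : `|x / u - x / u'| <= e -> `|x| * (T / (4 * T' ^+ 2)) <= e.
  apply: le_trans; have -> : x / u - x / u' = x * ((u' - u) / (u * u')).
    by field; rewrite !gt_eqF.
  rewrite normrM ler_wpM2l // normrM normfV (gtr0_norm (mulr_gt0 u0 u'0)) distrC.
  apply: ler_pM => //; [exact: ltW | by rewrite invr_ge0 mulr_ge0 ?sqr_ge0|].
  rewrite lef_pV2 ?posrE ?mulr_gt0 // ?exprn_gt0 //.
  have -> : 4 * T' ^+ 2 = (2 * T') * (2 * T') by ring.
  by apply: ler_pM => //; exact: ltW.
have c0 : 0 <= T / (4 * T' ^+ 2) by rewrite divr_ge0 ?(ltW T0) // mulr_ge0 // sqr_ge0.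
apply: (@le_trans _ _ (Num.max `|x1| `|x2| * (T / (4 * T' ^+ 2)))).
  have -> : r * T / (8 * T' ^+ 2) = r / 2 * (T / (4 * T' ^+ 2)).
    by field; rewrite gt_eqF.
  by rewrite ler_wpM2r.
by rewrite maxr_pMl // ge_max !key.
Qed.

Lemma coprime_cross (a b c d : nat) : (0 < a)%N -> coprime a b -> coprime c d ->
  (a * d = b * c)%N -> a = c /\ b = d.
Proof.
move=> a0 ab cd e.
have d1 : (a %| c)%N by rewrite -(Gauss_dvdr _ ab) -e dvdn_mulr.
have d2 : (c %| a)%N by rewrite -(Gauss_dvdl _ cd) e dvdn_mull.
have ac : a = c by apply/eqP; rewrite eqn_dvd d1 d2.
by split => //; apply/eqP; rewrite -(eqn_pmul2l a0) e ac mulnC.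
Qed.

Lemma xx_det (N : node) (a b a' b' : int) : (q0 N) != 0 -> ndet N = 1 ->
  xx N a b true * xx N a' b' false - xx N a b false * xx N a' b' true
  = (a * b' - b * a')%:~R / (q0 N)%:~R :> R.
Proof.
move=> qn /(pj_det (R := R) qn) e; rewrite -[X in _ = _ * X]e /xx !(intrD, intrM, mulrNz).
by ring.
Qed.

(** With [r = h' / T], taking [b] above [r / nW N] makes [b W] as long as required, and [a <= A]
    keeps [a V] below [r / 2]. Since [q nW ^ 2 <= 1/2], the bound on [V] leads to [4 A <= B], as the
    count of coprime pairs demands. [J] is the number of multiples of [Q] that fit between the
    denominators [T'] and [2 T']. *)
Lemma node_sizes (T h T' h' : R) (N : node) :
  0 < T -> 0 < h -> 144 * h ^+ 2 <= T ->
  10 * T <= h * h' -> 24 * h <= h' -> 4 * T <= T' -> ok T h N ->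
  exists A B J : nat,
    [/\ (0 < A)%N /\ (4 * A <= B)%N,
        forall a b : nat, (a <= A)%N -> (B <= b <= 2 * B)%N ->
          h' / T / 2 <= nx N a%:Z b%:Z <= 3 * (h' / T),
        J%:R * (q0 N)%:~R <= T' &
        8 * (h' ^+ 2 * T' / (20 ^+ 3 * T ^+ 2)) <= A%:R * B%:R * J%:R].
Proof.
move=> T0 h0 hT hh h24 TT okN.
have [dN /andP[q1 q2] /andP[w1 w2] VX] := okN.
set w := nW N in w1 w2 VX.
have h'0 : 0 < h' by lra.
have T'0 : 0 < T' by lra.
set q : R := (q0 N)%:~R in q1 q2 VX.
have q_gt0 : 0 < q by lra.
have qN0 : 0 < q0 N by rewrite -(ltr0z R).
pose r := h' / T.
have r0 : 0 < r by rewrite divr_gt0.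
have hT0 : 0 < h / T by rewrite divr_gt0.
have wp : 0 < w by lra.
have rw : 4 * w <= r.
  apply: (@le_trans _ _ (24 * (h / T))); first lra.
  by rewrite /r mulrA ler_pM2r ?invr_gt0.
have rh : 10 <= r * h by rewrite /r mulrAC ler_pdivlMr // [h' * h]mulrC.
have qw : h / 4 <= q * w.
  have -> : h / 4 = T * (h / T / 4) by field; rewrite gt_eqF.
  by apply: ler_pM => //; rewrite ltW // divr_gt0.
have qw2 : 2 * (q * w ^+ 2) <= 1.
  have : q * w ^+ 2 <= (2 * T) * (6 * (h / T)) ^+ 2.
    apply: ler_pM => //; [exact: ltW|exact: sqr_ge0|].
    by rewrite lerXn2r ?nnegrE //; lra.
  have -> : 2 * T * (6 * (h / T)) ^+ 2 = 72 * h ^+ 2 / T by field; rewrite gt_eqF.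
  have : 72 * h ^+ 2 / T <= 1 / 2 by rewrite ler_pdivrMr //; lra.
  by lra.
set X := (q * w)^-1 + w in VX.
have qw0 : 0 < q * w by rewrite mulr_gt0.
have X0 : 0 < X by rewrite addr_gt0 // invr_gt0.
have X5 : X <= 5 / h.
  have a1 : (q * w)^-1 <= 4 / h.
    have -> : 4 / h = (h / 4)^-1 by rewrite invf_div.
    by rewrite lef_pV2 ?posrE // divr_gt0.
  have a2 : w <= 1 / h.
    apply: le_trans w2 _; rewrite mulrA ler_pdivrMr // mulrAC ler_pdivlMr //.
    by move: hT (sqr_ge0 h); rewrite !expr2; lra.
  by rewrite /X; lra.
pose z := r / (2 * X).
have zh : r * h / 10 <= z.
  have -> : r * h / 10 = r / (2 * (5 / h)) by field; rewrite gt_eqF.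
  rewrite /z ler_pM2l // lef_pV2 ?posrE ?mulr_gt0 // ?divr_gt0 // ?invr_gt0 //.
  by rewrite ler_pM2l.
have z1 : 1 <= z by lra.
pose A := Num.truncn z.
have /andP[Az zA] : A%:R <= z < A.+1%:R by apply: truncn_itv; lra.
have A1 : (0 < A)%N by rewrite truncn_gt0.
have A2 : z / 2 <= A%:R.
  have : 1 <= A%:R :> R by rewrite (ler_nat _ 1).
  by move: zA; rewrite -natr1; lra.
pose B := (Num.truncn (r / w)).+1.
have rw0 : 0 < r / w by rewrite divr_gt0.
have /andP[B1 B2] : (Num.truncn (r / w))%:R <= r / w < B%:R by apply: truncn_itv; exact: ltW.
have B3 : B%:R <= r / w + 1 by rewrite /B -natr1; lra.
have AB : (4 * A <= B)%N.
  rewrite -(ler_nat R) natrM; apply: le_trans (ltW B2).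
  have zq : z <= r * (q * w) / 2.
    have -> : r * (q * w) / 2 = r / (2 * (q * w)^-1) by field; rewrite !gt_eqF.
    rewrite /z ler_pM2l // lef_pV2 ?posrE ?mulr_gt0 ?invr_gt0 // ler_pM2l // /X.
    by rewrite lerDl ltW.
  have : r * (2 * (q * w ^+ 2)) <= r * 1 by rewrite ler_pM2l.
  rewrite ler_pdivlMr // => rr.
  have -> : 4 * A%:R * w = (4 * w) * A%:R by ring.
  apply: (@le_trans _ _ (4 * w * (r * (q * w) / 2))).
    by rewrite ler_pM2l ?mulr_gt0 //; lra.
  by rewrite (_ : 4 * w * (r * (q * w) / 2) = r * (2 * (q * w ^+ 2))); [lra | field].
pose J := Num.truncn (T' / (4 * T)).
have tj1 : 1 <= T' / (4 * T) by rewrite ler_pdivlMr ?mulr_gt0 //; lra.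
have /andP[J1 J2] : J%:R <= T' / (4 * T) < J.+1%:R by apply: truncn_itv; lra.
have J3 : T' / (8 * T) <= J%:R.
  have J0 : (0 < J)%N by rewrite truncn_gt0.
  have : 1 <= J%:R :> R by rewrite (ler_nat _ 1).
  have -> : T' / (8 * T) = T' / (4 * T) / 2 by field; rewrite gt_eqF.
  by move: J2; rewrite -natr1; set tz := T' / (4 * T); lra.
have J4 : J%:R * q <= T'.
  apply: (@le_trans _ _ (T' / (4 * T) * (2 * T))).
    by apply: ler_pM => //; exact: ltW.
  have -> : T' / (4 * T) * (2 * T) = T' / 2 by field; rewrite gt_eqF.
  by lra.
exists A, B, J; split => //.
- move=> a b aA /andP[Bb b2B]; rewrite -/r.
  have a1 : a%:~R <= A%:R :> R by rewrite -[leLHS]/(a%:R) ler_nat.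
  have b1 : B%:R <= b%:~R :> R by rewrite -[leRHS]/(b%:R) ler_nat.
  have b2 : b%:~R <= 2 * B%:R :> R by rewrite -[leLHS]/(b%:R) -natrM ler_nat.
  have aV : a%:~R * nV N <= r / 2.
    have -> : r / 2 = z * X by rewrite /z; field; rewrite gt_eqF.
    apply: ler_pM => //; first by rewrite le_max normr_ge0.
    exact: le_trans Az.
  have bw : r <= b%:~R * nW N <= 5 / 2 * r.
    have e : r = r / w * w by rewrite divfK // gt_eqF.
    apply/andP; split.
      by rewrite [leLHS]e ler_pM2r //; lra.
    apply: (@le_trans _ _ (2 * (r / w + 1) * w)); first by rewrite ler_pM2r //; lra.
    rewrite (_ : 2 * (r / w + 1) * w = 2 * (r / w * w) + 2 * w); last by ring.
    by rewrite -e; lra.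
  have [] // := andP (nx_bounds (a := a%:Z) (b := b%:Z) _ _ aV bw).
  by clear -r0; move=> *; apply/andP; split; lra.
(* The bound 6 for [W] is relaxed to 25/4 for a round product: 1/20 from [A], 4/25 from [B] and 1/8
   from [J] give 1/1000 = 8 / 20 ^ 3. The 8 is what [coprime_count] loses. *)
have c0 : 0 < 25 / 4 * (h / T) by rewrite mulr_gt0 // divr_gt0.
have wc : w <= 25 / 4 * (h / T) by apply: le_trans w2 _; rewrite ler_pM2r // ler_pdivlMr //; lra.
have rw6 : r / (25 / 4 * (h / T)) <= r / w by rewrite ler_pM2l // lef_pV2 ?posrE.
clearbody w A B J X z; clear -T0 T'0 h0 r0 A2 B2 J3 zh rw6.
have c1 : r * h / 20 <= A%:R by lra.
have c2 : r / (25 / 4 * (h / T)) <= B%:R by lra.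
have -> : 8 * (h' ^+ 2 * T' / (20 ^+ 3 * T ^+ 2)) =
    r * h / 20 * (r / (25 / 4 * (h / T))) * (T' / (8 * T)).
  by rewrite /r; field; rewrite !gt_eqF.
have c3 : 0 <= r * h / 20 by rewrite divr_ge0 // mulr_ge0 // ltW.
have c4 : 0 <= r / (25 / 4 * (h / T)) by rewrite divr_ge0 ?(ltW r0) // mulr_ge0 // ?divr_ge0 // ltW.
have c5 : 0 <= T' / (8 * T) by rewrite divr_ge0 ?(ltW T'0) // mulr_ge0 // ltW.
by apply: ler_pM => //; [exact: mulr_ge0 | exact: ler_pM].
Qed.

(** The floor puts the sum into the interval from [T' - q] to [T'], and the next [J] steps of length
    [q] stay within [[T', 2 T']]. *)
Lemma shift_into (T' q : R) (J l : nat) (u : int) : 0 < q -> J%:R * q <= T' -> (0 < l <= J)%N ->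
  T' <= u%:~R + (Num.floor ((T' - u%:~R) / q) + l%:Z)%:~R * q <= 2 * T'.
Proof.
move=> q0 Jq /andP[l0 lJ].
have f1 := floor_le ((T' - u%:~R) / q).
have f2 := floorD1_gt ((T' - u%:~R) / q).
set f := Num.floor _ in f1 f2 *.
rewrite ler_pdivlMr // in f1; rewrite intrD ltr_pdivrMr // in f2.
have : 1 * q <= l%:~R * q by rewrite ler_pM2r // -[leRHS]/(l%:R) (ler_nat _ 1).
have : l%:~R * q <= J%:R * q by rewrite ler_pM2r // -[leLHS]/(l%:R) ler_nat.
by rewrite intrD mulrDl in f2 *; move=> *; apply/andP; split; lra.
Qed.

(** Children are labelled by coprime [(a, b)] and one of [J] shifts by [Q]. Equal [(a, b)] give
    denominators at least [T] apart, and this case sets the separation. For different [(a, b)]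
    coprimality makes [a b' - b a'] nonzero, and the resulting distance [1 / (48 T' h')] is no
    smaller because [144 h'^2 <= T']. *)
Lemma node_children (T h T' h' : R) (N : node) :
  0 < T -> 0 < h -> 144 * h ^+ 2 <= T -> 144 * h' ^+ 2 <= T' ->
  10 * T <= h * h' -> 24 * h <= h' -> 4 * T <= T' -> ok T h N ->
  exists n (y : 'I_n -> node),
    [/\ h' ^+ 2 * T' / (20 ^+ 3 * T ^+ 2) <= n%:R,
        forall i, [/\ ok T' h' (y i), `|center (y i) - center N| <= 3 * h' / (T * T')
          & center (y i) != center N :> 'rV[R]_2] &
        forall i j, i != j -> h' / (8 * T' ^+ 2) <= `|center (y i) - center (y j) : 'rV[R]_2|].
Proof.
move=> T0 h0 hT hT' hh h24 TT okN.
have h'0 : 0 < h' by move: h0 h24; clear; lra.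
have T'0 : 0 < T' by move: T0 TT; clear; lra.
have [A [B [J [[A1 AB] nxAB J4 cardABJ]]]] := node_sizes T0 h0 hT hh h24 TT okN.
have [dN /andP[q1 q2] _ _] := okN.
set q : R := (q0 N)%:~R in q1 q2 J4.
have q_gt0 : 0 < q := lt_le_trans T0 q1.
have qN0 : 0 < q0 N by rewrite -(ltr0z R).
pose r := h' / T.
have r0 : 0 < r by rewrite divr_gt0.
clear hh h24 TT hT h0.
pose C := [set p : 'I_A * 'I_B | coprime p.1.+1 (B + p.2).+1]%SET.
pose P := finset.setX C [set: 'I_J]%SET.
have cardP : (A * B * J <= 8 * #|P|)%N.
  rewrite cardsX cardsT card_ord mulnA leq_mul2r; apply/orP; right.
  have -> : #|C| = (\sum_(i < A) \sum_(k < B) coprime i.+1 (B + k).+1)%N.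
    rewrite -sum1_card big_mkcond pair_bigA /=; apply: eq_bigr => p _.
    by rewrite inE; case: coprime.
  exact: coprime_count.
pose aa (t : 'I_A * 'I_B * 'I_J) : int := (t.1.1).+1%:Z.
pose bb (t : 'I_A * 'I_B * 'I_J) : int := (B + t.1.2).+1%:Z.
pose uu (t : 'I_A * 'I_B * 'I_J) : int := aa t * v0 N + bb t * w0 N.
pose jj (t : 'I_A * 'I_B * 'I_J) : int := Num.floor ((T' - (uu t)%:~R) / q) + (t.2).+1%:Z.
pose U t : R := (uu t + jj t * q0 N)%:~R.
have UE t : T' <= U t <= 2 * T'.
  rewrite /U /jj intrD intrM -/q; apply: (@shift_into T' q J _ (uu t)) => //.
  exact: (valP t.2).
have nxE t : r / 2 <= nx N (aa t) (bb t) <= 3 * r.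
  apply: nxAB; first exact: ltn_ord.
  by rewrite -addnS leq_addr mul2n -addnn leq_add2l /= ltn_ord.
have /choice[Y YP] : forall t, exists N', t \in P -> ok T' h' N' /\
    exists c d n, N' = child N (aa t) (bb t) c d (jj t) n.
  move=> t; case: (boolP (t \in P)) => tP; last by exists N.
  have cop : coprimez (aa t) (bb t).
    by move: tP; rewrite !inE andbT.
  by have [N' ok' chN'] := child_ok T0 T'0 h'0 okN cop (nxE t) (UE t); exists N'.
exists #|P|, (fun i => Y (enum_val i)).
have cY t l : t \in P -> (center (Y t) - center N) 0 l =
    xx N (aa t) (bb t) (l == 0) / U t.
  move=> /YP[_ [c [d [n ->]]]].
  have u0 : 0 < q0 (child N (aa t) (bb t) c d (jj t) n).
    by rewrite -(ltr0z R); have /andP[+ _] := UE t; exact: lt_le_trans.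
  by apply: center_child; rewrite gt_eqF.
split.
- have : (A * B * J)%:R <= (8 * #|P|)%:R :> R by rewrite ler_nat.
  by rewrite !natrM; move: cardABJ; clear; lra.
- move=> i; have tP := enum_valP i; set t := enum_val i in tP *.
  have /andP[n1 n2] := nxE t; have /andP[U1 U2] := UE t.
  have U0 : 0 < U t := lt_le_trans T'0 U1.
  split; first by have [] := YP _ tP.
    have e : 3 * h' / (T * T') = 3 * r / T' by rewrite /r; field; rewrite !gt_eqF.
    have b l : `|(center (Y t) - center N) 0 l| <= 3 * h' / (T * T').
      rewrite cY // normrM normfV (gtr0_norm U0) e.
      apply: ler_pM => //; first by rewrite invr_ge0 ltW.
        by apply: le_trans n2; rewrite /nx le_max; case: (l == 0); rewrite lexx ?orbT.
      by rewrite lef_pV2 ?posrE.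
    by rewrite norm2_le !b.
  apply/eqP => ce.
  have x0 l : xx N (aa t) (bb t) (l == 0 :> 'I_2) = 0 :> R.
    have := cY t l tP; rewrite ce subrr mxE => /esym/eqP.
    by rewrite mulf_eq0 invr_eq0 (gt_eqF U0) orbF => /eqP.
  have x0t : xx N (aa t) (bb t) true = 0 :> R by exact: (x0 0).
  have x0f : xx N (aa t) (bb t) false = 0 :> R by exact: (x0 1).
  by move: n1; rewrite /nx x0t x0f normr0 maxxx leNgt divr_gt0.
- move=> i j ij; have tP := enum_valP i; have sP := enum_valP j.
  have ts : enum_val i != enum_val j by apply: contraNneq ij => /enum_val_inj ->.
  move: tP sP ts; set t := enum_val i; set s := enum_val j => tP sP ts.
  have dE l : (center (Y t) - center (Y s)) 0 l =
    xx N (aa t) (bb t) (l == 0) / U t - xx N (aa s) (bb s) (l == 0) / U s.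
    by rewrite -!cY // !mxE; ring.
  set e := `|_|.
  have /andP[] : (`|(center (Y t) - center (Y s)) 0 0| <= e) && (`|(center (Y t) - center (Y s)) 0 1| <= e).
    by rewrite -norm2_le.
  rewrite !dE /= => e1 e2.
  have /andP[n1 n2] := nxE t.
  have [abE|abN] := eqVneq t.1 s.1.
    have aE : aa t = aa s by rewrite /aa abE.
    have bE : bb t = bb s by rewrite /bb abE.
    have uE : uu t = uu s by rewrite /uu aE bE.
    have : r * T / (8 * T' ^+ 2) <= e.
      apply: (sep_same_direction T0 T'0 r0 (UE t) (UE s) n1) => //.
        rewrite /U /jj uE -intrB opprD addrACA subrr add0r -mulrBl opprD addrACA subrr add0r.
        rewrite intrM normrM -/q (gtr0_norm q_gt0).
        apply: le_trans q1 _; rewrite -[leLHS]mul1r ler_pM2r //.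
        rewrite -intr_norm (ler1z R) -gtz0_ge1 normr_gt0 subr_eq0.
        apply: contraNneq ts => -[] e'; case: (t) (s) abE e' => [t1 t2] [s1 s2] /= -> e'.
        by apply/eqP; congr (_, _); apply/val_inj.
      by rewrite aE bE in e1 *.
      by rewrite aE bE in e2 *.
    by have -> : r * T = h' by rewrite /r divfK // gt_eqF.
  have : (48 * T * T' * r)^-1 <= e.
    apply: (sep_directions T0 T'0 r0 (UE t) (UE s) n2 _ e1 e2).
    rewrite xx_det ?gt_eqF // normrM normfV -/q (gtr0_norm q_gt0).
    rewrite -[leLHS]mul1r; apply: ler_pM => //;
      [by rewrite invr_ge0 mulr_ge0 // ltW| |by rewrite lef_pV2 ?posrE ?mulr_gt0].
    rewrite -intr_norm (ler1z R) -gtz0_ge1 normr_gt0 subr_eq0.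
    apply: contraNneq abN; rewrite /aa /bb -!PoszM => /(congr1 absz) e'.
    have ct : coprime (t.1.1).+1 (B + t.1.2).+1 by move: tP; rewrite !inE andbT.
    have cs : coprime (s.1.1).+1 (B + s.1.2).+1 by move: sP; rewrite !inE andbT.
    have [a_eq b_eq] := coprime_cross (ltn0Sn _) ct cs e'.
    case: (t.1) (s.1) a_eq b_eq => [t1 t2] [s1 s2] /= [] a_eq [] /addnI b_eq.
    by apply/eqP; congr (_, _); apply/val_inj.
  apply: le_trans; have -> : 48 * T * T' * r = 48 * T' * h' by rewrite /r; field; rewrite gt_eqF.
  rewrite ler_pdivrMr ?mulr_gt0 ?exprn_gt0 // ler_pdivlMl ?mulr_gt0 //.
  have : T' * (48 * h' ^+ 2) <= T' * (8 * T').
    by rewrite ler_pM2l //; move: hT' (sqr_ge0 h'); clear; lra.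
  by rewrite !expr2; clear; lra.
Qed.

End children.

(** * The rank of the group generated by a point and the integer lattice *)

Section rank_facts.
Context {R : realType}.
Implicit Types theta : 'rV[R]_2.

Lemma clear_denominators n (u : 'rV[rat]_n) :
  exists2 d : int, d != 0 & exists c : 'I_n -> int, forall i, u 0 i * d%:~R = (c i)%:~R.
Proof.
exists (\prod_i denq (u 0 i)); first by apply/prodf_neq0 => i _; exact: denq_neq0.
exists (fun i => numq (u 0 i) * \prod_(j | j != i) denq (u 0 j)) => i.
by rewrite (bigD1 i) //= !intrM numqE mulrA.
Qed.

Lemma int_rows_dependent m n (M : 'M[int]_(m, n)) : (n < m)%N ->
  exists2 c : 'I_m -> int, (exists i, c i != 0) & forall j, \sum_i c i * M i j = 0.
Proof.
move=> nm; pose A : 'M[rat]_(m, n) := map_mx intr M.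
have : kermx A != 0.
  rewrite kermx_eq0 /row_free; apply: contraTneq nm => <-.
  by rewrite -leqNgt rank_leq_col.
case/rowV0Pn => u /sub_kermxP uA u0.
have [d d0 [c cE]] := clear_denominators u; exists c.
  have [i ui] : exists i, u 0 i != 0.
    apply/existsP; rewrite -negb_forall; apply: contra u0 => /forallP h.
    by apply/eqP/rowP => i; rewrite mxE; apply/eqP; have := h i.
  by exists i; rewrite -(intr_eq0 rat) -cE mulf_neq0 // intr_eq0.
move=> j; apply/eqP; rewrite -(intr_eq0 rat) rmorph_sum /=.
have := congr1 (fun B : 'rV[rat]_n => B 0 j * d%:~R) uA; rewrite !mxE mul0r => h.
apply/eqP; rewrite -[RHS]h mulr_suml; apply: eq_bigr => i _.
by rewrite intrM -cE !mxE; ring.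
Qed.

(** A relation among [theta] and the two unit vectors has the form that the hypothesis excludes for
    a nonzero coefficient of [theta]. Four elements of the group have integer coordinates in a 4 by
    3 matrix, whose rows are dependent. *)
Lemma has_rank3 theta :
  (forall (n : int) (p : 'rV[int]_2), n%:~R *: theta + intvec p = 0 -> n = 0) ->
  has_rank (theta_group theta) 3.
Proof.
move=> irr; split.
  exists (fun i : 'I_3 => if i == 0 then theta else
    if i == 1 then intvec (delta_mx 0 0) else intvec (delta_mx 0 1)); split.
    move=> i; case: ifP => _; first by exists 1, 0; apply/rowP => j; rewrite !mxE; ring.
    by case: ifP => _; exists 0; eexists; rewrite scale0r add0r.
  move=> c; rewrite !big_ord_recl big_ord0 /= => e.
  pose p : 'rV[int]_2 := \row_j (if j == 0 then c 1 else c (lift 0 (lift 0 0))).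
  have e' : (c 0)%:~R *: theta + intvec p = 0.
    rewrite -[RHS]e; apply/rowP => j; rewrite !mxE addr0.
    have z (m : int) (v : 'rV[R]_2) k : (v *~ m) 0 k = v 0 k * m%:~R.
      by rewrite -scaler_int mxE mulrC.
    rewrite !z !mxE mulrC (_ : lift 0 0 = 1 :> 'I_3); last exact/val_inj.
    by case: (ord2P j) => ->; rewrite /=; ring.
  have c0 : c 0 = 0 := irr _ _ e'.
  have pj j : p 0 j = 0.
    have := congr1 (fun v : 'rV[R]_2 => v 0 j) e'; rewrite c0 scale0r add0r !mxE => /eqP.
    by rewrite intr_eq0 => /eqP.
  have c1 : c 1 = 0 by have := pj 0; rewrite mxE.
  have c2 : c (lift 0 (lift 0 0)) = 0 by have := pj 1; rewrite mxE.
  case=> -[|[|[|//]]] i3.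
  - by rewrite -c0; congr c; exact/val_inj.
  - by rewrite -c1; congr c; exact/val_inj.
  - by rewrite -c2; congr c; exact/val_inj.
move=> v hv ind.
have [f fE] : {f : 'I_4 -> int * 'rV[int]_2 & forall i, v i = (f i).1%:~R *: theta + intvec (f i).2}.
  apply: (@choice _ _ (fun i (f : int * 'rV[int]_2) => v i = f.1%:~R *: theta + intvec f.2)) => i.
  by have [q [p ->]] := hv i; exists (q, p).
pose M : 'M[int]_(4, 3) := \matrix_(i, j)
  (if j == 0 then (f i).1 else if j == 1 then (f i).2 0 0 else (f i).2 0 1).
have [c [i0 ci0] cM] := int_rows_dependent M (isT : (3 < 4)%N).
move/eqP: ci0; apply; apply: ind; apply/rowP => j.
have z (m : int) (w : 'rV[R]_2) k : (w *~ m) 0 k = w 0 k * m%:~R.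
  by rewrite -scaler_int mxE mulrC.
have cMr l : \sum_i (c i)%:~R * (M i l)%:~R = 0 :> R.
  rewrite -[RHS](rmorph0 intr) -(cM l) rmorph_sum /=.
  by apply: eq_bigr => i _; rewrite intrM.
rewrite summxE mxE.
transitivity (theta 0 j * (\sum_i (c i)%:~R * (M i 0)%:~R) +
   \sum_i (c i)%:~R * (M i (if j == 0 then 1 else lift 0 (lift 0 0)))%:~R); last first.
  by rewrite !cMr mulr0 addr0.
rewrite mulr_sumr -big_split /=; apply: eq_bigr => i _.
by rewrite z fE !mxE; case: (ord2P j) => -> /=; ring.
Qed.

Lemma dist_to_int_le theta (p : 'rV[int]_2) : dist_to_int theta <= `|theta - intvec p|.
Proof.
apply: ge_inf; last by exists p.
by exists 0 => _ [q _ <-]; exact: normr_ge0.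
Qed.

End rank_facts.

(** * The lower bound *)

Section scales.
Context {R : realType}.

Lemma powR_const_le (c t x y : R) : 0 < t -> c <= t `^ (y - x) -> c * t `^ x <= t `^ y.
Proof.
move=> t0 h; have -> : t `^ y = t `^ (y - x) * t `^ x by rewrite -powR_add // subrK.
by rewrite ler_wpM2r // powR_ge0.
Qed.

(* The hypotheses say that, as [t] grows, the leading powers of [t] in the eight
   inequalities compare in the right direction. *)
Lemma scales_exist (ga a ka e s : R) : 1 < ga -> 0 < ka -> a = 1 / 2 - ka -> 0 < a ->
  0 < a * (1 + ga) - 1 ->
  0 < 2 * e + 4 * (ga * a) - 3 * ga - 2 ->
  0 < 2 * (ga * a) + ga - 2 - (ga * e - e) * s ->
  exists T0 : R, 1 <= T0 /\ forall t, T0 <= t ->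
    let t' := t `^ ga in let t'' := t' `^ ga in
    let h := t `^ a in let h' := t' `^ a in let h'' := t'' `^ a in
    [/\ 144 * h ^+ 2 <= t, 10 * t <= h * h', 24 * h <= h' & 4 * t <= t'] /\
    [/\ 192 * h'' * t' <= h' * t'',
        100 * (t `^ (- e)) ^+ 2 <=
          (h' / (8 * t' ^+ 2)) ^+ 2 * (h' ^+ 2 * t' / (20 ^+ 3 * t ^+ 2)),
        (t `^ (- e) / t' `^ (- e)) `^ s <= h' ^+ 2 * t' / (20 ^+ 3 * t ^+ 2) &
        24 <= t `^ (ka / 2)].
Proof.
move=> ga1 ka0 aE a0 P2 P6 P7.
have ga0 : 0 < ga - 1 by lra.
have P5 : 0 < ga * a + ga * ga - (ga * ga * a + ga).
  have -> : ga * a + ga * ga - (ga * ga * a + ga) = ga * (ga - 1) * (1 - a) by ring.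
  by rewrite !mulr_gt0 //; lra.
have P3 : 0 < ga * a - a by rewrite -[X in _ - X]mul1r -mulrBl mulr_gt0.
have ka2 : 0 < 2 * ka by rewrite mulr_gt0.
have ka3 : 0 < ka / 2 by rewrite divr_gt0.
have [T1 [T11 h1]] := powR_unbounded 144 ka2.
have [T2 [T21 h2]] := powR_unbounded 10 P2.
have [T3 [T31 h3]] := powR_unbounded 24 P3.
have [T4 [T41 h4]] := powR_unbounded 4 ga0.
have [T5 [T51 h5]] := powR_unbounded 192 P5.
have [T6 [T61 h6]] := powR_unbounded (100 * (64 * 20 ^+ 3)) P6.
have [T7 [T71 h7]] := powR_unbounded (20 ^+ 3) P7.
have [T8 [T81 h8]] := powR_unbounded 24 ka3.
exists (T1 + (T2 + (T3 + (T4 + (T5 + (T6 + (T7 + T8))))))); split; first by lra.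
move=> t tT.
have l1 : T1 <= t by lra.
have l2 : T2 <= t by lra.
have l3 : T3 <= t by lra.
have l4 : T4 <= t by lra.
have l5 : T5 <= t by lra.
have l6 : T6 <= t by lra.
have l7 : T7 <= t by lra.
have l8 : T8 <= t by lra.
have {}h1 := h1 _ l1; have {}h2 := h2 _ l2; have {}h3 := h3 _ l3; have {}h4 := h4 _ l4.
have {}h5 := h5 _ l5; have {}h6 := h6 _ l6; have {}h7 := h7 _ l7; have {}h8 := h8 _ l8.
have t0 : 0 < t by lra.
clear l1 l2 l3 l4 l5 l6 l7 l8 tT T11 T21 T31 T41 T51 T61 T71 T81.
have tE : t = t `^ 1 by rewrite powRr1 // ltW.
move=> t' t'' h h' h''.
have sq x : (t `^ x) ^+ 2 = t `^ (x + x) by rewrite expr2 powR_add.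
have hE' : h' = t `^ (ga * a) by rewrite /h' /t' -powRrM.
have tE'' : t'' = t `^ (ga * ga) by rewrite /t'' /t' -powRrM.
have hE'' : h'' = t `^ (ga * ga * a) by rewrite /h'' tE'' -powRrM.
have mE : h' ^+ 2 * t' / (20 ^+ 3 * t ^+ 2) = t `^ (2 * (ga * a) + ga - 2) / 20 ^+ 3.
  have -> : t `^ (2 * (ga * a) + ga - 2) = h' ^+ 2 * t' / t ^+ 2.
    rewrite hE' sq /t' -powR_add // -powR_mulrn ?(ltW t0) // -powRB.
      by congr (_ `^ _); ring.
    by rewrite (gt_eqF t0) implybT.
  by field; rewrite gt_eqF.
split; split.
- rewrite /h sq [leRHS]tE; apply: powR_const_le => //.
  by rewrite (_ : 1 - (a + a) = 2 * ka) // aE; field.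
- rewrite [in leLHS]tE hE' /h -powR_add //; apply: powR_const_le => //.
  by rewrite (_ : a + ga * a - 1 = a * (1 + ga) - 1) //; ring.
- by rewrite hE' /h; apply: powR_const_le.
- by rewrite [in leLHS]tE; apply: powR_const_le.
- rewrite hE'' hE' tE'' /t' -mulrA -!powR_add //; exact: powR_const_le.
- rewrite mE sq.
  have -> : (h' / (8 * t' ^+ 2)) ^+ 2 * (t `^ (2 * (ga * a) + ga - 2) / 20 ^+ 3) =
     t `^ (4 * (ga * a) - 3 * ga - 2) / (64 * 20 ^+ 3).
    have -> : t `^ (4 * (ga * a) - 3 * ga - 2) =
      (h' / t' ^+ 2) ^+ 2 * t `^ (2 * (ga * a) + ga - 2).
      rewrite hE' sq /t' -powRB; last by rewrite (gt_eqF t0) implybT.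
      by rewrite sq -powR_add //; congr (_ `^ _); ring.
    have t'0 : 0 < t' by rewrite powR_gt0.
    by field; rewrite gt_eqF.
  rewrite ler_pdivlMr ?mulr_gt0 ?exprn_gt0 // mulrAC.
  apply: powR_const_le => //.
  by rewrite (_ : _ - (- e + - e) = 2 * e + 4 * (ga * a) - 3 * ga - 2) //; ring.
- rewrite mE /t' -powRrM -powRB; last by rewrite (gt_eqF t0) implybT.
  rewrite -powRrM ler_pdivlMr ?exprn_gt0 // mulrC; apply: powR_const_le => //.
  by rewrite (_ : _ - _ = 2 * (ga * a) + ga - 2 - (ga * e - e) * s) //; ring.
- exact: h8.
Qed.

(** The vectors [V = (-1, 0, k)], [W = (0, 0, 1)], [Q = (n, 1, q)] have determinant 1 whatever [k],
    [n] and [q] are. [W] projects to [- (n, 1) / q], so [n] near [h] and [q] near [T] give the right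
    length, and [k] reduces [V]. *)
Lemma root_node (T h : R) : 1 <= T -> 1 <= h -> exists N, ok T h N.
Proof.
move=> T1 h1.
have T0 : 0 < T by lra.
have h0 : 0 < h by lra.
have nat_near (x : R) : 1 <= x -> exists n : int, x <= n%:~R <= 2 * x.
  move=> x1; exists (Num.floor x + 1).
  have := floor_le x; have := floorD1_gt x; rewrite !intrD.
  by move=> *; apply/andP; split; lra.
have [q /andP[q1 q2]] := nat_near _ T1; have [n /andP[n1 n2]] := nat_near _ h1.
have q0 : 0 < q%:~R :> R by lra.
have n0 : 0 < n%:~R :> R by lra.
have qn : q%:~R != 0 :> R by rewrite gt_eqF.
pose y1 : R := - (n%:~R / q%:~R); pose y2 : R := - (q%:~R)^-1.
have wE : Num.max `|y1| `|y2| = n%:~R / q%:~R.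
  rewrite /y1 /y2 !normrN !normrM normfV (gtr0_norm n0) (gtr0_norm q0).
  apply/max_idPl; rewrite -[leLHS]mul1r ler_pM2r ?invr_gt0 //; lra.
have w0 : 0 < Num.max `|y1| `|y2| by rewrite wE divr_gt0.
have [k hk] := reduce_vector (-1) 0 w0.
pose N := Node (- 1) 0 k 0 0 1 n 1 q.
have WE : nW N = n%:~R / q%:~R :> R.
  rewrite -wE /nW /pj /= /y1 /y2; congr (Num.max _ _); congr (`|_|); by field.
have VE : nV N = Num.max `|-1 + k%:~R * y1| `|0 + k%:~R * y2| :> R.
  by rewrite /nV /pj /= /y1 /y2; congr (Num.max _ _); congr (`|_|); field.
exists N; split.
- by rewrite /ndet /=; ring.
- by rewrite /= q1 q2.
- rewrite WE; apply/andP; split.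
    have -> : h / T / 4 = (h / 2) / (2 * T) by field; rewrite gt_eqF.
    by apply: ler_pM; rewrite ?invr_ge0 ?lef_pV2 ?posrE ?mulr_gt0 //; lra.
  rewrite mulrA; apply: ler_pM; rewrite ?invr_ge0 ?lef_pV2 ?posrE //; lra.
- rewrite VE; apply: le_trans hk _; rewrite wE WE lerD2r mul0r subr0 /= mulN1r opprK.
  by rewrite [leRHS]invfM gtr0_norm ?invr_gt0.
Qed.

End scales.

Section lower_bound.
Context {R : realType}.

Lemma scale_between (T : nat -> R) (X : R) : T 0%N <= X -> (forall k, exists n, k%:R <= T n) ->
  exists k, T k <= X < T k.+1.
Proof.
move=> T0X Tinf.
have [N XN] : exists n, X < T n.
  have [n hn] := Tinf (Num.truncn `|X|).+1; exists n; apply: lt_le_trans hn.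
  by apply: le_lt_trans (ler_norm X) _; have /andP[] := truncn_itv (normr_ge0 X).
case: (ex_minnP (ex_intro (fun n => X < T n) N XN)) => -[|k] Xk kmin.
  by move: Xk; rewrite ltNge T0X.
exists k; rewrite Xk andbT leNgt; apply/negP => /kmin.
by rewrite ltnn.
Qed.

Lemma near_pinfty_ge (P : R -> Prop) (M : R) : (forall X, M <= X -> P X) -> \forall X \near +oo_R, P X.
Proof.
by move=> h; exists M; split; [exact: num_real | move=> X /ltW; exact: h].
Qed.

Lemma sing_measure_neq0 (T h : nat -> R) (a ka e s mu : R) (N0 : node) :
  0 < s <= 2 -> 0 < ka <= 1 -> 1 <= e -> a = 1 / 2 - ka ->
  (forall k, 1 <= T k) -> (forall k, 1 <= h k) -> (forall k, h k = T k `^ a) ->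
  (forall k, [/\ 144 * h k ^+ 2 <= T k, 10 * T k <= h k * h k.+1, 24 * h k <= h k.+1
    & 4 * T k <= T k.+1]) ->
  (forall k, [/\ 192 * h k.+2 * T k.+1 <= h k.+1 * T k.+2,
        100 * (T k `^ (- e)) ^+ 2 <=
          (h k.+1 / (8 * T k.+1 ^+ 2)) ^+ 2 * (h k.+1 ^+ 2 * T k.+1 / (20 ^+ 3 * T k ^+ 2)),
        (T k `^ (- e) / T k.+1 `^ (- e)) `^ s <= h k.+1 ^+ 2 * T k.+1 / (20 ^+ 3 * T k ^+ 2) &
        24 <= T k `^ (ka / 2)]) ->
  0 <= mu -> mu <= 1 / 2 + ka / 2 -> ok (T 0%N) (h 0%N) N0 ->
  hausdorff_measure s (@Sing_star R mu) != 0%E.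
Proof.
move=> s02 /andP[ka0 ka1] e1 aE T1 h1 hE scA scB mu0 mu1 N0ok.
have Tgt0 k : 0 < T k := lt_le_trans ltr01 (T1 k).
have hgt0 k : 0 < h k := lt_le_trans ltr01 (h1 k).
have Tk k : k%:R <= T k.
  elim: k => [|k IH]; first exact: le_trans (T1 _).
  by have [_ _ _ T4] := scA k; have := T1 k; rewrite -natr1; lra.
have hk k : k%:R <= h k.
  elim: k => [|k IH]; first exact: le_trans (h1 _).
  by have [_ _ h4 _] := scA k; have := h1 k; rewrite -natr1; lra.
(* Twice the distance from a center to the centers of its children, which leaves room for the balls
   of the children. *)
pose rho k := 6 * h k.+1 / (T k * T k.+1).
pose g k := h k.+1 / (8 * T k.+1 ^+ 2).
pose m k := h k.+1 ^+ 2 * T k.+1 / (20 ^+ 3 * T k ^+ 2).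
pose omega k := T k `^ (- e).
have rho0 k : 0 <= rho k by rewrite /rho divr_ge0 // ?mulr_ge0 // ltW // mulr_gt0.
have qrho k N : ok (T k) (h k) N -> (q0 N)%:~R * rho k <= 12 * (h k.+1 / T k.+1).
  move=> [_ /andP[_ q2] _ _].
  have -> : 12 * (h k.+1 / T k.+1) = (2 * T k) * rho k.
    by rewrite /rho; field; rewrite !gt_eqF.
  by rewrite ler_wpM2r.
refine (cantor_measure_neq0 (good := fun k N => ok (T k) (h k) N) (c := @center R)
  (rho := rho) (g := g) (omega := omega) (m := m) s02 rho0 _ _ _ _ _ _ _ N0ok _).
- by move=> k; rewrite divr_gt0 // mulr_gt0 // exprn_gt0.
- by move=> k; rewrite powR_gt0.
- move=> z z0; exists (Num.truncn z^-1).+1.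
  set k := (Num.truncn _).+1.
  have zi : 0 <= z^-1 by rewrite invr_ge0 ltW.
  have zk : z^-1 < k%:R by case/andP: (truncn_itv zi).
  have Tz : z^-1 < T k := lt_le_trans zk (Tk k).
  rewrite /omega; apply: (@le_lt_trans _ _ (T k `^ (-1))).
    by apply: ler_powR => //; rewrite lerN2.
  by rewrite powR_inv1 ?ltW // invf_plt ?posrE.
- move=> k; have [c1 _ _ _] := scB k.
  rewrite /rho /g; move: c1 (Tgt0 k.+1) (Tgt0 k.+2); clear.
  move: (T k.+1) (T k.+2) (h k.+1) (h k.+2) => t t' x x' c1 t0 t'0.
  rewrite mulrA ler_pdivrMr ?mulr_gt0 // mulrAC ler_pdivlMr ?mulr_gt0 ?exprn_gt0 //.
  have : t * (192 * x' * t) <= t * (x * t') by rewrite ler_pM2l.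
  by rewrite !expr2; lra.
- by move=> k; have [] := scB k.
- by move=> k; have [] := scB k.
- move=> k N Nok; have [c1 c2 c3 c4] := scA k; have [c5 _ _ _] := scA k.+1.
  have [n [y [y1 y2 y3]]] := node_children (Tgt0 k) (hgt0 k) c1 c5 c2 c3 c4 Nok.
  exists n, y; split => // i; have [i1 i2 i3] := y2 i; split => //.
  apply: le_trans (lerD i2 (lexx _)) _; rewrite -lerBrDl.
  have -> : rho k - 3 * h k.+1 / (T k * T k.+1) = 3 * h k.+1 / (T k * T k.+1).
    by rewrite /rho; field; rewrite !gt_eqF.
  have [c6 _ _ _] := scB k.
  rewrite /rho; move: c4 c6 (Tgt0 k) (Tgt0 k.+1) (Tgt0 k.+2) (hgt0 k.+2); clear.
  move: (T k) (T k.+1) (T k.+2) (h k.+1) (h k.+2) => u t t' x x' c4 c6 u0 t0 t'0 x'0.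
  rewrite ler_pdivrMr ?mulr_gt0 // mulrAC ler_pdivlMr ?mulr_gt0 //.
  have c7 : t * (192 * x' * t) <= t * (x * t') by rewrite ler_pM2l.
  have c8 : x' * t * u <= x' * t * t by rewrite ler_pM2l ?mulr_gt0 //; lra.
  have : 0 < x' * t * t by rewrite !mulr_gt0.
  by lra.
- move=> x t xP; have near k l : `|(q0 (x k))%:~R * t 0 l - (if l == 0 then p1 (x k) else p2 (x k))%:~R|
      <= 12 * (h k.+1 / T k.+1).
    have [xk _ tk] := xP k; apply: le_trans (qrho _ _ xk).
    have [_ /andP[qT _] _ _] := xk.
    have q_gt0 : 0 < (q0 (x k))%:~R :> R := lt_le_trans (Tgt0 k) qT.
    have -> : (q0 (x k))%:~R * t 0 l - (if l == 0 then p1 (x k) else p2 (x k))%:~R =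
       (q0 (x k))%:~R * (t - center (x k)) 0 l.
      by rewrite !mxE; case: ifP => _; field; rewrite gt_eqF.
    rewrite normrM (gtr0_norm q_gt0) ler_pM2l //.
    by move: tk; rewrite norm2_le; case: (ord2P l) => -> /andP[].
  split.
    (* If [n t + p = 0], then for [k >= |n|] the integers [q0 p + n P] are smaller than 1 in
       absolute value, hence 0, so that [t] is the center of [x k]. This would hold for two
       consecutive nodes, whose centers differ. *)
    apply: has_rank3 => n p np; apply/eqP/negPn/negP => n0.
    have ht k : 12 * (h k.+1 / T k.+1) * k%:R < 1.
      have [c1 _ _ _] := scA k.+1; have := hk k.+1; rewrite -natr1 => c2.
      rewrite mulrA mulrAC ltr_pdivrMr // mul1r.
      apply: lt_le_trans c1; move: (hgt0 k.+1) c2; move: (h k.+1) (k%:R) => z y z0 c2.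
      have : z * y < z * z by rewrite ltr_pM2l //; lra.
      by have : 0 < z * z := mulr_gt0 z0 z0; rewrite expr2; lra.
    have eq_center k : `|n|%:~R <= k%:R :> R -> t = center (x k).
      move=> nk; apply/rowP => l.
      have := congr1 (fun v : 'rV[R]_2 => v 0 l) np; rewrite !mxE => nl.
      set P := if l == 0 then p1 (x k) else p2 (x k).
      have [xk _ _] := xP k.
      have [_ /andP[qT _] _ _] := xk.
      have q_gt0 : 0 < (q0 (x k))%:~R :> R := lt_le_trans (Tgt0 k) qT.
      have : `|q0 (x k) * p 0 l + n * P| < 1.
        rewrite -(ltr_int R) intr_norm intrD !intrM.
        have -> : (q0 (x k))%:~R * (p 0 l)%:~R + n%:~R * P%:~R =
          - (n%:~R * ((q0 (x k))%:~R * t 0 l - P%:~R)) :> R.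
          rewrite (_ : (p 0 l)%:~R = - (n%:~R * t 0 l)); first by ring.
          by apply/eqP; rewrite -addr_eq0 addrC nl.
        rewrite normrN normrM -intr_norm mulrC; apply: le_lt_trans (ht k).
        by apply: ler_pM => //; exact: near.
      rewrite -ltzD1 add0r normr_lt0 || rewrite (_ : (_ < 1) = (`|q0 (x k) * p 0 l + n * P| <= 0)) // normr_le0.
      move=> /eqP e0.
      have nr : n%:~R != 0 :> R by rewrite intr_eq0.
      apply: (mulfI nr).
      have -> : (if l == 0 then (p1 (x k))%:~R / (q0 (x k))%:~R else (p2 (x k))%:~R / (q0 (x k))%:~R) =
        P%:~R / (q0 (x k))%:~R :> R by rewrite /P; case: ifP.
      have := congr1 (fun z : int => z%:~R : R) e0; rewrite intrD !intrM => e0'.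
      apply: (mulfI (lt0r_neq0 q_gt0)).
      have -> : (q0 (x k))%:~R * (n%:~R * (P%:~R / (q0 (x k))%:~R)) = n%:~R * P%:~R :> R.
        by field; rewrite gt_eqF.
      have -> : n%:~R * t 0 l = - (p 0 l)%:~R by apply/eqP; rewrite -addr_eq0 nl.
      by rewrite mulrN; apply/eqP; rewrite eq_sym -addr_eq0 addrC e0'.
    pose k := `|n|%N.
    have kE : `|n|%:~R <= k%:R :> R by rewrite /k -[leRHS]/((`|n|%N : int)%:~R) abszE.
    have kE1 : `|n|%:~R <= k.+1%:R :> R by apply: le_trans kE _; rewrite ler_nat.
    have [_ + _] := xP k; rewrite -(eq_center _ kE) -(eq_center _ kE1).
    by rewrite eqxx.
  (* For [X] between [2 T k] and [2 T k.+1] the denominator of [x k] serves, with error at most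
     [12 T k.+1 ^ (-1/2 - ka)]. Half of [ka] goes into absorbing the 12 and the passage from
     [2 T k.+1] to [T k.+1]. *)
  apply: (near_pinfty_ge (M := 2 * T 0%N)) => X X0.
  have [k /andP[k1 k2]] : exists k, 2 * T k <= X < 2 * T k.+1.
    apply: (scale_between (T := fun k => 2 * T k)) => // k; exists k.
    by have := Tk k; have := Tgt0 k; lra.
  have [xk _ tk] := xP k.
  have [_ /andP[qT q2T] _ _] := xk.
  have q_gt0 : 0 < (q0 (x k))%:~R :> R := lt_le_trans (Tgt0 k) qT.
  have q_gt0' : 0 < q0 (x k) by rewrite -(ltr0z R).
  exists (q0 (x k)); rewrite (gtr0_norm q_gt0'); split => //; first exact: le_trans k1.
  pose p : 'rV[int]_2 := \row_l (if l == 0 then p1 (x k) else p2 (x k)).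
  apply: le_trans (dist_to_int_le _ p) _.
  apply: (@le_trans _ _ (12 * (h k.+1 / T k.+1))).
    by rewrite norm2_le !mxE; apply/andP; split; [exact: (near k 0)|exact: (near k 1)].
  have X_gt0 : 0 < X by have := Tgt0 k; lra.
  have [_ _ _ c24] := scB k.+1.
  apply: (@le_trans _ _ ((2 * T k.+1) `^ (- mu))); last first.
    by apply: powR_leN => //; [exact: ltW|rewrite oppr_le0].
  apply: (@le_trans _ _ ((2 * T k.+1) `^ (- (1 / 2 + ka / 2)))); last first.
    by apply: ler_powR; [have := T1 k.+1; lra | rewrite lerN2].
  rewrite powRM ?(ltW (Tgt0 _)) //.
  have t2 : 1 / 2 <= (2 : R) `^ (- (1 / 2 + ka / 2)).
    apply: (@le_trans _ _ ((2 : R) `^ (-1))); first by rewrite powR_inv1 // mul1r.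
    apply: ler_powR; first by lra.
    by rewrite lerN2; lra.
  apply: (@le_trans _ _ (1 / 2 * T k.+1 `^ (- (1 / 2 + ka / 2)))); last first.
    by rewrite ler_wpM2r // powR_ge0.
  have -> : h k.+1 / T k.+1 = T k.+1 `^ (- (1 / 2 + ka)).
    rewrite hE (_ : - (1 / 2 + ka) = a - 1); last by rewrite aE; field.
    by rewrite powRB ?(gt_eqF (Tgt0 _)) ?implybT // powRr1 // ltW.
  have -> : T k.+1 `^ (- (1 / 2 + ka / 2)) = T k.+1 `^ (ka / 2) * T k.+1 `^ (- (1 / 2 + ka)).
    by rewrite -powR_add //; congr (_ `^ _); field.
  rewrite mulrA ler_wpM2r ?powR_ge0 //; lra.
Qed.

Lemma lower_bound (s : R) : 0 < s < 4 / 3 ->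
  exists2 mu1 : R, 1 / 2 < mu1 & forall mu, 1 / 2 < mu -> mu <= mu1 ->
    hausdorff_measure s (@Sing_star R mu) != 0%E.
Proof.
move=> /andP[s0 s43].
(* In the exponent comparing the number of children with what [s] asks for, the gain is
   [tau (2 - e s)], of order [tau ^ 2], and the loss is of order [ka]; hence [ka] is a small
   multiple of [tau ^ 2]. *)
pose tau := (4 / 3 - s) / 4; pose ka := tau ^+ 2 / 16.
have tau0 : 0 < tau by rewrite /tau; lra.
have tau1 : tau <= 1 / 3 by rewrite /tau; lra.
have sE : s = 4 / 3 - 4 * tau by rewrite /tau; field.
have ka0 : 0 < ka by rewrite /ka divr_gt0 // exprn_gt0.
have katau : 16 * ka = tau * tau by rewrite /ka; field.
have tt : tau * tau <= tau * (1 / 3) by rewrite ler_pM2l.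
have ka1 : ka <= tau / 48 by lra.
(* With [e = 1 + ga / 2 + 2 ga ka], [omega] would have the order of [g] times the square root of
   [m], the side of a square filled by the children. The extra [tau] wins a power of [T] over the
   constants in that comparison. *)
pose a := 1 / 2 - ka; pose ga := 1 + tau; pose e := 1 + ga / 2 + 2 * ga * ka + tau.
have a0 : 0 < a by rewrite /a; lra.
have P2 : 0 < a * (1 + ga) - 1.
  have -> : a * (1 + ga) - 1 = tau / 2 - 2 * ka - tau * ka by rewrite /a /ga; field.
  have : tau * ka <= 1 / 3 * ka by rewrite ler_pM2r.
  by lra.
have P6 : 0 < 2 * e + 4 * (ga * a) - 3 * ga - 2.
  have -> : 2 * e + 4 * (ga * a) - 3 * ga - 2 = 2 * tau by rewrite /e /a /ga; field.
  by rewrite mulr_gt0.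
have tk : tau * ka <= 1 / 3 * ka by rewrite ler_pM2r.
have P7 : 0 < 2 * (ga * a) + ga - 2 - (ga * e - e) * s.
  have -> : 2 * (ga * a) + ga - 2 - (ga * e - e) * s =
     tau * (2 - e * s) - 2 * ka - 2 * (tau * ka) by rewrite /e /a /ga; field.
  have e1 : e <= 3 / 2 + 2 * tau.
    have -> : e = 3 / 2 + 3 / 2 * tau + 2 * ka + 2 * (tau * ka) by rewrite /e /ga; field.
    by lra.
  have e2 : e * s <= 2 - 10 / 3 * tau.
    apply: (@le_trans _ _ ((3 / 2 + 2 * tau) * s)); first by rewrite ler_pM2r.
    rewrite {1}sE; have -> : (3 / 2 + 2 * tau) * (4 / 3 - 4 * tau) = 2 - 10 / 3 * tau - 8 * (tau * tau).
      by field.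
    by have : 0 < tau * tau := mulr_gt0 tau0 tau0; lra.
  have : tau * (10 / 3 * tau) <= tau * (2 - e * s) by rewrite ler_pM2l //; lra.
  by rewrite mulrCA -katau; lra.
have ga1 : 1 < ga by rewrite /ga; lra.
have ga0 : 0 < ga := lt_trans ltr01 ga1.
have gk : 0 < 2 * ga * ka by exact: mulr_gt0 (mulr_gt0 (ltr0Sn _ _) ga0) ka0.
have e1 : 1 <= e by rewrite /e; lra.
have [T0 [T01 sc]] := scales_exist ga1 ka0 (erefl : a = 1 / 2 - ka) a0 P2 P6 P7.
clear P2 P6 P7 gk tk tt katau sE.
pose T := fix T k := if k is k'.+1 then T k' `^ ga else T0.
have TS k : T k.+1 = T k `^ ga by [].
pose h k := T k `^ a.
have TT0 k : T0 <= T k.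
  elim: k => [|k IH]; first by rewrite lexx.
  have T1k : 1 <= T k := le_trans T01 IH.
  rewrite TS (le_trans IH) // -[leLHS]powRr1 ?(le_trans ler01) //.
  by apply: ler_powR => //; exact: ltW.
have T1 k : 1 <= T k := le_trans T01 (TT0 k).
have Tgt0 k : 0 < T k := lt_le_trans ltr01 (T1 k).
have h1 k : 1 <= h k by apply: powR_ge1 => //; exact: ltW.
have hgt0 k : 0 < h k := lt_le_trans ltr01 (h1 k).
have scA k : [/\ 144 * h k ^+ 2 <= T k, 10 * T k <= h k * h k.+1, 24 * h k <= h k.+1 & 4 * T k <= T k.+1].
  by have [] := sc _ (TT0 k).
have scB k : [/\ 192 * h k.+2 * T k.+1 <= h k.+1 * T k.+2,
        100 * (T k `^ (- e)) ^+ 2 <=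
          (h k.+1 / (8 * T k.+1 ^+ 2)) ^+ 2 * (h k.+1 ^+ 2 * T k.+1 / (20 ^+ 3 * T k ^+ 2)),
        (T k `^ (- e) / T k.+1 `^ (- e)) `^ s <= h k.+1 ^+ 2 * T k.+1 / (20 ^+ 3 * T k ^+ 2) &
        24 <= T k `^ (ka / 2)].
  by have [] := sc _ (TT0 k).
clear sc.
exists (1 / 2 + ka / 2); first by rewrite ltrDl divr_gt0.
move=> mu mu0 mu1.
have [N0 N0ok] := root_node (T1 0%N) (h1 0%N).
have s02 : 0 < s <= 2 by rewrite s0 /=; move: s43; clear; lra.
have ka01 : 0 < ka <= 1 by rewrite ka0 /=; move: ka1 tau1; clear; lra.
have mu0' : 0 <= mu by move: mu0; clear; lra.
exact: (sing_measure_neq0 s02 ka01 e1 (erefl : a = 1 / 2 - ka) T1 h1 (fun k => erefl) scA scB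
  mu0' mu1 N0ok).
Qed.

End lower_bound.

(** * Coverings indexed by integers *)

Section lines.
Context {R : realType}.

Lemma content_bigcup_ord (s delta b : R) n (A : nat -> set 'rV[R]_2) : 0 <= delta ->
  (forall k, (k < n)%N -> (hausdorff_content s delta (A k) <= b%:E)%E) ->
  (hausdorff_content s delta (\bigcup_(k in [set k | (k < n)%N]) A k) <= (n%:R * b)%:E)%E.
Proof.
move=> d0 h; pose B k := if (k < n)%N then A k else set0.
have -> : \bigcup_(k in [set k | (k < n)%N]) A k = \bigcup_k B k.
  apply/seteqP; split => [x [k /= kn Ax]|x [k _]]; first by exists k => //; rewrite /B kn.
  by rewrite /B; case: ifP => // kn Ax; exists k.
apply: le_trans (content_sigma_subadditive _ _ _) _.
rewrite (nneseries_split 0 n); last by move=> k _; exact: content_ge0.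
rewrite [X in (_ + X)%E]eseries0; last first.
  move=> k; rewrite add0n => nk _; rewrite /B ltnNge nk /=; exact: content_set0.
rewrite adde0 add0n.
apply: (@le_trans _ _ (\sum_(0 <= k < n) b%:E)%E).
  by rewrite !big_mkord; apply: lee_sum => k _; rewrite /B ltn_ord; exact: h.
by rewrite sumEFin lee_fin sumr_const_nat subn0 mulr_natl.
Qed.

(** A slope of at most 1 keeps the piece over an interval of length [1 / n] within diameter [1 / n],
    so a unit interval costs [n ^ (1 - s)]. *)
Lemma graph_measure0 (s c d : R) (l l' : 'I_2) : 1 < s -> `|c| <= 1 -> l != l' ->
  hausdorff_measure s [set t : 'rV[R]_2 | t 0 l' = c * t 0 l + d] = 0%E.
Proof.
move=> s1 c1 ll'; have s0 : 0 < s by lra.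
set G := [set t | _].
pose seg (i : int) := G `&` [set t : 'rV[R]_2 | i%:~R <= t 0 l < i%:~R + 1].
have seg0 i : hausdorff_measure s (seg i) = 0%E.
  apply/measure0P => delta d0; apply/eqP; rewrite eq_le content_ge0 andbT.
  apply/lee_addgt0Pr => e e0; rewrite add0e.
  have s1' : 0 < s - 1 by lra.
  have [T [T1 hT]] := powR_unbounded e^-1 s1'.
  pose n := (Num.truncn (T + delta^-1)).+1.
  have Td0 : 0 <= T + delta^-1 by rewrite addr_ge0 ?invr_ge0 ?(ltW d0) //; lra.
  have nT : T + delta^-1 < n%:R by case/andP: (truncn_itv Td0).
  have di0 : 0 < delta^-1 by rewrite invr_gt0.
  have n0 : 0 < n%:R :> R by rewrite ltr0n.
  pose A k := G `&` [set t : 'rV[R]_2 | i%:~R + k%:R / n%:R <= t 0 l <= i%:~R + (k.+1)%:R / n%:R].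
  have segA : seg i `<=` \bigcup_(k in [set k | (k < n)%N]) A k.
    move=> t [Gt /andP[t1 t2]].
    have x0 : 0 <= (t 0 l - i%:~R) * n%:R by rewrite mulr_ge0 // subr_ge0.
    have /andP[k1 k2] := truncn_itv x0; set k := Num.truncn _ in k1 k2.
    have kn : (k < n)%N.
      rewrite -(ltr_nat R); apply: le_lt_trans k1 _.
      by rewrite -[ltRHS]mul1r ltr_pM2r // ltrBlDl.
    exists k => //; split => //=; rewrite -!lerBrDl -[in leRHS](mulfK (lt0r_neq0 n0) (t 0 l - i%:~R)).
    apply/andP; split; first by rewrite ler_pM2r ?invr_gt0.
    by rewrite -lerBlDl ler_pdivlMr // ltW.
  apply: le_trans (content_mono _ _ segA) _.
  have Ak k : (hausdorff_content s delta (A k) <= ((n%:R^-1) `^ s)%:E)%E.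
    apply: content_le1 => //.
      by rewrite invf_ple ?posrE //; lra.
    move=> x y [Gx /andP[x1 x2]] [Gy /andP[y1 y2]].
    have k1 : (k.+1)%:R / n%:R = k%:R / n%:R + n%:R^-1 :> R by rewrite -natr1 mulrDl mul1r.
    have xy : `|x 0 l - y 0 l| <= n%:R^-1 by rewrite ler_norml; lra.
    have xy' : `|x 0 l' - y 0 l'| <= n%:R^-1.
      rewrite (Gx : x 0 l' = _) (Gy : y 0 l' = _) opprD addrACA subrr addr0 -mulrBr normrM.
      by rewrite -[leRHS]mul1r ler_pM.
    rewrite norm2_le !mxE; move: xy xy' ll'.
    by case: (ord2P l) => ->; case: (ord2P l') => -> // -> ->.
  apply: le_trans (content_bigcup_ord (ltW d0) (fun k _ => Ak k)) _.
  rewrite lee_fin -powR_inv1 ?(ltW n0) // -powRrM mulN1r -[X in X * _]powRr1 ?(ltW n0) //.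
  rewrite -powR_add //.
  rewrite (_ : 1 + - s = - (s - 1)); last by ring.
  by rewrite powRN invf_ple ?posrE ?powR_gt0 //; apply: hT; lra.
apply: (@measure0_sub _ _ _ _ (\bigcup_n (if (unpickle n : option int) is Some i then seg i else set0))).
  move=> t Gt; exists (pickle (Num.floor (t 0 l))); first exact: I.
  rewrite pickleK; split; first exact: Gt.
  by move: (floor_le (t 0 l)) (floorD1_gt (t 0 l)); rewrite intrD /= => -> ->.
apply: measure0_bigcup => n; case: unpickle => [i|]; first exact: seg0.
by apply/measure0P => delta d0; rewrite content_set0 // ltW.
Qed.

(** Solving for the coordinate with the larger coefficient gives a slope of at most 1. *)
Lemma line_measure0 (s a b c : R) : 1 < s -> (a != 0) || (b != 0) ->
  hausdorff_measure s [set t : 'rV[R]_2 | a * t 0 0 + b * t 0 1 + c = 0] = 0%E.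
Proof.
move=> s1 ab; have [hab|hab] := leP `|a| `|b|.
  have b0 : b != 0.
    apply: contraTneq ab => b0; move: hab; rewrite b0 normr0 normr_le0 => /eqP ->.
    by rewrite eqxx.
  apply: measure0_sub (graph_measure0 (c := - (a / b)) (- (c / b)) s1 _ (_ : 0 != 1 :> 'I_2)) => //.
    move=> t /= e; apply: (mulfI b0).
    have -> : b * t 0 1 = - (a * t 0 0) - c by apply/eqP; rewrite -subr_eq0 -[X in _ == X]e; apply/eqP; ring.
    by field.
  by rewrite normrN normrM normfV ler_pdivrMr ?normr_gt0 // mul1r.
have a0 : a != 0 by rewrite -normr_gt0 (le_lt_trans _ hab).
apply: measure0_sub (graph_measure0 (c := - (b / a)) (- (c / a)) s1 _ (_ : 1 != 0 :> 'I_2)) => //.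
  move=> t /= e; apply: (mulfI a0).
  have -> : a * t 0 0 = - (b * t 0 1) - c by apply/eqP; rewrite -subr_eq0 -[X in _ == X]e; apply/eqP; ring.
  by field.
by rewrite normrN normrM normfV ler_pdivrMr ?normr_gt0 // mul1r ltW.
Qed.

End lines.

(** * Sums over integer labels *)

Section label_sums.
Context {R : realType}.

(** With [y = x + 1], the term [z y ^ (-1 - z)] is at most the telescoping difference
    [x ^ (-z) - y ^ (-z)]. Two uses of [1 + v <= exp v] prove this in place of an integral. *)
Lemma zeta_sum_le (z : R) : 0 < z -> exists2 Z : R, 0 <= Z &
  (\sum_(0 <= n <oo) ((n.+1%:R : R) `^ (- (1 + z)))%:E <= Z%:E)%E.
Proof.
move=> z0; exists (1 + z^-1); first by rewrite addr_ge0 // invr_ge0 ltW.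
have part n : \sum_(0 <= k < n.+1) ((k.+1%:R : R) `^ (- (1 + z))) <=
    1 + z^-1 * (1 - (n.+1%:R) `^ (- z)).
  elim: n => [|n IH]; first by rewrite big_nat1 !powR1 subrr mulr0 addr0.
  rewrite big_nat_recr //=; apply: le_trans (lerD IH (lexx _)) _.
  rewrite -addrA lerD2l -lerBrDl -mulrBr.
  have -> : 1 - n.+2%:R `^ (- z) - (1 - n.+1%:R `^ (- z)) = n.+1%:R `^ (- z) - n.+2%:R `^ (- z) :> R.
    by ring.
  rewrite ler_pdivlMl //.
  set x : R := n.+1%:R; set y : R := n.+2%:R.
  have x0 : 0 < x by rewrite ltr0n.
  have y0 : 0 < y by rewrite ltr0n.
  have yx : y = x + 1 by rewrite /y -natr1.
  have xE : x `^ (- z) = y `^ (- z) * (y / x) `^ z.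
    rewrite powRM ?invr_ge0 ?ltW // mulrA -powR_add // addNr powRr0 mul1r.
    by rewrite -powR_inv1 ?ltW // -powRrM mulN1r.
  rewrite xE opprD [in leLHS]powR_add // mulrCA -[X in _ - X]mulr1 -mulrBr.
  have -> : y `^ (-1) * (z * y `^ (- z)) = y `^ (- z) * (z * y `^ (-1)) by ring.
  rewrite ler_wpM2l ?powR_ge0 // powR_inv1 ?(ltW y0) //.
  have : 1 + z * ln (y / x) <= (y / x) `^ z.
    rewrite /powR gt_eqF ?divr_gt0 //; exact: expR_ge1Dx.
  suff : y^-1 <= ln (y / x).
    move=> h1 h2; have h3 : z * y^-1 <= z * ln (y / x) by rewrite ler_pM2l.
    by rewrite lerBrDr addrC (le_trans _ h2) // lerD2l.
  have xy0 : 0 < x / y by rewrite divr_gt0.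
  have -> : y / x = (x / y)^-1 by rewrite invf_div.
  rewrite lnV ?posrE // lerNr.
  have : 1 + ln (x / y) <= x / y.
    by rewrite -[leRHS](lnK (_ : x / y \is Num.pos)) ?posrE //; exact: expR_ge1Dx.
  have -> : x / y = 1 - y^-1 by apply: (mulIf (lt0r_neq0 y0)); rewrite mulrBl mul1r divfK ?mulVf ?gt_eqF // yx addrK.
  by rewrite lerD2l.
apply: lime_le; first by apply: is_cvg_nneseries => n _ _; rewrite lee_fin powR_ge0.
apply: nearW => n; rewrite sumEFin lee_fin.
case: n => [|n]; first by rewrite big_geq // addr_ge0 // invr_ge0 ltW.
apply: le_trans (part n) _; rewrite lerD2l -[leRHS]mulr1 ler_wpM2l ?invr_ge0 ?ltW //.
Qed.

(** The maximum with 1 serves the label 0, which the quotient [j] can take. *)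
Definition weight (z : R) (i : int) : R := (Num.max 1 `|i|%:~R) `^ (- (1 + z)).

Lemma content_bigcup_int (z : R) : 0 < z -> exists2 Z : R, 0 < Z &
  forall s delta B (A : int -> set 'rV[R]_2), 0 <= B ->
    (forall i, (hausdorff_content s delta (A i) <= (B * weight z i)%:E)%E) ->
    (hausdorff_content s delta (\bigcup_i A i) <= (B * Z)%:E)%E.
Proof.
move=> z0; have [Z Z0 hZ] := zeta_sum_le z0.
exists (4 `^ (1 + z) * Z + 1); first by rewrite ltr_wpDl // mulr_ge0 // powR_ge0.
move=> s delta B A B0 hA.
pose enc n := if odd n then Negz n./2 else Posz n./2.
have -> : \bigcup_i A i = \bigcup_n A (enc n).
  apply/seteqP; split => [x [[k|k] _ Ax]|x [n _ Ax]]; last by exists (enc n).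
    by exists k.*2 => //; rewrite /enc odd_double doubleK.
  by exists (k.*2).+1 => //; rewrite /enc /= odd_double /= uphalf_double.
(* The alternating enumeration distorts absolute values by a factor of at most 4. *)
have wle n : weight z (enc n) <= 4 `^ (1 + z) * (n.+1%:R : R) `^ (- (1 + z)).
  have n4 : n.+1%:R / 4 <= Num.max 1 `|enc n|%:~R :> R.
    have h1 : (n./2)%:R <= `|enc n|%:~R :> R.
      rewrite /enc; case: ifP => _ /=; last exact: lexx.
      by rewrite NegzE normrN /= -[leRHS]/((n./2).+1%:R) ler_nat.
    have h2 : n%:R <= 2 * (n./2)%:R + 1 :> R.
      rewrite -natrM natr1 ler_nat -[X in (X <= _)%N]odd_double_half -mul2n.
      by case: (odd n); rewrite ?add1n ?add0n.
    rewrite le_max; have [nn|nn] := leP n%:R (3 : R).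
      by apply/orP; left; rewrite ler_pdivrMr // -natr1; lra.
    by apply/orP; right; rewrite ler_pdivrMr // -natr1; lra.
  have p0 : 0 < n.+1%:R / 4 :> R by rewrite divr_gt0 // ltr0n.
  apply: le_trans (powR_leN p0 n4 _) _; first by rewrite oppr_le0 addr_ge0 // ltW.
  rewrite powRM ?invr_ge0 // mulrC -powR_inv1 // -powRrM mulN1r opprK //.
apply: (@content_bigcup_le _ _ _ _ _ _ _ (fun n => weight z (enc n))) => //.
  by move=> n; exact: powR_ge0.
apply: (@le_trans _ _ (\sum_(0 <= n <oo) ((4 `^ (1 + z))%:E * ((n.+1%:R : R) `^ (- (1 + z)))%:E))%E).
  apply: lee_nneseries => [n _ _|n _]; first by rewrite lee_fin powR_ge0.
  by rewrite -EFinM lee_fin.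
rewrite nneseriesZl; last by move=> n _; rewrite lee_fin powR_ge0.
apply: (@le_trans _ _ ((4 `^ (1 + z))%:E * Z%:E)%E); first by rewrite lee_wpmul2l // lee_fin powR_ge0.
by rewrite -EFinM lee_fin lerDl.
Qed.

End label_sums.

(** * Best approximations *)

Section integer_vectors.

Definition vec : Type := (int * int * int)%type.
Implicit Types A B C : vec.

Definition dot A B : int := A.1.1 * B.1.1 + A.1.2 * B.1.2 + A.2 * B.2.

Definition cross A B : vec :=
  (A.1.2 * B.2 - A.2 * B.1.2, A.2 * B.1.1 - A.1.1 * B.2, A.1.1 * B.1.2 - A.1.2 * B.1.1).

Definition vscale (n : int) A : vec := (n * A.1.1, n * A.1.2, n * A.2).

Definition vsub A B : vec := (A.1.1 - B.1.1, A.1.2 - B.1.2, A.2 - B.2).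

Definition vzero : vec := (0, 0, 0).

Definition nrm A : int := Num.max (Num.max `|A.1.1| `|A.1.2|) `|A.2|.

(** The Bezout form of having coprime entries: pairing a parallel vector with [B] yields the
    multiplier at once. *)
Definition primitive A : Prop := exists B, dot A B = 1.

Lemma vecP A B : A.1.1 = B.1.1 -> A.1.2 = B.1.2 -> A.2 = B.2 -> A = B.
Proof. by case: A B => [[a1 a2] a3] [[b1 b2] b3] /= -> -> ->. Qed.

Lemma primitive_neq0 A : primitive A -> A <> vzero.
Proof. by case=> B + A0; rewrite A0 /dot /= !mul0r. Qed.

Lemma nrm_scale n A : nrm (vscale n A) = `|n| * nrm A.
Proof. by rewrite /nrm /= !normrM -!maxr_pMr. Qed.

Lemma nrm_gt0 A : A <> vzero -> 0 < nrm A.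
Proof.
move=> A0; rewrite /nrm !lt_max !normr_gt0; apply/negPn/negP.
rewrite !negb_or !negbK => /andP[/andP[/eqP a1 /eqP a2] /eqP a3].
by apply: A0; apply: vecP.
Qed.

Lemma nrm_ge A : [/\ `|A.1.1| <= nrm A, `|A.1.2| <= nrm A & `|A.2| <= nrm A].
Proof. by rewrite /nrm !le_max !lexx ?orbT. Qed.

Lemma nrm_cross A B : nrm (cross A B) <= 2 * (nrm A * nrm B).
Proof.
have [a1 a2 a3] := nrm_ge A; have [b1 b2 b3] := nrm_ge B.
have mn (x y z w : int) : `|x| <= nrm A -> `|y| <= nrm B -> `|z| <= nrm A -> `|w| <= nrm B ->
    `|x * y - z * w| <= 2 * (nrm A * nrm B).
  move=> h1 h2 h3 h4; apply: le_trans (ler_normB _ _) _; rewrite !normrM.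
  by rewrite mulr_natl mulr2n lerD // ler_pM.
by rewrite {1}/nrm !ge_max /cross /= !mn.
Qed.

Lemma cross_dotl A B : dot A (cross A B) = 0.
Proof. by rewrite /dot /cross /=; ring. Qed.

Lemma cross_dotr A B : dot B (cross A B) = 0.
Proof. by rewrite /dot /cross /=; ring. Qed.

Lemma dotC A B : dot A B = dot B A.
Proof. by rewrite /dot; ring. Qed.

Lemma dot_scale n A B : dot A (vscale n B) = n * dot A B.
Proof. by rewrite /dot /=; ring. Qed.

Lemma cross_sub A B C : cross A (vsub B C) = vsub (cross A B) (cross A C).
Proof. by apply: vecP; rewrite /cross /vsub /=; ring. Qed.

Lemma vsub_eq0 A B : vsub A B = vzero <-> A = B.
Proof.
split=> [|->]; last by rewrite /vsub !subrr.
by case: A B => [[a1 a2] a3] [[b1 b2] b3] [] /eqP + /eqP + /eqP; rewrite !subr_eq0 => /eqP -> /eqP -> /eqP ->.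
Qed.

Lemma parallel_primitive A B : primitive A -> cross A B = vzero -> exists n, B = vscale n A.
Proof.
case=> C AC [] e1 e2 e3; exists (dot C B).
apply: vecP; rewrite /vscale /=; rewrite /dot in AC *.
- rewrite -[LHS]mulr1 -AC; apply/eqP; rewrite -subr_eq0.
  have -> : B.1.1 * (A.1.1 * C.1.1 + A.1.2 * C.1.2 + A.2 * C.2) -
      (C.1.1 * B.1.1 + C.1.2 * B.1.2 + C.2 * B.2) * A.1.1 =
    - C.1.2 * (A.1.1 * B.1.2 - A.1.2 * B.1.1) + C.2 * (A.2 * B.1.1 - A.1.1 * B.2) by ring.
  by rewrite e2 e3 !mulr0 addr0.
- rewrite -[LHS]mulr1 -AC; apply/eqP; rewrite -subr_eq0.
  have -> : B.1.2 * (A.1.1 * C.1.1 + A.1.2 * C.1.2 + A.2 * C.2) -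
      (C.1.1 * B.1.1 + C.1.2 * B.1.2 + C.2 * B.2) * A.1.2 =
    C.1.1 * (A.1.1 * B.1.2 - A.1.2 * B.1.1) - C.2 * (A.1.2 * B.2 - A.2 * B.1.2) by ring.
  by rewrite e1 e3 !mulr0 subr0.
- rewrite -[LHS]mulr1 -AC; apply/eqP; rewrite -subr_eq0.
  have -> : B.2 * (A.1.1 * C.1.1 + A.1.2 * C.1.2 + A.2 * C.2) -
      (C.1.1 * B.1.1 + C.1.2 * B.1.2 + C.2 * B.2) * A.2 =
    - C.1.1 * (A.2 * B.1.1 - A.1.1 * B.2) + C.1.2 * (A.1.2 * B.2 - A.2 * B.1.2) by ring.
  by rewrite e1 e2 !mulr0 addr0.
Qed.

Lemma primitive_part A : A <> vzero -> exists d B, [/\ 0 < d, primitive B & A = vscale d B].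
Proof.
case: A => [[a1 a2] a3] A0.
pose g1 := gcdz a1 a2; pose g := gcdz g1 a3.
have g0 : g != 0.
  apply/negP; rewrite /g gcdz_eq0 => /andP[]; rewrite /g1 gcdz_eq0 => /andP[/eqP h1 /eqP h2] /eqP h3.
  by apply: A0; rewrite h1 h2 h3.
have gpos : 0 < g by rewrite lt_def g0.
have d3 : (g %| a3)%Z by rewrite dvdz_gcdr.
have dg1 : (g %| g1)%Z by rewrite dvdz_gcdl.
have d1 : (g %| a1)%Z by apply: dvdz_trans dg1 _; rewrite dvdz_gcdl.
have d2 : (g %| a2)%Z by apply: dvdz_trans dg1 _; rewrite dvdz_gcdr.
have [u1 [v1 e1]] := Bezoutz a1 a2; have [u [v e]] := Bezoutz g1 a3.
case/dvdzP: d1 => b1 h1; case/dvdzP: d2 => b2 h2; case/dvdzP: d3 => b3 h3.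
exists g, (b1, b2, b3); split => //; last by rewrite /vscale /= h1 h2 h3 ![_ * g]mulrC.
exists (u * u1, u * v1, v); apply: (mulfI g0); rewrite mulr1 /dot /=.
rewrite -[RHS]/(gcdz g1 a3) -e /g1 -e1 h1 h2 h3 -/g.
by ring.
Qed.

End integer_vectors.

Section best_approximations.
Context {R : realType}.
Implicit Types (t : 'rV[R]_2) (q p u : nat).

Definition rd (x : R) : int := Num.floor (x + 1 / 2).

Lemma rd_half (x : R) : `|x - (rd x)%:~R| <= 1 / 2.
Proof.
have := floor_le (x + 1 / 2); have := floorD1_gt (x + 1 / 2).
by rewrite /rd intrD ler_norml; lra.
Qed.

Lemma rd_near (x : R) (n : int) : `|x - (rd x)%:~R| <= `|x - n%:~R|.
Proof.
have [->//|nE] := eqVneq n (rd x).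
have h := rd_half x; apply: le_trans h _.
have : (1 : R) <= `|n%:~R - (rd x)%:~R|.
  by rewrite -intrB -intr_norm (ler1z R) -gtz0_ge1 normr_gt0 subr_eq0.
have := rd_half x; have : `|n%:~R - (rd x)%:~R| <= `|x - n%:~R| + `|x - (rd x)%:~R|.
  have -> : n%:~R - (rd x)%:~R = - (x - n%:~R) + (x - (rd x)%:~R) by ring.
  by apply: le_trans (ler_normD _ _) _; rewrite normrN.
by lra.
Qed.

Definition err t q : R :=
  Num.max `|q%:R * t 0 0 - (rd (q%:R * t 0 0))%:~R| `|q%:R * t 0 1 - (rd (q%:R * t 0 1))%:~R|.

Definition approx t q : vec := (rd (q%:R * t 0 0), rd (q%:R * t 0 1), Posz q).

(** Denominators of best approximations; the strict inequality selects the smallest of several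
    denominators with equal error. *)
Definition record t q : Prop :=
  (0 < q)%N /\ forall p, (0 < p < q)%N -> err t q < err t p.

Definition next t q u : Prop :=
  [/\ (q < u)%N, err t u < err t q & forall p, (q < p < u)%N -> err t q <= err t p].

Definition off_lines t : Prop := forall a b c : int, (a != 0) || (b != 0) ->
  a%:~R * t 0 0 + b%:~R * t 0 1 + c%:~R != 0.

Definition unif t (mu X0 : R) : Prop := forall X, X0 <= X -> exists p,
  [/\ (0 < p)%N, p%:R <= X & err t p <= X `^ (- mu)].

Lemma err_ge0 t q : 0 <= err t q.
Proof. by rewrite /err le_max normr_ge0. Qed.

Lemma err_half t q : err t q <= 1 / 2.
Proof. by rewrite /err ge_max !rd_half. Qed.

Lemma err_le t q (a b : int) :
  err t q <= Num.max `|q%:R * t 0 0 - a%:~R| `|q%:R * t 0 1 - b%:~R|.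
Proof. by rewrite /err ge_max !le_max !rd_near orbT. Qed.

Lemma err_gt0 t q : off_lines t -> (0 < q)%N -> 0 < err t q.
Proof.
move=> off q0; rewrite lt_def err_ge0 andbT; apply/negP => /eqP e.
have : `|q%:R * t 0 0 - (rd (q%:R * t 0 0))%:~R| <= 0 by rewrite -e /err le_max lexx.
rewrite normr_le0 => /eqP e1.
have := off (Posz q) 0 (- rd (q%:R * t 0 0)); rewrite mul0r addr0 mulrNz e1 eqxx.
by move=> /(_ _)/negP; apply => //; apply/orP; left; rewrite -lt0n in q0 *; case: q q0 {e e1}.
Qed.

Lemma next_record t q u : record t q -> next t q u -> record t u.
Proof.
move=> [q0 rq] [qu eu mid]; split; first exact: leq_trans qu.
move=> p /andP[p0 pu]; have [pq|qp|->//] := ltngtP p q.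
  by apply: lt_trans eu _; apply: rq; rewrite p0.
by apply: lt_le_trans eu _; apply: mid; rewrite qp.
Qed.

Lemma next_exists t q : record t q -> (exists p, (0 < p)%N /\ err t p < err t q) ->
  exists u, next t q u.
Proof.
move=> [q0 rq] [p [p0 ep]].
have ex : exists u, (q < u)%N && (err t u < err t q).
  exists p; rewrite ep andbT ltnNge; apply/negP; rewrite leq_eqVlt => /orP[/eqP pq|pq].
    by move: ep; rewrite pq ltxx.
  have := rq p; rewrite p0 pq => /(_ isT); by rewrite ltNge ltW.
case: (ex_minnP ex) => u /andP[qu eu] umin; exists u; split => // r /andP[qr ru].
rewrite leNgt; apply/negP => er; have := umin r; rewrite qr er => /(_ isT).
by rewrite leqNgt ru.
Qed.

Lemma unif_small t mu X0 (e : R) : 0 < mu -> unif t mu X0 -> 0 < e ->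
  exists p, (0 < p)%N /\ err t p < e.
Proof.
move=> mu0 U e0; have [T [T1 hT]] := powR_unbounded (2 * e^-1) mu0.
pose X := Num.max X0 T; have [|p [p0 _ pe]] := U X; first by rewrite le_max lexx.
exists p; split => //; apply: le_lt_trans pe _.
have XT : T <= X by rewrite le_max lexx orbT.
have X0' : 0 < X by lra.
have ei : 0 < e^-1 by rewrite invr_gt0.
rewrite powRN invf_plt ?posrE ?powR_gt0 //; apply: lt_le_trans (hT _ XT); lra.
Qed.

Lemma record_ge t mu X0 n : 0 < mu -> off_lines t -> unif t mu X0 ->
  exists q, (n <= q)%N /\ record t q.
Proof.
move=> mu0 off U; elim: n => [|n [q [nq rq]]].
  exists 1%N; split => //; split => // p /andP[p0 p1]; lia.
have [u nu] := next_exists rq (unif_small mu0 U (err_gt0 off rq.1)).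
exists u; split; last exact: next_record nu.
by case: nu => qu _ _; exact: leq_ltn_trans qu.
Qed.

(** Uniformity at [u / 2] yields some [p < u], and no denominator below [u] has a smaller error than
    [q]. *)
Lemma err_next t mu X0 q u : 0 < X0 -> unif t mu X0 -> record t q -> next t q u ->
  2 * X0 <= u%:R -> err t q <= (u%:R / 2) `^ (- mu).
Proof.
move=> X00 U [q0 rq] [qu eu mid] uX.
have [|p [p0 pX pe]] := U (u%:R / 2); first by lra.
apply: le_trans pe.
have pu : (p < u)%N.
  rewrite -(ltr_nat R); apply: le_lt_trans pX _.
  have u0 : 0 < u%:R :> R by lra.
  by lra.
have [pq|qp|->//] := ltngtP p q; first by apply/ltW/rq; rewrite p0.
by apply: mid; rewrite qp.
Qed.

(** Dividing by a common factor would give a smaller denominator with an error no larger. *)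
Lemma record_primitive t q : record t q -> primitive (approx t q).
Proof.
move=> [q0 rq].
have A0 : approx t q <> vzero by case=> _ _ [] e; rewrite e in q0.
have [d [B [d0 pB AE]]] := primitive_part A0.
have [e1 e2 e3] : [/\ rd (q%:R * t 0 0) = d * B.1.1, rd (q%:R * t 0 1) = d * B.1.2 & Posz q = d * B.2].
  by case: AE.
have B0 : 0 < B.2 by rewrite -(pmulr_rgt0 _ d0) -e3.
have [d1|dn1] := eqVneq d 1.
  by rewrite AE d1 /vscale !mul1r; move: pB; case: (B) => [[]].
exfalso.
have d2 : 2 <= d by lia.
pose p := `|B.2|%N.
have pE : Posz p = B.2 by rewrite /p gtz0_abs.
have pq : (0 < p < q)%N.
  apply/andP; split; first by rewrite -ltz_nat pE.
  by rewrite -ltz_nat pE e3; nia.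
have := rq p pq; apply/negP; rewrite -leNgt.
have pR : p%:R = B.2%:~R :> R by rewrite -pE.
have dR : 1 <= d%:~R :> R by rewrite (ler1z R); lia.
have qR : q%:R = d%:~R * B.2%:~R :> R by rewrite -intrM -e3.
apply: le_trans (err_le t p B.1.1 B.1.2) _.
have mono (x : R) (n : int) : `|p%:R * x - n%:~R| <= `|q%:R * x - (d * n)%:~R|.
  rewrite qR pR intrM -mulrA -mulrBr normrM ger0_norm ?(le_trans ler01) //.
  by rewrite -[leLHS]mul1r ler_wpM2r.
by rewrite /err e1 e2 ge_max !le_max !mono orbT.
Qed.

(** Proportional vectors have errors in the ratio of their denominators, so the larger denominator
    could not have the smaller error. *)
Lemma cross_independent t q u : (0 < q)%N -> (q < u)%N -> err t u < err t q ->
  cross (approx t q) (approx t u) <> vzero.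
Proof.
move=> q0 qu eu [] c1 c2 c3.
move: eu; apply/negP; rewrite -leNgt.
have qr : 0 < q%:R :> R by rewrite ltr0n.
have qur : q%:R <= u%:R :> R by rewrite ler_nat ltnW.
have key (x : R) : rd (q%:R * x) * Posz u = Posz q * rd (u%:R * x) ->
   `|q%:R * x - (rd (q%:R * x))%:~R| <= `|u%:R * x - (rd (u%:R * x))%:~R|.
  move=> /(congr1 (fun z : int => z%:~R : R)); rewrite !intrM => e.
  have e' : q%:R * (u%:R * x - (rd (u%:R * x))%:~R) = u%:R * (q%:R * x - (rd (q%:R * x))%:~R).
    rewrite !mulrBr; congr (_ - _); first by ring.
    by rewrite -[q%:R]/((Posz q)%:~R) -[u%:R]/((Posz u)%:~R) -e mulrC.
  rewrite -(ler_pM2l qr) -[q%:R in leRHS](gtr0_norm qr) -normrM e' normrM.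
  by rewrite ler_wpM2r // ger0_norm // ler0n.
rewrite /err ge_max !le_max !key ?orbT //.
  by apply/eqP; rewrite -subr_eq0 -[X in _ == X]c1; apply/eqP; rewrite /approx /=; ring.
by apply/eqP; rewrite eq_sym -subr_eq0; apply/eqP; exact: c2.
Qed.

(** In each entry the terms free of errors cancel. The entry built from the two numerators also
    carries the coordinates of [t], and this is where [M] enters. *)
Lemma cross_bound t (M : R) q u : `|t 0 0| <= M -> `|t 0 1| <= M ->
  (0 < q)%N -> (q <= u)%N -> err t u <= err t q ->
  (nrm (cross (approx t q) (approx t u)))%:~R <= (4 * M + 2) * (u%:R * err t q).
Proof.
move=> M1 M2 q0 qu eu.
set a := rd (q%:R * t 0 0); set b := rd (q%:R * t 0 1).
set c := rd (u%:R * t 0 0); set d := rd (u%:R * t 0 1).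
set e := err t q in eu *.
have M0 : 0 <= M by exact: le_trans M1.
have e0 : 0 <= e by exact: err_ge0.
have qr : 0 < q%:R :> R by rewrite ltr0n.
have ur : 1 <= u%:R :> R by rewrite (ler_nat _ 1); exact: leq_trans qu.
have qur : q%:R <= u%:R :> R by rewrite ler_nat.
have ha : `|q%:R * t 0 0 - a%:~R| <= e by rewrite /e /err le_max lexx.
have hb : `|q%:R * t 0 1 - b%:~R| <= e by rewrite /e /err le_max lexx orbT.
have hc : `|u%:R * t 0 0 - c%:~R| <= e by apply: le_trans eu; rewrite /err le_max lexx.
have hd : `|u%:R * t 0 1 - d%:~R| <= e by apply: le_trans eu; rewrite /err le_max lexx orbT.
have e2 : e <= 1 / 2 by exact: err_half.
have ue0 : 0 <= u%:R * e by rewrite mulr_ge0 // ler0n.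
have big : 2 * (u%:R * e) <= (4 * M + 2) * (u%:R * e).
  by rewrite ler_wpM2r //; lra.
have lin (x : R) (y z : int) : `|q%:R * x - y%:~R| <= e -> `|u%:R * x - z%:~R| <= e ->
    `|y%:~R * u%:R - q%:R * z%:~R| <= 2 * (u%:R * e).
  move=> h1 h2.
  have -> : y%:~R * u%:R - q%:R * z%:~R =
    q%:R * (u%:R * x - z%:~R) - u%:R * (q%:R * x - y%:~R) by ring.
  apply: le_trans (ler_normB _ _) _; rewrite !normrM [`|q%:R|]ger0_norm ?ler0n // [`|u%:R|]ger0_norm ?ler0n //.
  rewrite (_ : 2 * (u%:R * e) = u%:R * e + u%:R * e); last by ring.
  apply: lerD; last by rewrite ler_wpM2l // ler0n.
  by apply: ler_pM => //; exact: ltW.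
have quad : `|a%:~R * d%:~R - b%:~R * c%:~R| <= (4 * M + 2) * (u%:R * e).
  have -> : a%:~R * d%:~R - b%:~R * c%:~R =
    (q%:R * t 0 0 - a%:~R) * (u%:R * t 0 1 - d%:~R) - (q%:R * t 0 1 - b%:~R) * (u%:R * t 0 0 - c%:~R)
    - q%:R * t 0 0 * (u%:R * t 0 1 - d%:~R) - u%:R * t 0 1 * (q%:R * t 0 0 - a%:~R)
    + q%:R * t 0 1 * (u%:R * t 0 0 - c%:~R) + u%:R * t 0 0 * (q%:R * t 0 1 - b%:~R) :> R by ring.
  have ee : e * e <= u%:R * e by rewrite ler_wpM2r //; lra.
  have n1 (x y : R) : `|x| <= e -> `|y| <= e -> `|x * y| <= u%:R * e.
    by move=> h1 h2; apply: le_trans ee; rewrite normrM ler_pM.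
  have n2 (n : nat) (x y : R) : (n <= u)%N -> `|x| <= M -> `|y| <= e -> `|n%:R * x * y| <= M * (u%:R * e).
    move=> nu h1 h2; rewrite mulrCA mulrA !normrM [`|n%:R|]ger0_norm ?ler0n //.
    by rewrite !ler_pM ?mulr_ge0 ?ler0n // ler_nat.
  have -> : (4 * M + 2) * (u%:R * e) = u%:R * e + u%:R * e + M * (u%:R * e) + M * (u%:R * e)
    + M * (u%:R * e) + M * (u%:R * e) by ring.
  apply: le_trans (ler_normD _ _) _; apply: lerD; last exact: n2.
  apply: le_trans (ler_normD _ _) _; apply: lerD; last exact: n2.
  apply: le_trans (ler_normB _ _) _; apply: lerD; last exact: n2.
  apply: le_trans (ler_normB _ _) _; apply: lerD; last exact: n2.
  by apply: le_trans (ler_normB _ _) _; apply: lerD; exact: n1.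
have toR (x y z w : int) (B : R) : `|x%:~R * y%:~R - z%:~R * w%:~R| <= B ->
    (`|x * y - z * w|)%:~R <= B by rewrite intr_norm intrB !intrM.
suff : forall n : int, (n == `|b * Posz u - Posz q * d|) || (n == `|Posz q * c - a * Posz u|)
    || (n == `|a * d - b * c|) -> n%:~R <= (4 * M + 2) * (u%:R * e).
  move=> h; apply: h; rewrite /nrm /cross /approx /= -/a -/b -/c -/d.
  rewrite /Num.max; case: ifP => _; first by rewrite eqxx orbT.
  by case: ifP => _; rewrite eqxx ?orbT.
move=> n /orP[/orP[]|] /eqP ->.
- by apply: toR; apply: le_trans big; exact: lin hb hd.
- by apply: toR; rewrite distrC; apply: le_trans big; exact: lin ha hc.
- by apply: toR; exact: quad.
Qed.

(** Otherwise [H] annihilates best approximations with arbitrarily large [u]. The fixed number [L0],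
    the value of [H] on [(t, 1)], would then satisfy [u |L0| <= |H|], as rounding errors are at most
    1/2; but [L0] is nonzero off the rational lines. *)
Lemma exit_plane t mu X0 (H : vec) q : 0 < mu -> off_lines t -> unif t mu X0 ->
  H <> vzero -> record t q -> dot H (approx t q) = 0 ->
  exists u v, [/\ (q <= u)%N, record t u, dot H (approx t u) = 0, next t u v &
    dot H (approx t v) <> 0].
Proof.
move=> mu0 off U H0 rq Hq; apply: contrapT => no.
have [L0 LE] : {L : R | L = H.1.1%:~R * t 0 0 + H.1.2%:~R * t 0 1 + H.2%:~R} by eexists.
have Lpos : 0 < `|L0|.
  rewrite normr_gt0 LE; have [h|] := boolP ((H.1.1 != 0) || (H.1.2 != 0)); first exact: off.
  rewrite negb_or !negbK => /andP[/eqP h1 /eqP h2]; rewrite h1 h2 !mul0r !add0r intr_eq0.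
  by apply/eqP => h3; apply: H0; apply: vecP.
have all n : exists u, [/\ (n <= u)%N, (q <= u)%N, record t u & dot H (approx t u) = 0].
  elim: n => [|n [u [nu qu ru Hu]]]; first by exists q.
  have [v nv] := next_exists ru (unif_small mu0 U (err_gt0 off ru.1)).
  have uv : (u < v)%N by case: nv.
  exists v; split; [exact: leq_ltn_trans uv| | exact: next_record nv|].
    by apply: leq_trans qu _; exact: ltnW.
  by apply: contrapT => Hv; apply: no; exists u, v.
pose h : R := (nrm H)%:~R.
have [u [nu _ ru Hu]] := all (Num.truncn (h / `|L0|)).+1.
have h0 : 0 <= h / `|L0|.
  by rewrite divr_ge0 // /h ler0z; apply: ltW; exact: nrm_gt0.
have : h / `|L0| < u%:R.
  by case/andP: (truncn_itv h0) => _ /lt_le_trans; apply; rewrite ler_nat.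
rewrite ltr_pdivrMr //; apply/negP; rewrite -leNgt.
have [n1 n2 n3] := nrm_ge H.
have -> : u%:R * `|L0| = `|H.1.1%:~R * (u%:R * t 0 0 - (rd (u%:R * t 0 0))%:~R) +
    H.1.2%:~R * (u%:R * t 0 1 - (rd (u%:R * t 0 1))%:~R)|.
  have /(congr1 (fun z : int => z%:~R : R)) := Hu; rewrite /dot /approx /= !intrD !intrM => e.
  rewrite -[u%:R in LHS]ger0_norm ?ler0n // -normrM LE; congr `|_|.
  apply/eqP; rewrite -subr_eq0 -[X in _ == X]e -[(Posz u)%:~R]/(u%:R : R); apply/eqP; ring.
apply: le_trans (ler_normD _ _) _; rewrite !normrM -!intr_norm.
have hh : h = h * (1 / 2) + h * (1 / 2) by field.
by rewrite hh; apply: lerD; apply: ler_pM => //; rewrite ?ler0z ?rd_half // /h ler_int.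
Qed.

End best_approximations.

(** * The upper bound *)

Section child_weight.
Context {R : realType}.

Lemma ln_scale (x a : R) : 0 < x -> ln (x `^ a) = a * ln x.
Proof. by move=> x0; rewrite ln_powR. Qed.

(* The weight [h ^ (3 s - 4) * q ^ (2 - 3 s)] of a node dominates the total
   weight of its children; the latter are labelled by [m], [j], [m'], [j']. *)
Lemma child_weight (s z eta C h q h' u m j m' j' : R) :
  0 < z -> 0 < eta -> 2 * z <= 3 * s - 4 -> 4 * z <= eta -> 1 <= C -> 1 <= h -> 1 <= q ->
  1 <= h' -> 1 <= u -> 1 <= m -> 1 <= j -> 1 <= m' -> 1 <= j' ->
  m * q <= 2 * (h * h') -> j * h <= 2 * h' -> m' * (h' / C) `^ (2 + eta) <= u -> j' * q <= u ->
  h' `^ (3 * s - 4) * u `^ (2 - 3 * s) <=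
  (h `^ (3 * s - 4) * q `^ (2 - 3 * s)) *
  (C `^ ((2 + eta) * (3 * s - 3 - z)) * 2 `^ (3 * s - 2) * h' `^ (- (eta / 2))) *
  (m `^ (- (1 + z)) * j `^ (- (1 + z)) * m' `^ (- (1 + z)) * j' `^ (- (1 + z))).
Proof.
move=> z0 eta0 zs ze C1 h1 q1 h'1 u1 m1 j1 m'1 j'1 e1 e2 e3 e4.
have pos (x : R) : 1 <= x -> 0 < x by exact: lt_le_trans.
have [C0 h0 q0 h'0] := And4 (pos _ C1) (pos _ h1) (pos _ q1) (pos _ h'1).
have u0 := pos _ u1.
have [m0 j0 m'0 j'0] := And4 (pos _ m1) (pos _ j1) (pos _ m'1) (pos _ j'1).
have two0 : 0 < 2 :> R by [].
have p (x a : R) : 0 < x -> 0 < x `^ a by exact: powR_gt0.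
have lnle (x y : R) : 0 < x -> x <= y -> ln x <= ln y.
  by move=> x0 xy; rewrite ler_ln ?posrE // (lt_le_trans x0).
have ln1 (x : R) : 1 <= x -> 0 <= ln x by exact: ln_ge0.
have {}e1 := lnle _ _ (mulr_gt0 m0 q0) e1.
have {}e2 := lnle _ _ (mulr_gt0 j0 h0) e2.
have {}e3 := lnle _ _ (mulr_gt0 m'0 (p _ _ (divr_gt0 h'0 C0))) e3.
have {}e4 := lnle _ _ (mulr_gt0 j'0 q0) e4.
have hh'0 := mulr_gt0 h0 h'0.
have Ci : 0 < C^-1 by rewrite invr_gt0.
rewrite !lnM ?posrE // in e1 e2 e4.
rewrite lnM ?posrE ?p ?divr_gt0 // ln_scale ?divr_gt0 // lnM ?posrE // lnV ?posrE // in e3.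
rewrite -ler_ln ?posrE; last 2 first.
- by rewrite mulr_gt0 ?p.
- by rewrite !mulr_gt0 ?p.
rewrite !lnM ?posrE ?mulr_gt0 ?p // !ln_scale //.
have [lC lh lq lh'] := And4 (ln1 _ C1) (ln1 _ h1) (ln1 _ q1) (ln1 _ h'1).
have [lm lj lm' lj'] := And4 (ln1 _ m1) (ln1 _ j1) (ln1 _ m'1) (ln1 _ j'1).
move: (ln C) (ln h) (ln q) (ln h') (ln u) (ln m) (ln j) (ln m') (ln j') (ln 2)
  lC lh lq lh' lm lj lm' lj' e1 e2 e3 e4.
move: z0 eta0 zs ze; clear.
move=> z0 eta0 zs ze C h q h' u m j m' j' l2 C0 h0 q0 h'0 m0 j0 m'0 j'0 e1 e2 e3 e4.
(* The inequalities for [m] and [m'] are used with exponent [w], those for [j] and [j'] with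
   exponent [1 + z], so that [q] and [u] receive [w + (1 + z) = 3s - 2]. The requirement
   [w >= 1 + z] is where [s > 4/3] is spent. *)
pose w := 3 * s - 3 - z.
have w1 : 1 + z <= w by rewrite /w; lra.
have w0 : 0 <= w by lra.
have z1 : 0 <= 1 + z by lra.
have f1 := ler_wpM2l w0 e1; have f2 := ler_wpM2l z1 e2.
have f3 := ler_wpM2l w0 e3; have f4 := ler_wpM2l z1 e4.
have wz : 0 <= w - (1 + z) by lra.
have g1 := mulr_ge0 wz m'0; have g2 := mulr_ge0 wz m0.
have g3 := mulr_ge0 (ltW z0) h0.
have hw : eta * 1 <= eta * w by rewrite ler_pM2l //; lra.
have we : 0 <= eta * w - eta / 2 - 2 * z by lra.
have g4 := mulr_ge0 we h'0.
have sE : s = (w + 3 + z) / 3 by rewrite /w; field.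
rewrite -/w; clearbody w; subst s.
by lra.
Qed.

(** Apart from the power of [D], the right side is the left side times [(q / h ^ 2) ^ (2 - s)],
    which is at least 1. *)
Lemma diam_weight (s D h q : R) : s <= 2 -> 0 < D -> 1 <= h -> h ^+ 2 <= q ->
  (D * (h / q ^+ 2)) `^ s <= D `^ s * (h `^ (3 * s - 4) * q `^ (2 - 3 * s)).
Proof.
move=> s2 D0 h1 hq.
have h0 : 0 < h := lt_le_trans ltr01 h1.
have q0 : 0 < q by apply: lt_le_trans hq; rewrite exprn_gt0.
have hq0 : 0 < h / q ^+ 2 by rewrite divr_gt0 // exprn_gt0.
rewrite powRM ?(ltW D0) ?(ltW hq0) // ler_wpM2l ?powR_ge0 //.
have l1 : 2 * ln h <= ln q.
  rewrite -ln_scale // powR_mulrn ?(ltW h0) // ler_ln ?posrE //.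
  by rewrite exprn_gt0.
rewrite -ler_ln ?posrE ?mulr_gt0 ?powR_gt0 // lnM ?posrE ?powR_gt0 // !ln_scale //.
rewrite lnM ?posrE ?invr_gt0 ?exprn_gt0 // lnV ?posrE ?exprn_gt0 //.
rewrite -powR_mulrn ?(ltW q0) // ln_scale //.
have : (2 - s) * (2 * ln h) <= (2 - s) * ln q by rewrite ler_wpM2l // subr_ge0.
by move: (ln h) (ln q) => x y; lra.
Qed.

End child_weight.

(** * Integer labels that determine the next pair *)

Section labels.
Implicit Types H X : vec.

(* The coordinate of [X] at a position where [H] attains its norm. *)
Definition maxcoord H X : int :=
  if `|H.1.1| == nrm H then X.1.1 else if `|H.1.2| == nrm H then X.1.2 else X.2.

Lemma maxcoord_norm H : `|maxcoord H H| = nrm H.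
Proof.
rewrite /maxcoord; case: eqP => // n1; case: eqP => // n2.
move: n1 n2; rewrite /nrm /Num.max; case: ifP => // _; case: ifP => //.
Qed.

Lemma maxcoord_le H X : `|maxcoord H X| <= nrm X.
Proof. by have [a b c] := nrm_ge X; rewrite /maxcoord; case: ifP => // _; case: ifP. Qed.

Lemma maxcoord_sub H X Y : maxcoord H (vsub X Y) = maxcoord H X - maxcoord H Y.
Proof. by rewrite /maxcoord; case: ifP => // _; case: ifP. Qed.

Lemma maxcoord_scale H n X : maxcoord H (vscale n X) = n * maxcoord H X.
Proof. by rewrite /maxcoord; case: ifP => // _; case: ifP. Qed.

(** [m] determines [H'] up to adding multiples of [H], and [j] selects the multiple; likewise [m']
    determines [U] up to multiples of [Q], and [j'] selects one. *)
Definition labelled (Q H : vec) (m j m' j' : int) (U H' : vec) : Prop :=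
  [/\ cross H H' = vscale m Q, (maxcoord H H' %/ nrm H)%Z = j,
      cross Q U = vscale m' H' & (U.2 %/ Q.2)%Z = j'].

Lemma same_quotient (a b d n : int) : 0 < d -> (a %/ d)%Z = (b %/ d)%Z -> `|a - b| = `|n| * d -> n = 0.
Proof.
move=> d0 e ab; have ha := divz_eq a d; have hb := divz_eq b d.
have d_neq0 : d != 0 by rewrite gt_eqF.
have := modz_ge0 a d_neq0; have := modz_ge0 b d_neq0.
have := ltz_pmod a d0; have := ltz_pmod b d0 => h1 h2 h3 h4.
have : `|a - b| < d.
  by rewrite ha hb e opprD addrACA subrr add0r ltr_norml; apply/andP; split; lia.
rewrite ab -[X in _ < X]mul1r ltr_pM2r // => n1.
by apply/eqP; rewrite -normr_eq0; apply/eqP; have := normr_ge0 n; lia.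
Qed.

Lemma labelled_unique (Q H : vec) m j m' j' U1 H1 U2 H2 :
  primitive Q -> primitive H -> 0 < Q.2 ->
  labelled Q H m j m' j' U1 H1 -> labelled Q H m j m' j' U2 H2 -> U1 = U2 /\ H1 = H2.
Proof.
move=> pQ pH Q0 [a1 a2 a3 a4] [b1 b2 b3 b4].
have HE : H1 = H2.
  have [|n hn] := parallel_primitive pH (_ : cross H (vsub H1 H2) = vzero).
    by rewrite cross_sub a1 b1; apply/vsub_eq0.
  have n0 : n = 0.
    apply: (@same_quotient (maxcoord H H1) (maxcoord H H2) (nrm H)).
    - exact: nrm_gt0 (primitive_neq0 pH).
    - by rewrite a2 b2.
    - by rewrite -maxcoord_sub hn maxcoord_scale normrM maxcoord_norm.
  by apply/vsub_eq0; rewrite hn n0 /vscale !mul0r.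
split => //; subst H2.
have [|n hn] := parallel_primitive pQ (_ : cross Q (vsub U1 U2) = vzero).
  by rewrite cross_sub a3 b3; apply/vsub_eq0.
have n0 : n = 0.
  apply: (@same_quotient U1.2 U2.2 Q.2) => //; first by rewrite a4 b4.
  by have /(congr1 snd) /= -> := hn; rewrite normrM (gtr0_norm Q0).
by apply/vsub_eq0; rewrite hn n0 /vscale !mul0r.
Qed.

(** By the triple product formula, [H x H'] is parallel to the primitive [Q], and [Q x U] to the
    primitive [H']. [P] lies in the plane normal to [H'] but not in that normal to [H], so [m] is
    nonzero; [m'] is nonzero because [Q] and [U] are independent. *)
Lemma label_exists (Q H U H' P : vec) : primitive Q -> primitive H -> primitive H' ->
  dot H Q = 0 -> dot H' Q = 0 -> dot H' U = 0 -> dot H P <> 0 -> dot H' P = 0 ->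
  cross Q U <> vzero ->
  exists m j m' j', [/\ labelled Q H m j m' j' U H', m != 0 & m' != 0].
Proof.
move=> pQ pH pH' HQ H'Q H'U HP H'P QU.
have cQ : cross Q (cross H H') = vzero.
  have e A B C : cross A (cross B C) = vsub (vscale (dot A C) B) (vscale (dot A B) C).
    by apply: vecP; rewrite /cross /vsub /vscale /dot /=; ring.
  by rewrite e dotC H'Q dotC HQ /vscale !mul0r /vsub !subr0.
have cH' : cross H' (cross Q U) = vzero.
  have e A B C : cross A (cross B C) = vsub (vscale (dot A C) B) (vscale (dot A B) C).
    by apply: vecP; rewrite /cross /vsub /vscale /dot /=; ring.
  by rewrite e H'Q H'U /vscale !mul0r /vsub !subr0.
have [m hm] := parallel_primitive pQ cQ; have [m' hm'] := parallel_primitive pH' cH'.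
exists m, (maxcoord H H' %/ nrm H)%Z, m', (U.2 %/ Q.2)%Z; split => //.
  apply/eqP => m0; rewrite m0 in hm.
  have [|n hn] := parallel_primitive pH (_ : cross H H' = vzero).
    by rewrite hm /vscale !mul0r.
  have n0 : n = 0.
    apply/eqP/negPn/negP => n0; apply: HP; apply/eqP.
    have : n * dot H P = 0 by rewrite dotC -dot_scale -hn dotC.
    by move/eqP; rewrite mulf_eq0 (negbTE n0).
  by apply: (primitive_neq0 pH'); rewrite hn n0 /vscale !mul0r.
by apply/eqP => m0; apply: QU; rewrite hm' m0 /vscale !mul0r.
Qed.

End labels.

Section tree.
Context {R : realType}.
Variables (M X0 mu s : R).
Hypothesis M0 : 0 <= M.
Hypothesis X00 : 0 < X0.
Hypothesis mu12 : 1 / 2 < mu < 1.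
Hypothesis s432 : 4 / 3 < s < 2.

(** Twice the constant of [cross_bound], since [(v / 2) ^ (-mu) <= 2 v ^ (-mu)]. With [eta],
    positive because [mu > 1/2], the bound [|H| <= C q ^ (1 - mu)] reads
    [(|H| / C) ^ (2 + eta) <= q]. *)
Let C : R := 2 * (4 * M + 2).
Let eta : R := (1 - mu)^-1 - 2.
Let Rn (H : vec) : R := (nrm H)%:~R.

Definition base (t : 'rV[R]_2) : Prop :=
  [/\ off_lines t, unif t mu X0, `|t 0 0| <= M & `|t 0 1| <= M].

(* [H] is normal to a plane containing [Q] but not the next best approximation. *)
Definition good N (t : 'rV[R]_2) (Q H : vec) : Prop := exists q v,
  [/\ Q = approx t q, record t q, (N <= q)%N & next t q v] /\
  [/\ primitive H, dot H Q = 0, dot H (approx t v) <> 0 &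
      Rn H <= C * q%:R `^ (1 - mu)].

Let mu1 : 0 < 1 - mu. Proof. by case/andP: mu12 => *; lra. Qed.
Let mu0 : 0 < mu. Proof. by case/andP: mu12 => *; lra. Qed.

Let eta0 : 0 < eta.
Proof.
rewrite /eta subr_gt0 -[2]invrK ltf_pV2 ?posrE ?invr_gt0 //.
by case/andP: mu12 => *; lra.
Qed.

Let etaE : (1 - mu) * (2 + eta) = 1.
Proof. by rewrite /eta addrCA subrr addr0 mulfV // gt_eqF. Qed.

Let etamu : mu * (2 + eta) = 1 + eta.
Proof. by move: etaE; rewrite mulrBl mul1r => h; lra. Qed.

Let C1 : 1 <= C. Proof. by move: M0; rewrite /C; lra. Qed.
Let C0 : 0 < C. Proof. exact: lt_le_trans C1. Qed.

Lemma Rn_ge1 H : primitive H -> 1 <= Rn H.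
Proof. by move=> /primitive_neq0 /nrm_gt0 h; rewrite /Rn (ler1z R) -gtz0_ge1. Qed.

(** [H'] is the primitive normal to the plane of the best approximations [q] and [v], and [U] is one
    from [v] on that lies in this plane while its successor does not. The bound on [H'] by
    [cross_bound] holds with [v], hence with the denominator of [U]; the same estimate for
    [Q x U = m' H'] gains the factor [m']. *)
Lemma extend N (t : 'rV[R]_2) q v : base t -> record t q -> (N <= q)%N -> 2 * X0 <= N%:R -> next t q v ->
  exists U H', [/\ good N t U H', primitive H', dot H' (approx t q) = 0 &
      dot H' (approx t v) = 0] /\
    [/\ dot H' U = 0 /\ Posz q <= U.2, cross (approx t q) U <> vzero,
      (Rn H' / C) `^ (2 + eta) <= (U.2)%:~R,
      (forall m', cross (approx t q) U = vscale m' H' ->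
         `|m'|%:~R * (Rn H' / C) `^ (2 + eta) <= (U.2)%:~R) &
      err t q <= 2 * (Rn H' / C) `^ (- (1 + eta))].
Proof.
move=> [off U M1 M2] rq Nq NX nv.
have [q0 _] := rq; have [qv ev _] := nv.
have rv := next_record rq nv.
have [d [H' [d0 pH' dE]]] := primitive_part (cross_independent q0 qv ev).
have H'q : dot H' (approx t q) = 0.
  have : d * dot H' (approx t q) = 0 by rewrite [dot H' _]dotC -dot_scale -dE cross_dotl.
  by move/eqP; rewrite mulf_eq0 (gt_eqF d0) => /eqP.
have H'v : dot H' (approx t v) = 0.
  have : d * dot H' (approx t v) = 0 by rewrite [dot H' _]dotC -dot_scale -dE cross_dotr.
  by move/eqP; rewrite mulf_eq0 (gt_eqF d0) => /eqP.
have [u [w [vu ru H'u nw H'w]]] := exit_plane mu0 off U (primitive_neq0 pH') rv H'v.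
have qu : (q < u)%N := leq_trans qv vu.
have eu : err t u < err t q.
  have [uv|vu'|->//] := ltngtP u v; first by move: vu; rewrite leqNgt uv.
  by apply: lt_trans ev; apply: ru.2; rewrite vu' andbT; exact: leq_ltn_trans qv.
have v0 : 0 < v%:R :> R by rewrite ltr0n; exact: leq_ltn_trans qv.
have u0 : 0 < u%:R :> R by rewrite ltr0n; exact: leq_ltn_trans qu.
have vur : v%:R <= u%:R :> R by rewrite ler_nat.
have qerr : err t q <= 2 * v%:R `^ (- mu).
  have vX : 2 * X0 <= v%:R.
    by apply: le_trans NX _; rewrite ler_nat; apply: leq_trans Nq _; exact: ltnW.
  apply: le_trans (err_next X00 U rq nv vX) _.
  rewrite powRM ?(ltW v0) ?invr_ge0 // mulrC ler_wpM2r ?powR_ge0 //.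
  rewrite -powR_inv1 // -powRrM mulN1r opprK -[leRHS]powRr1 //.
  by apply: ler_powR; [lra|case/andP: mu12 => *; lra].
have h'v : Rn H' <= C * v%:R `^ (1 - mu).
  have : Rn (cross (approx t q) (approx t v)) <= (4 * M + 2) * (v%:R * err t q).
    by apply: cross_bound => //; [exact: ltnW qv|exact: ltW ev].
  rewrite dE /Rn nrm_scale intrM => h1.
  apply: (@le_trans _ _ (`|d|%:~R * Rn H')).
    rewrite -[leLHS]mul1r ler_wpM2r //; last by rewrite (ler1z R) gtr0_norm //; lia.
    by rewrite (le_trans ler01) // Rn_ge1.
  apply: le_trans h1 _.
  have -> : C * v%:R `^ (1 - mu) = (4 * M + 2) * (v%:R * (2 * v%:R `^ (- mu))).
    by rewrite powR_add // powRr1 ?(ltW v0) // /C; ring.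
  rewrite ler_wpM2l //; first by move: M0; lra.
  by rewrite ler_wpM2l // ltW.
have h'1 := Rn_ge1 pH'.
have h'0 : 0 < Rn H' := lt_le_trans ltr01 h'1.
have g0 : 0 < Rn H' / C by rewrite divr_gt0.
have gv : (Rn H' / C) `^ (2 + eta) <= v%:R.
  have -> : v%:R = (v%:R `^ (1 - mu)) `^ (2 + eta) :> R.
    by rewrite -powRrM etaE powRr1 // ltW.
  apply: powR_le; rewrite ?(ltW g0) //; first by rewrite ler_pdivrMr // mulrC.
  by rewrite addr_ge0 // ltW.
have qerr2 : err t q <= 2 * (Rn H' / C) `^ (- (1 + eta)).
  apply: le_trans qerr _; rewrite ler_wpM2l //.
  have -> : (Rn H' / C) `^ (- (1 + eta)) = ((Rn H' / C) `^ (2 + eta)) `^ (- mu).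
    by rewrite -powRrM mulrN [_ * mu]mulrC etamu.
  apply: powR_leN => //; first by rewrite powR_gt0.
  by rewrite oppr_le0 ltW.
exists (approx t u), H'; split.
  split => //; exists u, w; split; split => //.
    by apply: leq_trans Nq _; exact: ltnW.
  apply: le_trans h'v _; rewrite ler_pM2l //; apply: powR_le => //; exact: ltW.
split => //.
- by split => //; rewrite lez_nat ltnW.
- exact: cross_independent.
- exact: le_trans gv vur.
move=> m' mE.
have : Rn (cross (approx t q) (approx t u)) <= (4 * M + 2) * (u%:R * err t q).
  by apply: cross_bound => //; [exact: ltnW qu|exact: ltW eu].
rewrite mE /Rn nrm_scale intrM -/(Rn H') => h1.
have h2 : `|m'|%:~R * Rn H' <= C * (u%:R * (Rn H' / C) `^ (- (1 + eta))).
  apply: le_trans h1 _.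
  have -> : C * (u%:R * (Rn H' / C) `^ (- (1 + eta))) =
    (4 * M + 2) * (u%:R * (2 * (Rn H' / C) `^ (- (1 + eta)))) by rewrite /C; ring.
  rewrite ler_wpM2l //; first by move: M0; lra.
  by rewrite ler_wpM2l // ltW.
have -> : (Rn H' / C) `^ (2 + eta) = (Rn H' / C) * (Rn H' / C) `^ (1 + eta).
  rewrite (_ : 2 + eta = 1 + (1 + eta)); last by ring.
  by rewrite powR_add // powRr1 // ltW.
have p0 : 0 < (Rn H' / C) `^ (1 + eta) by rewrite powR_gt0.
rewrite mulrA -ler_pdivlMr // -powRN mulrA ler_pdivrMr //.
by apply: le_trans h2 _; rewrite mulrC.
Qed.

Let z : R := Num.min ((3 * s - 4) / 2) (eta / 4).
Let K : R := C `^ ((2 + eta) * (3 * s - 3 - z)) * 2 `^ (3 * s - 2).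

Let z0 : 0 < z.
Proof.
rewrite /z lt_min; case/andP: s432 => *.
by apply/andP; split; rewrite divr_gt0 //; lra.
Qed.

Let zs : 2 * z <= 3 * s - 4.
Proof. by rewrite -ler_pdivlMl // mulrC /z ge_min lexx. Qed.

Let zeta4 : 4 * z <= eta.
Proof. by rewrite -ler_pdivlMl // mulrC /z ge_min lexx orbT. Qed.

Definition lab (n : int) : R := Num.max 1 `|n|%:~R.

(** The last clause turns [|H| <= C q ^ (1 - mu)] into [2 |H| ^ 2 <= q] for [q >= N]. *)
Definition large (N : nat) : Prop :=
  [/\ (0 < N)%N, 2 * X0 <= N%:R & forall x : R, N%:R <= x -> 2 * C ^+ 2 <= x `^ (2 * mu - 1)].

Lemma good_child N (t : 'rV[R]_2) Q H : large N -> base t -> good N t Q H ->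
  exists q U H' m j m' j',
   [/\ Q = approx t q, (N <= q)%N, primitive Q, primitive H & 2 * Rn H ^+ 2 <= q%:R] /\
   [/\ labelled Q H m j m' j' U H', good N t U H', primitive H',
       err t q <= 2 * (Rn H' / C) `^ (- (1 + eta)) & q%:R <= (U.2)%:~R :> R] /\
   [/\ lab m * q%:R <= 2 * (Rn H * Rn H'), lab j * Rn H <= 2 * Rn H',
       lab m' * (Rn H' / C) `^ (2 + eta) <= (U.2)%:~R & lab j' * q%:R <= (U.2)%:~R].
Proof.
move=> [N0 NX Nbig] bt [q [v [[QE rq Nq nv] [pH HQ Hv hH]]]].
have [U [H' [[gU pH' H'q H'v] [[H'U qU] QU gu gm' qe]]]] := extend bt rq Nq NX nv.
have pQ : primitive Q by rewrite QE; exact: record_primitive.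
rewrite -QE in H'q QU gm'.
have [m [j [m' [j' [lab0 m_neq0 m'_neq0]]]]] := label_exists pQ pH pH' HQ H'q H'U Hv H'v QU.
have max1 (n : int) : n != 0 -> lab n = `|n|%:~R.
  by move=> n0; apply/max_idPr; rewrite (ler1z R) -gtz0_ge1 normr_gt0.
have h1 := Rn_ge1 pH; have h'1 := Rn_ge1 pH'.
have h0 : 0 < Rn H := lt_le_trans ltr01 h1.
have h'0 : 0 < Rn H' := lt_le_trans ltr01 h'1.
have q0 : (0 < q)%N by case: rq.
have qr0 : 0 < q%:R :> R by rewrite ltr0n.
have h2q : 2 * Rn H ^+ 2 <= q%:R.
  apply: (@le_trans _ _ (2 * (C * q%:R `^ (1 - mu)) ^+ 2)).
    rewrite ler_pM2l //; apply: lerXn2r => //; rewrite nnegrE ?(ltW h0) //.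
    by rewrite mulr_ge0 ?powR_ge0 // ltW.
  rewrite exprMn mulrA.
  have NqR : N%:R <= q%:R :> R by rewrite ler_nat.
  rewrite [leRHS](_ : _ = q%:R `^ (2 * mu - 1) * (q%:R `^ (1 - mu)) ^+ 2); last first.
    rewrite expr2 -!powR_add // -[LHS]powRr1 ?(ltW qr0) //; congr (_ `^ _); ring.
  by rewrite ler_wpM2r ?sqr_ge0 // Nbig.
have qhh : `|m|%:~R * q%:R <= 2 * (Rn H * Rn H').
  have [lm _ _ _] := lab0; have := nrm_cross H H'; rewrite lm nrm_scale -(ler_int R) !intrM.
  apply: le_trans; rewrite ler_wpM2l ?ler0z //.
  have [_ _ +] := nrm_ge Q; rewrite -(ler_int R) QE /=; apply: le_trans.
  by rewrite ger0_norm.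
have m1 : 1 <= `|m|%:~R :> R by rewrite (ler1z R) -gtz0_ge1 normr_gt0.
(* [2 |H| ^ 2 <= q <= 2 |H| |H'|] makes the norms increase; the remainder in the quotient [j], less
   than [|H|], is then absorbed by [|H'|]. *)
have hh' : Rn H <= Rn H'.
  rewrite -(ler_pM2l h0) -expr2 -(ler_pM2l (_ : 0 < 2)) //.
  apply: le_trans h2q _; apply: le_trans qhh.
  by rewrite -[leLHS]mul1r ler_pM2r.
have Q2 : Q.2 = Posz q by rewrite QE.
have qUr : q%:R <= (U.2)%:~R :> R by rewrite -[leLHS]/((Posz q)%:~R) ler_int.
have [_ lj _ lj'] := lab0.
have j'q : 0 < j' /\ j' * Posz q <= U.2.
  have := divz_eq U.2 (Posz q); rewrite -Q2 lj' Q2 => e.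
  have qn0 : Posz q != 0 by rewrite -lt0n.
  have := modz_ge0 U.2 qn0; have qz : 0 < Posz q by [].
  have := ltz_pmod U.2 qz => r1 r2.
  split; last by rewrite [leRHS]e lerDl.
  rewrite ltNge; apply/negP => j0.
  have j'q0 : j' * Posz q <= 0 by rewrite mulr_le0_ge0.
  by move: qU; rewrite leNgt e -[X in _ < X]add0r ler_ltD.
have jh : `|j|%:~R * Rn H <= 2 * Rn H'.
  have nH0 : 0 < nrm H := nrm_gt0 (primitive_neq0 pH).
  have := divz_eq (maxcoord H H') (nrm H); rewrite lj => e.
  have := modz_ge0 (maxcoord H H') (lt0r_neq0 nH0); have := ltz_pmod (maxcoord H H') nH0.
  set r := (_ %% _)%Z in e * => r1 r2.
  have : `|j| * nrm H <= nrm H' + nrm H.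
    have -> : `|j| * nrm H = `|maxcoord H H' - r|.
      by rewrite e addrK normrM (gtr0_norm nH0).
    apply: le_trans (ler_normB _ _) _; apply: lerD; first exact: maxcoord_le.
    by rewrite ger0_norm // ltW.
  rewrite -(ler_int R) intrD intrM -/(Rn H) -/(Rn H') => h.
  by apply: le_trans h _; lra.
exists q, U, H', m, j, m', j'; split; first by [].
split; first by [].
split.
- by rewrite max1.
- by rewrite /lab maxr_pMl ?(ltW h0) // ge_max mul1r jh andbT; lra.
- by rewrite max1 //; apply: gm'; have [] := lab0.
- rewrite max1 ?gt_eqF //; first by rewrite gtr0_norm ?j'q.1 // -[q%:R]/((Posz q)%:~R) -intrM ler_int j'q.2.
  exact: j'q.1.
Qed.

Let C2 : R := 4 * C `^ (1 + eta).

Let C20 : 0 < C2. Proof. by rewrite mulr_gt0 // powR_gt0. Qed.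

Definition vcenter (Q : vec) : 'rV[R]_2 :=
  \row_i (if i == 0 then (Q.1.1)%:~R / (Q.2)%:~R else (Q.1.2)%:~R / (Q.2)%:~R).

Definition weightf (Q H : vec) : R := Rn H `^ (3 * s - 4) * (Q.2)%:~R `^ (2 - 3 * s).

Lemma lab_ge1 n : 1 <= lab n.
Proof. by rewrite /lab le_max lexx. Qed.

Lemma weightf_ge0 Q H : 0 <= weightf Q H.
Proof. by rewrite mulr_ge0 // powR_ge0. Qed.

(** The error is of order [1 / |H'|] and [q <= 2 |H| |H'|], so it is of order [|H| / q]; the two
    factors 2 and the power of [C] make up [C2]. *)
Lemma good_dist N (t : 'rV[R]_2) Q H : large N -> base t -> good N t Q H ->
  [/\ primitive Q, primitive H, N%:R <= (Q.2)%:~R :> R, 2 * Rn H ^+ 2 <= (Q.2)%:~R &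
    `|t - vcenter Q| <= C2 * (Rn H / (Q.2)%:~R ^+ 2)].
Proof.
move=> lN bt gt.
have [q [U [H' [m [j [m' [j' [[QE Nq pQ pH h2q] [[_ _ pH' qe _] [mq _ _ _]]]]]]]]]] := good_child lN bt gt.
have [N0 _ _] := lN.
have qR : (Q.2)%:~R = q%:R :> R by rewrite QE.
have h1 := Rn_ge1 pH; have h'1 := Rn_ge1 pH'.
have h0 : 0 < Rn H := lt_le_trans ltr01 h1.
have h'0 : 0 < Rn H' := lt_le_trans ltr01 h'1.
have q0 : (0 < q)%N := leq_trans N0 Nq.
have qr0 : 0 < q%:R :> R by rewrite ltr0n.
have qhh : q%:R <= 2 * (Rn H * Rn H').
  by apply: le_trans mq; rewrite -[leLHS]mul1r ler_pM2r // lab_ge1.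
split => //; first by rewrite qR ler_nat.
  by rewrite qR.
have qe2 : err t q <= C2 * (Rn H / q%:R).
  apply: le_trans qe _; rewrite powRM ?invr_ge0 ?(ltW h'0) ?(ltW C0) //.
  rewrite -powR_inv1 ?(ltW C0) // -powRrM mulrNN mul1r.
  have -> : C2 * (Rn H / q%:R) = 2 * (2 * Rn H / q%:R * C `^ (1 + eta)) by rewrite /C2; ring.
  rewrite ler_pM2l // ler_wpM2r ?powR_ge0 //.
  apply: (@le_trans _ _ (Rn H' `^ (-1))).
    by apply: ler_powR => //; rewrite lerN2 lerDl ltW.
  rewrite powR_inv1 ?(ltW h'0) // -[leRHS]invrK lef_pV2 ?posrE ?invr_gt0 ?divr_gt0 ?mulr_gt0 //.
  by rewrite invf_div ler_pdivrMr ?mulr_gt0 // mulrC -mulrA.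
have coord (x : R) : `|q%:R * x - (rd (q%:R * x))%:~R| <= err t q ->
    `|x - (rd (q%:R * x))%:~R / q%:R| <= C2 * (Rn H / q%:R ^+ 2).
  move=> hx; have -> : x - (rd (q%:R * x))%:~R / q%:R = (q%:R * x - (rd (q%:R * x))%:~R) / q%:R.
    by field; rewrite gt_eqF.
  rewrite normrM normfV (gtr0_norm qr0) ler_pdivrMr //.
  apply: le_trans hx (le_trans qe2 _).
  by rewrite le_eqVlt; apply/orP; left; apply/eqP; field; rewrite gt_eqF.
rewrite qR norm2_le !mxE /= qR QE /=; apply/andP.
by split; apply: coord; rewrite /err le_max lexx ?orbT.
Qed.

Definition cell N Q H : set 'rV[R]_2 := [set t | base t /\ good N t Q H].

Lemma content_cell delta N Q H : 0 < delta -> large N -> 2 * C2 <= delta * N%:R ->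
  (hausdorff_content s delta (cell N Q H) <= ((2 * C2) `^ s * weightf Q H)%:E)%E.
Proof.
move=> d0 lN dN; have [N0 _ _] := lN.
have s0 : 0 < s by case/andP: s432 => *; lra.
have [[t0 [bt0 gt0]]|no] := pselect (exists t, cell N Q H t); last first.
  rewrite (_ : cell N Q H = set0); last by apply/seteqP; split => // t ct; exfalso; apply: no; exists t.
  by rewrite content_set0 ?(ltW d0) // lee_fin mulr_ge0 ?powR_ge0 // weightf_ge0.
have [pQ pH NQ h2q _] := good_dist lN bt0 gt0.
have h1 := Rn_ge1 pH.
have h0 : 0 < Rn H := lt_le_trans ltr01 h1.
have N0r : 0 < N%:R :> R by rewrite ltr0n.
set q : R := (Q.2)%:~R in NQ h2q *.
have q0 : 0 < q := lt_le_trans N0r NQ.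
have hq : Rn H ^+ 2 <= q.
  by apply: le_trans h2q; rewrite -[leLHS]mul1r ler_pM2r ?exprn_gt0 //; lra.
have hq1 : Rn H <= q.
  by apply: le_trans hq; rewrite expr2 -[leLHS]mul1r ler_pM2r.
pose r := 2 * C2 * (Rn H / q ^+ 2).
have r0 : 0 <= r.
  rewrite /r; apply: mulr_ge0; first by rewrite mulr_ge0 // ltW.
  by rewrite divr_ge0 ?sqr_ge0 // ltW.
apply: (@le_trans _ _ (r `^ s)%:E); last first.
  rewrite lee_fin /weightf -/q; apply: diam_weight => //; last by rewrite mulr_gt0.
  by case/andP: s432 => _ /ltW.
apply: content_le1 => //.
  apply: (@le_trans _ _ (delta * N%:R * (Rn H / q ^+ 2))).
    by rewrite /r ler_wpM2r // divr_ge0 ?sqr_ge0 // ltW.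
  rewrite -mulrA -[leRHS]mulr1 ler_pM2l // mulrA ler_pdivrMr ?exprn_gt0 // mul1r expr2.
  by apply: ler_pM => //; exact: ltW.
move=> x y [bx gx] [by_ gy].
have [_ _ _ _ dx] := good_dist lN bx gx; have [_ _ _ _ dy] := good_dist lN by_ gy.
rewrite (_ : x - y = (x - vcenter Q) - (y - vcenter Q)); last by rewrite opprB addrA subrK.
apply: le_trans (ler_normB _ _) _.
have -> : r = C2 * (Rn H / q ^+ 2) + C2 * (Rn H / q ^+ 2) by rewrite /r; ring.
exact: lerD.
Qed.

(** The factor [K |H'| ^ (-eta / 2)] of a child must drop below [1 / (2 Z ^ 4)]: one [Z] for each
    label sum, and 2 for the decay from one generation to the next. Since [|H'| ^ 2 >= N / 2], this
    is a condition on [N]. *)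
Lemma tree_step N (t : 'rV[R]_2) Q H Z : large N -> 0 < Z ->
  (forall x : R, N%:R <= 2 * x -> 2 * K * Z ^+ 4 <= x `^ (eta / 4)) ->
  base t -> good N t Q H ->
  exists U H' m j m' j', [/\ labelled Q H m j m' j' U H', good N t U H' &
    weightf U H' <= weightf Q H / (2 * Z ^+ 4) *
      (weight z m * weight z j * weight z m' * weight z j')].
Proof.
move=> lN Z0 Nbig bt gt.
have [q [U [H' [m [j [m' [j' [[QE Nq pQ pH h2q] [[lb gU pH' _ qU] [mq jq m'q j'q]]]]]]]]]] := good_child lN bt gt.
have [N0 _ _] := lN.
exists U, H', m, j, m', j'; split => //.
have qR : (Q.2)%:~R = q%:R :> R by rewrite QE.
have h1 := Rn_ge1 pH; have h'1 := Rn_ge1 pH'.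
have h0 : 0 < Rn H := lt_le_trans ltr01 h1.
have h'0 : 0 < Rn H' := lt_le_trans ltr01 h'1.
have q1 : 1 <= q%:R :> R by rewrite (ler_nat _ 1); exact: leq_trans Nq.
have u1 : 1 <= (U.2)%:~R :> R := le_trans q1 qU.
have := child_weight z0 eta0 zs zeta4 C1 h1 q1 h'1 u1 (lab_ge1 m) (lab_ge1 j) (lab_ge1 m') (lab_ge1 j')
  mq jq m'q j'q.
rewrite -/(weight z m) -/(weight z j) -/(weight z m') -/(weight z j') -/K => cw.
rewrite /weightf qR; apply: le_trans cw _.
have W0 (n : int) : 0 <= weight z n by exact: powR_ge0.
rewrite ler_wpM2r ?mulr_ge0 //.
rewrite ler_wpM2l ?mulr_ge0 ?powR_ge0 //.
have hh' : Rn H <= Rn H'.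
  rewrite -(ler_pM2l h0) -expr2 -(ler_pM2l (_ : 0 < 2)) //.
  apply: le_trans h2q _; apply: le_trans mq.
  by rewrite -[leLHS]mul1r ler_pM2r ?lab_ge1 // (lt_le_trans ltr01).
have Nh : N%:R <= 2 * Rn H' ^+ 2.
  apply: (@le_trans _ _ q%:R); first by rewrite ler_nat.
  apply: (@le_trans _ _ (2 * (Rn H * Rn H'))).
    by apply: le_trans mq; rewrite -[leLHS]mul1r ler_pM2r ?lab_ge1 // (lt_le_trans ltr01).
  by rewrite ler_pM2l // expr2 ler_pM2r.
have := Nbig _ Nh.
have -> : (Rn H' ^+ 2) `^ (eta / 4) = Rn H' `^ (eta / 2).
  rewrite -[Rn H' ^+ 2]powR_mulrn ?(ltW h'0) // -powRrM; congr (_ `^ _); by field.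
move=> big; rewrite powRN ler_pdivrMr ?powR_gt0 // ler_pdivlMl ?mulr_gt0 ?exprn_gt0 //.
by apply: le_trans big; rewrite mulrAC.
Qed.

(** At fixed [delta], passing to the children and summing over the four labels halves the bound. The
    estimate is uniform in [(Q, H)], so the induction can be iterated to any depth. *)
Lemma content_tree delta N Z : 0 < delta -> large N -> 2 * C2 <= delta * N%:R -> 0 < Z ->
  (forall x : R, N%:R <= 2 * x -> 2 * K * Z ^+ 4 <= x `^ (eta / 4)) ->
  (forall (B : R) (A : int -> set 'rV[R]_2), 0 <= B ->
    (forall i, (hausdorff_content s delta (A i) <= (B * weight z i)%:E)%E) ->
    (hausdorff_content s delta (\bigcup_i A i) <= (B * Z)%:E)%E) ->
  forall n Q H, (hausdorff_content s delta (cell N Q H) <=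
    ((2 * C2) `^ s * weightf Q H / 2 ^+ n)%:E)%E.
Proof.
move=> d0 lN dN Z0 Nbig sumZ; elim=> [|n IH] Q H.
  by rewrite expr0 divr1; exact: content_cell.
have [[t0 [bt0 gt0]]|no] := pselect (exists t, cell N Q H t); last first.
  rewrite (_ : cell N Q H = set0); last by apply/seteqP; split => // t ct; exfalso; apply: no; exists t.
  rewrite content_set0 ?(ltW d0) // lee_fin; apply: divr_ge0; last by rewrite exprn_ge0.
  by apply: mulr_ge0; rewrite ?powR_ge0 ?weightf_ge0.
have [pQ pH NQ _ _] := good_dist lN bt0 gt0.
have [N0 _ _] := lN.
have Q20 : 0 < Q.2 by rewrite -(ltr0z R); apply: lt_le_trans NQ; rewrite ltr0n.
(* The labels determine the next pair, so a nonempty [F] lies in a single cell of the next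
   generation. *)
pose F (m j m' j' : int) : set 'rV[R]_2 := [set t | cell N Q H t /\
  exists U H', [/\ labelled Q H m j m' j' U H', good N t U H' &
    weightf U H' <= weightf Q H / (2 * Z ^+ 4) *
      (weight z m * weight z j * weight z m' * weight z j')]].
have W0 (i : int) : 0 <= weight z i by exact: powR_ge0.
pose B := (2 * C2) `^ s * weightf Q H / 2 ^+ n / (2 * Z ^+ 4).
have B0 : 0 <= B.
  rewrite /B; apply: divr_ge0; last by rewrite mulr_ge0 ?exprn_ge0 ?(ltW Z0).
  apply: divr_ge0; last by rewrite exprn_ge0.
  by apply: mulr_ge0; rewrite ?powR_ge0 ?weightf_ge0.
have hF m j m' j' : (hausdorff_content s delta (F m j m' j') <=
    (B * weight z m * weight z j * weight z m' * weight z j')%:E)%E.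
  have [[t1 [_ [U [H' [lab1 _ wU]]]]]|no] := pselect (exists t, F m j m' j' t); last first.
    rewrite (_ : F m j m' j' = set0); last by apply/seteqP; split => // t ct; exfalso; apply: no; exists t.
    rewrite content_set0 ?(ltW d0) // lee_fin; do 4!apply: mulr_ge0 => //.
  apply: (@le_trans _ _ (hausdorff_content s delta (cell N U H'))).
    apply: content_mono => t [[bt _] [U2 [H2 [lab2 g2 _]]]].
    by have [-> ->] := labelled_unique pQ pH Q20 lab1 lab2.
  apply: le_trans (IH U H') _; rewrite lee_fin.
  have -> : B * weight z m * weight z j * weight z m' * weight z j' =
    (2 * C2) `^ s * (weightf Q H / (2 * Z ^+ 4) *
      (weight z m * weight z j * weight z m' * weight z j')) / 2 ^+ n.
    by rewrite /B; ring.
  by rewrite ler_wpM2r ?invr_ge0 ?exprn_ge0 // ler_wpM2l // powR_ge0.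
have cover : cell N Q H `<=` \bigcup_m \bigcup_j \bigcup_m' \bigcup_j' F m j m' j'.
  move=> t [bt gt]; have [U [H' [m [j [m' [j' h]]]]]] := tree_step lN Z0 Nbig bt gt.
  exists m; first exact: I; exists j; first exact: I; exists m'; first exact: I.
  exists j'; first exact: I; split; first by [].
  by exists U, H'.
apply: le_trans (content_mono _ _ cover) _.
have -> : (2 * C2) `^ s * weightf Q H / 2 ^+ n.+1 = B * Z * Z * Z * Z.
  rewrite /B exprS; have : Z != 0 by rewrite gt_eqF.
  have : (2 : R) ^+ n != 0 by rewrite expf_neq0.
  move: (2 ^+ n) ((2 * C2) `^ s) (weightf Q H) => p c w p0 Zn0.
  by field; rewrite Zn0 p0.
have Zle := ltW Z0.
apply: (sumZ _ _) => [|m]; first by do 3!apply: mulr_ge0 => //.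
rewrite (_ : _ * weight z m = B * weight z m * Z * Z * Z); last by ring.
apply: (sumZ _ _) => [|j]; first by do 3!apply: mulr_ge0 => //.
rewrite (_ : _ * weight z j = B * weight z m * weight z j * Z * Z); last by ring.
apply: (sumZ _ _) => [|m']; first by do 3!apply: mulr_ge0 => //.
rewrite (_ : _ * weight z m' = B * weight z m * weight z j * weight z m' * Z); last by ring.
by apply: (sumZ _ _) => [|j'//]; do 3!apply: mulr_ge0 => //.
Qed.

Lemma content_cell0 delta N Z Q H : 0 < delta -> large N -> 2 * C2 <= delta * N%:R -> 0 < Z ->
  (forall x : R, N%:R <= 2 * x -> 2 * K * Z ^+ 4 <= x `^ (eta / 4)) ->
  (forall (B : R) (A : int -> set 'rV[R]_2), 0 <= B ->
    (forall i, (hausdorff_content s delta (A i) <= (B * weight z i)%:E)%E) ->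
    (hausdorff_content s delta (\bigcup_i A i) <= (B * Z)%:E)%E) ->
  hausdorff_content s delta (cell N Q H) = 0%E.
Proof.
move=> d0 lN dN Z0 Nbig sumZ; apply/eqP; rewrite eq_le content_ge0 andbT.
have h n := content_tree d0 lN dN Z0 Nbig sumZ n Q H.
set W := (2 * C2) `^ s * weightf Q H in h.
have W0 : 0 <= W by rewrite mulr_ge0 ?powR_ge0 // weightf_ge0.
apply/lee_addgt0Pr => e e0; rewrite add0e.
have h0 : 0 <= W / e by rewrite divr_ge0 // ltW.
apply: le_trans (h (Num.truncn (W / e)).+1) _; rewrite lee_fin.
rewrite ler_pdivrMr ?exprn_gt0 // mulrC -ler_pdivrMr //.
case/andP: (truncn_itv h0) => _ /ltW /le_trans; apply.
by rewrite -natrX ler_nat ltnW // ltn_expl.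
Qed.

Lemma large_exists delta Z : 0 < delta -> 0 < Z ->
  exists N, [/\ large N, 2 * C2 <= delta * N%:R &
    forall x : R, N%:R <= 2 * x -> 2 * K * Z ^+ 4 <= x `^ (eta / 4)].
Proof.
move=> d0 Z0.
have e1 : 0 < 2 * mu - 1 by case/andP: mu12 => *; lra.
have e2 : 0 < eta / 4 by rewrite divr_gt0.
have [T1 [_ hT1]] := powR_unbounded (2 * C ^+ 2) e1.
have [T2 [T20 hT2]] := powR_unbounded (2 * K * Z ^+ 4) e2.
pose T := Num.max (Num.max (2 * X0) T1) (Num.max (2 * T2) (2 * C2 / delta)).
have T0 : 0 <= T by rewrite /T !le_max mulr_ge0 ?(ltW X00).
pose N := (Num.truncn T).+1.
have TN : T <= N%:R by case/andP: (truncn_itv T0) => _ /ltW.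
have [[t1 t2] [t3 t4]] : (2 * X0 <= N%:R /\ T1 <= N%:R) /\ (2 * T2 <= N%:R /\ 2 * C2 / delta <= N%:R).
  by move: TN; rewrite /T !ge_max => /andP[/andP[-> ->] /andP[-> ->]].
exists N; split.
- by split => // x xN; apply: hT1; exact: le_trans xN.
- by move: t4; rewrite ler_pdivrMr // [delta * _]mulrC.
- move=> x xN; apply: hT2; rewrite -(ler_pM2l (_ : 0 < 2)) //.
  exact: le_trans xN.
Qed.

Lemma base_cell N (t : 'rV[R]_2) : large N -> base t -> exists Q H, cell N Q H t.
Proof.
move=> [N0 NX _] bt; have [off U _ _] := bt.
have [q [Nq rq]] := record_ge N mu0 off U.
have [v nv] := next_exists rq (unif_small mu0 U (err_gt0 off rq.1)).
by have [Q [H [[gQ _ _ _] _]]] := extend bt rq Nq NX nv; exists Q, H.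
Qed.

Lemma base_measure0 : hausdorff_measure s base = 0%E.
Proof.
apply/measure0P => d d0.
have [Z Z0 sumZ] := content_bigcup_int (R := R) z0.
have [N [lN dN Nbig]] := large_exists d0 Z0.
pose A n := if unpickle n is Some QH then cell N QH.1 QH.2 else set0.
have cover : base `<=` \bigcup_n A n.
  move=> t bt; have [Q [H c]] := base_cell lN bt.
  exists (pickle (Q, H)); first exact: I.
  by rewrite /A pickleK.
apply/eqP; rewrite eq_le content_ge0 andbT.
apply: le_trans (content_mono _ _ cover) _; apply: le_trans (content_sigma_subadditive _ _ _) _.
rewrite eseries0 // => n _ _; rewrite /A; case: (unpickle n) => [[Q H]|] /=.
  by apply: (content_cell0 _ _ d0 lN dN Z0 Nbig) => B A' B0 h; exact: sumZ.
by rewrite content_set0 // ltW.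
Qed.

End tree.

(** * Covering the singular points *)

Section upper_bound.
Context {R : realType}.
Implicit Types (t : 'rV[R]_2) (mu s : R).

Lemma err_le_dist t (q : int) : err t `|q|%N <= dist_to_int (q%:~R *: t).
Proof.
apply: lb_le_inf; first by exists `|q%:~R *: t - intvec 0|; exists 0.
move=> _ [p _ <-].
have [x xE xx] : exists2 x : int, `|q|%N%:R = x%:~R * q%:~R :> R & `|x%:~R| = 1 :> R.
  have [q0|q0] := leP 0 q.
    by exists 1; rewrite ?normr1 // mul1r -[LHS]/((Posz `|q|%N)%:~R) gez0_abs.
  exists (-1); last by rewrite mulrN1z normrN normr1.
  by rewrite mulrN1z mulN1r -[LHS]/((Posz `|q|%N)%:~R) ltz0_abs // mulrNz.
apply: le_trans (err_le t `|q|%N (x * p 0 0) (x * p 0 1)) _.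
have coord (i : 'I_2) : `| `|q|%N%:R * t 0 i - (x * p 0 i)%:~R | = `|(q%:~R *: t - intvec p) 0 i|.
  rewrite !mxE xE intrM -mulrA -mulrBr normrM xx mul1r.
  by [].
have /andP[n1 n2] : (`|(q%:~R *: t - intvec p) 0 0| <= `|q%:~R *: t - intvec p|) &&
   (`|(q%:~R *: t - intvec p) 0 1| <= `|q%:~R *: t - intvec p|).
  by rewrite -norm2_le.
by rewrite ge_max !coord n1 n2.
Qed.

Lemma sing_unif t mu nu : nu <= mu -> Sing_star mu t ->
  exists2 X0 : R, 1 <= X0 & forall X1, X0 <= X1 -> unif t nu X1.
Proof.
move=> nm [_ [M [_ hM]]].
exists (Num.max 1 (M + 1)); first by rewrite le_max lexx.
move=> X1; rewrite ge_max => /andP[X11 MX1] X X1X.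
have [|q [q0 qX qd]] := hM X; first by lra.
exists `|q|%N; split.
- by rewrite absz_gt0 -normr_gt0.
- by apply: le_trans qX; rewrite -[leLHS]/((Posz `|q|%N)%:~R) abszE.
apply: le_trans (err_le_dist t q) (le_trans qd _).
by apply: ler_powR; [exact: le_trans X1X|rewrite lerN2].
Qed.

Lemma sing_measure0 mu s : 1 / 2 < mu -> 4 / 3 < s < 2 ->
  hausdorff_measure s (@Sing_star R mu) = 0%E.
Proof.
(* The tree argument takes an exponent below 1, where [1 - nu] is invertible; lowering the exponent
   preserves uniform approximability. *)
move=> mu12 s432; pose nu := Num.min mu (3 / 4).
have nu12 : 1 / 2 < nu < 1.
  by rewrite /nu lt_min gt_min mu12 /=; apply/andP; split; [lra|apply/orP; right; lra].
(* Countably many rational lines, and countably many sets [base] with growing bounds; the threshold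
   [n.+1] keeps [X0] positive. *)
pose L n : set 'rV[R]_2 := if unpickle n is Some (a, b, c) then
  if (a != 0) || (b != 0) then [set t | a%:~R * t 0 0 + b%:~R * t 0 1 + c%:~R = 0] else set0
  else set0.
have cover : Sing_star mu `<=` (\bigcup_n L n) `|` \bigcup_n [set t | base (n%:R) (n.+1%:R) nu t].
  move=> t st; have [off|] := pselect (off_lines t); last first.
    move=> /existsNP[a] /existsNP[b] /existsNP[c] /not_implyP[ab] /negP; rewrite negbK => /eqP e.
    left; exists (pickle (a, b, c)); first exact: I.
    by rewrite /L pickleK ab.
  right; have num : nu <= mu by rewrite /nu ge_min lexx.
  have [X0 X01 U] := sing_unif num st.
  pose T := Num.max X0 (Num.max `|t 0 0| `|t 0 1|).
  have T0 : 0 <= T by rewrite /T le_max (le_trans ler01 X01).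
  have : T <= (Num.truncn T).+1%:R by case/andP: (truncn_itv T0) => _ /ltW.
  rewrite /T !ge_max => /and3P[h0 h1 h2].
  exists (Num.truncn T).+1; first exact: I.
  split => //; apply: U; apply: le_trans h0 _; by rewrite ler_nat.
have s0 : 1 < s by case/andP: s432 => *; lra.
apply: measure0_sub cover _.
have E : (\bigcup_n L n) `|` \bigcup_n [set t | base (n%:R) (n.+1%:R) nu t] `<=`
   \bigcup_k (if k is k'.+1 then \bigcup_n [set t : 'rV[R]_2 | base (n%:R) (n.+1%:R) nu t] else \bigcup_n L n).
  by move=> t [h|h]; [exists 0%N|exists 1%N].
apply: measure0_sub E _; apply: measure0_bigcup => -[|_]; apply: measure0_bigcup => n.
  rewrite /L; case: (unpickle n) => [[[a b] c]|]; last first.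
    by apply/measure0P => d d0; rewrite content_set0 // ltW.
  case: ifP => ab; last by apply/measure0P => d d0; rewrite content_set0 // ltW.
  by apply: line_measure0 => //; rewrite !intr_eq0.
by apply: base_measure0.
Qed.

End upper_bound.

(** * The limit of the dimensions *)

Lemma dim_near (R : realType) (e : R) : 0 < e ->
  \forall mu \near (1 / 2 : R)^'+,
    ((4 / 3 - e)%:E <= hausdorff_dim (@Sing_star R mu) <= (4 / 3 + e)%:E)%E.
Proof.
(* [d <= 1 / 2] keeps [4 / 3 - d] positive and [4 / 3 + d] below 2. *)
move=> e0; have [d [d0 d2 de]] : exists d, [/\ 0 < d, d <= 1 / 2 & d <= e].
  by exists (Num.min (1 / 2) e); rewrite lt_min e0 !ge_min !lexx orbT andbT; split=> //; lra.
(* Only the lower bound restricts [mu] to a neighbourhood of 1/2; the upper bound holds for all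
   [mu > 1/2]. *)
have [|mu1 mu1h low] := @lower_bound R (4 / 3 - d); first by lra.
near=> mu; have mu0 : 1 / 2 < mu by [].
have muE : mu <= mu1 by near: mu; exact: nbhs_right_le.
apply/andP; split.
  apply: (@le_trans _ _ (4 / 3 - d)%:E); first by rewrite lee_fin; lra.
  by apply: dim_ge; [lra|exact: low].
apply: (@le_trans _ _ (4 / 3 + d)%:E); last by rewrite lee_fin; lra.
by apply: dim_le; [lra|apply: sing_measure0 => //; lra].
Unshelve. all: by end_near. Qed.

Theorem corollary4 (R : realType) :
  hausdorff_dim (@Sing_star R mu) @[mu --> ((1 / 2 : R)^'+)] --> ((4 / 3 : R)%:E).
Proof.
apply/fine_cvgP; split.
  apply: filterS (@dim_near R 1 ltr01) => mu /andP[lo hi].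
  by rewrite fin_numE; apply/andP; split; apply/eqP => E; move: lo hi; rewrite E.
apply/cvgrPdist_le => e e0; apply: filterS (dim_near e0) => mu /andP[] /=.
case: (hausdorff_dim _) => [r| |] //=.
by rewrite !lee_fin ler_norml => *; lra.
Qed.
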